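(* Let $P\in\mathcal{O}\setminus\{0\}$, $P(0)=0$, and $s>0$. Suppose that the $P$-sectors $\Pi_j=\Pi_P(a_j,b_j;r)$, $1\le j\le m$, form a cover of $D(0;r)\setminus\{x: P(x)=0\}$. Let $f_j:\Pi_j\to\mathbb{C}$, $j=1,\dots,m$, be bounded and analytic, and assume that there exists $\gamma>0$ such that for every couple $(j_1,j_2)$ with $\Pi_{j_1}\cap\Pi_{j_2}\neq\emptyset$ $$|f_{j_1}(x)-f_{j_2}(x)|=O\big(\exp(-\gamma/|P(x)|^{1/s})\big)\quad\text{for }x\in\Pi_{j_1}\cap\Pi_{j_2}.$$ Then the functions $f_j$ have $P$-$s$-Gevrey asymptotic expansions on $\Pi_j$ with a common right hand side, i.e. there is a single $\hat f\in\hat{\mathcal{O}}$ which is the $P$-$s$-Gevrey asymptotic expansion of $f_j$ on $\Pi_j$ for every $j$.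
   Context: Fix an integer $d\ge2$. $D(0;r)=\{x\in\mathbb{C}^d:|x_j|<r\ \forall j\}$. $\mathcal{O}=\mathbb{C}\{x_1,\dots,x_d\}$, $\hat{\mathcal{O}}=\mathbb{C}[[x_1,\dots,x_d]]$ with maximal ideal $\mathfrak{m}$; $\mathcal{O}_b(U)$ = bounded holomorphic functions on $U$. For $a<b$, $b-a\le2\pi$, $r>0$: $\Pi_P(a,b;r)=\{x\in\mathbb{C}^d:|x_j|<r\ \forall j,\ P(x)\ne0,\ a<\arg P(x)<b\}$, with $r$ such that $P$ is holomorphic on $D(0;r)$. Let $\Pi$ be a $P$-sector and $f\in\mathcal{O}(\Pi)$. $\hat f\in\hat{\mathcal{O}}$ is the $P$-$s$-Gevrey asymptotic expansion of $f$ on $\Pi$ if there exist $\rho>0$, a family $f_n\in\mathcal{O}_b(D(0;\rho))$, $n\in\mathbb{N}$, whose Taylor series at $0$ converge to $\hat f$ in the $\mathfrak{m}$-adic topology, and constants $K,A>0$ such that for all $n\in\mathbb{N}$: $|f_n(x)|\le KA^n\Gamma(sn+1)$ for $x\in D(0;\rho)$, and $|f(x)-f_n(x)|\le KA^n\Gamma(sn+1)|P(x)|^n$ for $x\in\Pi\cap D(0;\rho)$. *)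

(* Defs.v *)
From HB Require Import structures.
From mathcomp Require Import all_boot all_order all_algebra.
From mathcomp Require Import all_classical all_reals all_analysis.
From mathcomp Require Import complex.

Set Implicit Arguments.
Unset Strict Implicit.
Unset Printing Implicit Defensive.
Import Order.TTheory GRing.Theory Num.Theory.
Import numFieldNormedType.Exports ComplexField.Normc.

Local Open Scope classical_set_scope.
Local Open Scope ring_scope.
Local Open Scope complex_scope.

(* The library instances that make 'rV[K]_d a normed K-module are keyed on the
   coercion from numFieldType to types, which R[i] alone does not exhibit. *)
Definition CC (R : realType) : numFieldType := R[i].

Definition Gamma (R : realType) (z : R) : R :=
  \int[lebesgue_measure]_(t in `]0, +oo[) (t `^ (z - 1) * expR (- t)).

Section HolomorphicFunctions.
Variables (R : realType) (d : nat).

Definition polydisc (r : R) : set 'rV[CC R]_d :=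
  [set x | forall j, normc (x 0 j) < r].

(* Only meant for open U: [differentiable] is Frechet differentiability over
   the field of complex numbers, with respect to full neighbourhoods of x. *)
Definition holomorphic_on (U : set 'rV[CC R]_d) (f : 'rV[CC R]_d -> CC R) :=
  forall x, U x -> differentiable f x.

Definition bounded_on (U : set 'rV[CC R]_d) (f : 'rV[CC R]_d -> CC R) :=
  exists M : R, forall x, U x -> normc (f x) <= M.

End HolomorphicFunctions.

Section FormalPowerSeries.
Variables (R : realType) (d : nat).

(* A formal power series is the family of its coefficients, indexed by
   multi-indices; addition is pointwise, but the product is [fps_mul]. *)
Definition fps := {ffun 'I_d -> nat} -> CC R.

Definition fps_mul (f g : fps) : fps := fun al =>
  \sum_(be : {dffun forall j : 'I_d, 'I_(al j).+1})
    f [ffun j => be j : nat] * g [ffun j => (al j - be j)%N].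

Definition fps_max_ideal : set fps := [set f | f [ffun=> 0%N] = 0].

Fixpoint fps_max_ideal_pow (N : nat) : set fps :=
  if N is N'.+1 then
    [set f | exists k (g h : 'I_k -> fps),
       (forall i, fps_max_ideal (g i) /\ fps_max_ideal_pow N' (h i)) /\
       f = \sum_(i < k) fps_mul (g i) (h i)]
  else setT.

Definition madic_cvg (u : nat -> fps) (f : fps) :=
  forall N : nat, exists n0 : nat, forall n : nat, (n0 <= n)%N ->
    fps_max_ideal_pow N (u n - f).

Definition partial_derive (al : {ffun 'I_d -> nat})
    (f : 'rV[CC R]_d -> CC R) : 'rV[CC R]_d -> CC R :=
  foldr (fun j g => iter (al j) (fun h x => 'D_(delta_mx 0 j) h x) g)
    f (enum 'I_d).

Definition taylor (f : 'rV[CC R]_d -> CC R) : fps := fun al =>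
  partial_derive al f 0 / (\prod_(j < d) (al j)`!)%:R.

End FormalPowerSeries.

Section GevreyExpansions.
Variables (R : realType) (d : nat).

Definition is_arg (z : CC R) (theta : R) :=
  z = (normc z * cos theta) +i* (normc z * sin theta).

(* As the argument is multivalued, a < arg (P x) < b means that some
   determination of it lies in ]a, b[. *)
Definition P_sector (P : 'rV[CC R]_d -> CC R) (a b r : R) :
    set 'rV[CC R]_d :=
  [set x | polydisc r x /\ P x <> 0 /\
           exists theta : R, a < theta < b /\ is_arg (P x) theta].

Definition gevrey_expansion (P : 'rV[CC R]_d -> CC R) (s : R)
    (Pi : set 'rV[CC R]_d) (f : 'rV[CC R]_d -> CC R) (fhat : fps R d) :=
  exists (rho : R) (fn : nat -> 'rV[CC R]_d -> CC R) (K A : R),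
    [/\ 0 < rho, 0 < K & 0 < A] /\
    [/\ forall n, holomorphic_on (polydisc rho) (fn n) /\
                  bounded_on (polydisc rho) (fn n),
        madic_cvg (fun n => taylor (fn n)) fhat,
        forall n x, polydisc rho x ->
          normc (fn n x) <= K * A ^+ n * Gamma (s * n%:R + 1) &
        forall n x, Pi x -> polydisc rho x ->
          normc (f x - fn n x) <=
            K * A ^+ n * Gamma (s * n%:R + 1) * normc (P x) ^+ n].

End GevreyExpansions.

(* Main.v *)
Require Import Defs.
From HB Require Import structures.
From mathcomp Require Import all_boot all_order all_algebra.
From mathcomp Require Import all_classical all_reals all_analysis.
From mathcomp Require Import measurable_realfun.
From mathcomp Require Import complex.
From mathcomp Require Import ring lra zify.

Set Implicit Arguments.
Unset Strict Implicit.
Unset Printing Implicit Defensive.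
Import Order.TTheory GRing.Theory Num.Theory.
Import numFieldNormedType.Exports ComplexField.Normc.

Local Open Scope classical_set_scope.
Local Open Scope ring_scope.
Local Open Scope complex_scope.

(** Near 0 every sector is the preimage under [P] of an open cone [S j], so the theorem
    would follow from its one-variable version (the Ramis-Sibuya theorem) if
    [f j x] were a function of [P x]. It is enough to make it a function of
    [(x, t)] evaluated at [t = P x]: [lift] builds [F j x t], holomorphic in [x]
    near 0 and in [t] in the cone [S j], with [F j x (P x) = f j x], by summing
    residues over the points of the fibre [P = t] on a fixed complex line
    through [x]. The lift costs a factor [t ^- 2], but it is linear, so the
    differences of the lifts stay exponentially small in [t].

    For fixed [x] the functions [t ^+ 2 * F j x t] are then bounded and differ
    by flat terms. They are glued with cutoff functions that depend on the
    direction of [t] only, and Cauchy's formula is applied to the glued function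
    with the kernel [t ^+ n / (z ^+ n * (z - t))]. Around 0 this gives
    coefficients [acoef k x], around [t] the value at [t], and on the circular
    shells in between only the flat differences contribute (lemmas [shell] and
    [glue_expansion]). Flatness to all orders, with constants of Gevrey type,
    comes from [y ^ a * exp (- y) <= e * Gamma (a + 1)] (lemma [gamma_lower]).
    The coefficients are holomorphic in [x], and [t = P x] gives an expansion of
    [P ^+ 2 * f j] in powers of [P], the same for all [j].

    It remains to divide by [P ^+ 2]. The quotient of the first two terms,
    [principal], is bounded off the zeros of [P], because all other terms are;
    a line of a suitable direction through a point where [P] is not zero meets
    these zeros finitely often near that point, and a Cauchy formula along such
    lines continues [principal] to a holomorphic function [regular]. The approximations are
    [regular x + \sum_(k < n) P x ^+ k * acoef k.+2 x]; two consecutive ones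
    differ by a multiple of [P ^+ n], whence the m-adic convergence of their
    Taylor series.

    All integrals in the complex plane are of the form
    [\int (dk/dzbar) * q] with a Lipschitz cutoff function [k] of compact
    support: they vanish when [q] is holomorphic on the support of [k], and
    replace contour integrals by sums over grids, in which neither the shape of
    a contour nor its parametrization matters. The sums are passed to the limit
    along an ultrafilter, so that their convergence need not be proved:
    boundedness gives a linear functional ([cint]), and Goursat's bisection argument gives
    its vanishing on holomorphic functions ([goursat], [green]). Uniform
    quadratic Taylor estimates, which survive bounded generalized limits, take
    the place of differentiation under the integral sign ([clim_hol],
    [gsum_hol]). *)

(* [lra] without the equations between complex numbers of the context, which it
   would try to interpret in an ordered ring *)
Ltac lraR := repeat match goal with
  | H : @eq ?T _ _ |- _ => match T with context [CC] => clear H end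
  end; lra.


(** * Complex numbers: modulus and generalized limits *)

Section Modulus.
Variable R : realType.
Local Notation C := (CC R).
Implicit Types x y z : C.

Lemma cnormD x y : normc (x + y) <= normc x + normc y.
Proof. exact: le_normcD. Qed.

Lemma cnormM x y : normc (x * y) = normc x * normc y.
Proof. exact: normcM. Qed.

Lemma cnormN x : normc (- x) = normc x.
Proof. exact: normcN. Qed.

Lemma cnormV x : normc x^-1 = (normc x)^-1.
Proof. exact: normcV. Qed.

Lemma cnorm0 : normc (0 : C) = 0. Proof. exact: normc0. Qed.
Lemma cnorm1 : normc (1 : C) = 1. Proof. exact: normc1. Qed.

Lemma cnorm_ge0 x : 0 <= normc x.
Proof. by case: x => a b; rewrite /normc sqrtr_ge0. Qed.

Lemma cnorm_eq0 x : (normc x == 0) = (x == 0).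
Proof.
apply/eqP/eqP => [/eq0_normc //|->]; exact: cnorm0.
Qed.

Lemma cnorm_gt0 x : (0 < normc x) = (x != 0).
Proof. by rewrite lt_def cnorm_eq0 cnorm_ge0 andbT. Qed.

Lemma cnormX x n : normc (x ^+ n) = normc x ^+ n.
Proof.
elim: n => [|n IH]; first by rewrite !expr0 cnorm1.
by rewrite !exprS cnormM IH.
Qed.

Lemma cdistC x y : normc (x - y) = normc (y - x).
Proof. by rewrite -cnormN opprB. Qed.

Lemma cnormB x y : normc (x - y) <= normc x + normc y.
Proof. by rewrite -(cnormN y) cnormD. Qed.

Lemma cdist_triangle z x y : normc (x - y) <= normc (x - z) + normc (z - y).
Proof. by rewrite -(subrKA z) cnormD. Qed.

Lemma cnorm_sub x y : normc x - normc y <= normc (x - y).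
Proof. by rewrite lerBlDr -{1}(subrK y x) cnormD. Qed.

Lemma cnorm_dist x y : `|normc x - normc y| <= normc (x - y).
Proof.
rewrite ler_norml cnorm_sub andbT lerNl opprB cdistC; exact: cnorm_sub.
Qed.

Lemma cnorm_real (r : R) : normc (r%:C : C) = `|r|.
Proof. by rewrite /normc /= expr0n /= addr0 sqrtr_sqr. Qed.

Lemma normr_cnorm x : `|x| = (normc x)%:C.
Proof. by []. Qed.

Lemma cnormE x : normc x = Num.sqrt (complex.Re x ^+ 2 + complex.Im x ^+ 2).
Proof. by case: x. Qed.

Lemma sqr_cnorm x : normc x ^+ 2 = complex.Re x ^+ 2 + complex.Im x ^+ 2.
Proof. by rewrite cnormE sqr_sqrtr // addr_ge0 ?sqr_ge0. Qed.

Lemma Re_le_cnorm x : `|complex.Re x| <= normc x.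
Proof.
rewrite -[leLHS]sqrtr_sqr cnormE ler_sqrt ?addr_ge0 ?sqr_ge0 //.
by rewrite lerDl sqr_ge0.
Qed.

Lemma Im_le_cnorm x : `|complex.Im x| <= normc x.
Proof.
rewrite -[leLHS]sqrtr_sqr cnormE ler_sqrt ?addr_ge0 ?sqr_ge0 //.
by rewrite lerDr sqr_ge0.
Qed.

Lemma cnorm_le_ReIm x : normc x <= `|complex.Re x| + `|complex.Im x|.
Proof.
rewrite -(@ler_pXn2r _ 2) ?nnegrE ?addr_ge0 ?cnorm_ge0 //.
rewrite sqr_cnorm sqrrD !real_normK ?num_real // lerD2r lerDl.
by rewrite mulrn_wge0 // mulr_ge0.
Qed.

Lemma ReB x y : complex.Re (x - y) = complex.Re x - complex.Re y.
Proof. by case: x; case: y. Qed.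
Lemma ImB x y : complex.Im (x - y) = complex.Im x - complex.Im y.
Proof. by case: x; case: y. Qed.
Lemma ReD x y : complex.Re (x + y) = complex.Re x + complex.Re y.
Proof. by case: x; case: y. Qed.
Lemma ImD x y : complex.Im (x + y) = complex.Im x + complex.Im y.
Proof. by case: x; case: y. Qed.

Lemma cnorm_sum (I : Type) (r : seq I) (P : pred I) (F : I -> C) :
  normc (\sum_(i <- r | P i) F i) <= \sum_(i <- r | P i) normc (F i).
Proof.
elim/big_ind2 : _ => //; first by rewrite cnorm0.
by move=> x1 x2 y1 y2 h1 h2; apply: le_trans (cnormD _ _) _; exact: lerD.
Qed.

Lemma rcD (a b : R) : ((a + b)%:C : C) = a%:C + b%:C.
Proof. exact: rmorphD. Qed.
Lemma rcB (a b : R) : ((a - b)%:C : C) = a%:C - b%:C.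
Proof. exact: rmorphB. Qed.
Lemma rcM (a b : R) : ((a * b)%:C : C) = a%:C * b%:C.
Proof. exact: rmorphM. Qed.
Lemma rcV (a : R) : ((a^-1)%:C : C) = (a%:C)^-1.
Proof. exact: fmorphV. Qed.
Lemma rc_eq0 (a : R) : ((a%:C : C) == 0) = (a == 0).
Proof. by rewrite -cnorm_eq0 cnorm_real normr_eq0. Qed.

End Modulus.

Section GeneralizedLimit.
Variable R : realType.
Local Notation C := (CC R).

Lemma ultra_exists : exists U : set_system nat,
  UltraFilter U /\ (\oo `<=` U)%classic.
Proof. by have [U [h1 h2]] := ultraFilterLemma (F := \oo); exists U. Qed.

(** Limits along an ultrafilter exist for every bounded sequence and depend
    linearly on it, so that Riemann sums define integrals without any proof of
    convergence. *)
Definition ultra := projT1 (cid ultra_exists).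

#[local] Instance ultra_ultra : UltraFilter ultra.
Proof. by rewrite /ultra; case: cid => U []. Qed.

Lemma ultra_oo : (\oo `<=` ultra)%classic.
Proof. by rewrite /ultra; case: cid => U []. Qed.

Definition rlim (u : nat -> R) : R := lim (u @ ultra).
Definition clim (u : nat -> C) : C :=
  rlim (fun n => complex.Re (u n)) +i* rlim (fun n => complex.Im (u n)).

Definition rbounded (u : nat -> R) :=
  exists (M : R) (N0 : nat), forall n, (N0 <= n)%N -> `|u n| <= M.
Definition ev_le (u : nat -> C) (M : R) :=
  exists N0, forall n, (N0 <= n)%N -> normc (u n) <= M.
Definition bdd (u : nat -> C) := exists M, ev_le u M.

Lemma ultra_ev (P : nat -> Prop) :
  (exists N0, forall n, (N0 <= n)%N -> P n) -> ultra P.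
Proof. by move=> [N0 h]; apply: ultra_oo; exists N0. Qed.

Lemma rlim_cvg u : rbounded u -> u @ ultra --> rlim u.
Proof.
move=> [M [N0 uM]].
have uK : (u @ ultra) `[(- M), M]%classic.
  apply: ultra_ev; exists N0 => n Nn.
  by rewrite /= in_itv /= -ler_norml; exact: uM.
have [p [_ up]] := @segment_compact R (- M) M _ (fmap_proper_filter u _) uK.
rewrite /rlim; suff up1 : u @ ultra --> p by exact: (cvgP p).
move=> B Bp.
have [//|h] := in_ultra_setVsetC (u @^-1` B) ultra_ultra.
have [x [/= hx]] := up _ _ (h : (u @ ultra) (~` B)) Bp.
by [].
Qed.

Lemma rlimD u v : rbounded u -> rbounded v ->
  rlim (fun n => u n + v n) = rlim u + rlim v.
Proof.
move=> /rlim_cvg uu /rlim_cvg vv.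
by apply: cvg_lim => //; exact: (cvgD uu vv).
Qed.

Lemma rlimZ k u : rbounded u -> rlim (fun n => k * u n) = k * rlim u.
Proof. by move=> /rlim_cvg uu; apply: cvg_lim => //; exact: cvgMr. Qed.

Lemma rlim_le u (M : R) : rbounded u ->
  (exists N0, forall n, (N0 <= n)%N -> u n <= M) -> rlim u <= M.
Proof.
move=> /rlim_cvg uu h; rewrite leNgt; apply/negP => lt.
have h1 : ultra (fun n => M < u n) by exact: (uu [set x | M < x] (lt_nbhsr lt)).
have [n /= [h2 h3]] := @filter_ex _ ultra _ _ (filterI h1 (ultra_ev h)).
by move: h2; rewrite ltNge h3.
Qed.

Lemma bddRe u : bdd u -> rbounded (fun n => complex.Re (u n)).
Proof.
move=> [M [N0 h]]; exists M, N0 => n /h; apply: le_trans; exact: Re_le_cnorm.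
Qed.
Lemma bddIm u : bdd u -> rbounded (fun n => complex.Im (u n)).
Proof.
move=> [M [N0 h]]; exists M, N0 => n /h; apply: le_trans; exact: Im_le_cnorm.
Qed.

Lemma clim_cst c : clim (fun=> c) = c.
Proof.
by case: c => a b; rewrite /clim /rlim /=; congr Complex; apply: lim_cst.
Qed.

Lemma climD u v : bdd u -> bdd v -> clim (fun n => u n + v n) = clim u + clim v.
Proof.
move=> bu bv; rewrite /clim.
have -> : (fun n => complex.Re (u n + v n)) =
  (fun n => complex.Re (u n) + complex.Re (v n)) by apply/funext => n; rewrite ReD.
have -> : (fun n => complex.Im (u n + v n)) =
  (fun n => complex.Im (u n) + complex.Im (v n)) by apply/funext => n; rewrite ImD.
by rewrite !rlimD //; [exact: bddIm|exact: bddIm|exact: bddRe|exact: bddRe].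
Qed.

Lemma rboundedZ k u : rbounded u -> rbounded (fun n => k * u n).
Proof.
move=> [M [N0 h]]; exists (`|k| * M), N0 => n /h hn.
by rewrite normrM ler_wpM2l.
Qed.

Lemma climZ k u : bdd u -> clim (fun n => k * u n) = k * clim u.
Proof.
move=> bu; rewrite /clim; case: k => a b.
have uR := bddRe bu; have uI := bddIm bu.
have -> : (fun n => complex.Re ((a +i* b : C) * u n)) =
  (fun n => a * complex.Re (u n) + (- b) * complex.Im (u n)).
  by apply/funext => n; case: (u n) => x y /=; rewrite mulNr.
have -> : (fun n => complex.Im ((a +i* b : C) * u n)) =
  (fun n => a * complex.Im (u n) + b * complex.Re (u n)).
  by apply/funext => n; case: (u n) => x y /=.
rewrite !rlimD ?rlimZ //; try exact: rboundedZ.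
by apply/eqP; rewrite eq_complex /= mulNr !eqxx.
Qed.

Lemma climM u k : bdd u -> clim (fun n => u n * k) = clim u * k.
Proof.
by move=> bu; rewrite [RHS]mulrC -climZ //; congr clim; apply/funext => n; rewrite mulrC.
Qed.

Lemma clim_le u M : ev_le u M -> normc (clim u) <= M.
Proof.
move=> uM; have bu : bdd u by exists M.
have [->|l0] := eqVneq (clim u) 0.
  rewrite cnorm0; have [N0 /(_ N0 (leqnn _)) h] := uM.
  exact: le_trans (cnorm_ge0 _) h.
(* rotate the limit onto the positive axis and take real parts *)
pose w : C := (clim u)^-1 * (normc (clim u))%:C.
have w1 : normc w = 1.
  by rewrite cnormM cnormV cnorm_real ger0_norm ?cnorm_ge0 // mulVf // cnorm_eq0.
have e : clim (fun n => w * u n) = (normc (clim u))%:C.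
  by rewrite climZ // /w mulrAC mulVf // mul1r.
have : complex.Re (clim (fun n => w * u n)) <= M.
  have [N0 h] := uM.
  have h' n : (N0 <= n)%N -> normc (w * u n) <= M.
    by move=> /h; rewrite cnormM w1 mul1r.
  apply: rlim_le.
    by apply: bddRe; exists M, N0.
  exists N0 => n Nn; apply: le_trans (h' n Nn).
  exact: le_trans (ler_norm _) (Re_le_cnorm _).
by rewrite e.
Qed.

Lemma clim_eq u v : bdd u -> (forall e, 0 < e -> ev_le (fun n => v n - u n) e) ->
  clim v = clim u.
Proof.
move=> bu h; have bd : bdd (fun n => v n - u n) by exists 1; apply: h.
have -> : v = (fun n => u n + (v n - u n)).
  by apply/funext => n; rewrite addrC subrK.
rewrite climD //; suff -> : clim (fun n => v n - u n) = 0 by rewrite addr0.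
apply/eqP; rewrite -cnorm_eq0 eq_le cnorm_ge0 andbT.
by apply/ler_addgt0Pl => e e0; rewrite addr0; apply: clim_le; exact: h.
Qed.

Definition nul (u : nat -> C) := forall e, 0 < e -> ev_le u e.

Lemma nul_bdd u : nul u -> bdd u. Proof. by move=> h; exists 1; exact: h. Qed.

Lemma clim0 u : nul u -> clim u = 0.
Proof.
move=> h; rewrite -[RHS]clim_cst; apply: clim_eq.
  by exists 0; exists 0%N => n _; rewrite cnorm0.
move=> e e0; have [N0 hN] := h e e0; exists N0 => n /hN.
by rewrite subr0.
Qed.

Lemma ev_leD u v a b : ev_le u a -> ev_le v b -> ev_le (fun n => u n + v n) (a + b).
Proof.
move=> [N1 h1] [N2 h2]; exists (maxn N1 N2) => n; rewrite geq_max => /andP[n1 n2].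
by apply: le_trans (cnormD _ _) _; apply: lerD; [exact: h1|exact: h2].
Qed.

Lemma ev_leZ k u a : ev_le u a -> ev_le (fun n => k * u n) (normc k * a).
Proof.
move=> [N1 h1]; exists N1 => n /h1 h; rewrite cnormM ler_wpM2l //; exact: cnorm_ge0.
Qed.

Lemma ev_le_mono u a b : a <= b -> ev_le u a -> ev_le u b.
Proof. by move=> ab [N1 h1]; exists N1 => n /h1 h; apply: le_trans ab. Qed.

Lemma bddD u v : bdd u -> bdd v -> bdd (fun n => u n + v n).
Proof. by move=> [a ha] [b hb]; exists (a + b); exact: ev_leD. Qed.
Lemma bddZ k u : bdd u -> bdd (fun n => k * u n).
Proof. by move=> [a ha]; exists (normc k * a); exact: ev_leZ. Qed.

Lemma nulD u v : nul u -> nul v -> nul (fun n => u n + v n).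
Proof.
move=> hu hv e e0; rewrite [e]splitr; apply: ev_leD; [apply: hu|apply: hv];
  by rewrite divr_gt0.
Qed.
Lemma nulZ k u : nul u -> nul (fun n => k * u n).
Proof.
move=> hu e e0; have h : 0 < normc k + 1 by rewrite ltr_wpDl ?cnorm_ge0.
apply: (@ev_le_mono _ (normc k * (e / (normc k + 1)))).
  rewrite mulrCA ger_pMr // ler_pdivrMr // mul1r lerDl //.
by apply: ev_leZ; apply: hu; rewrite divr_gt0.
Qed.

Lemma nul_ext u v : (forall n, u n = v n) -> nul u -> nul v.
Proof. by move=> /funext ->. Qed.

End GeneralizedLimit.

(** * Complex differentiability by estimates *)

Section RealNorm.
Variables (R : realType) (V : normedModType (CC R)).
Local Notation C := (CC R).

(** Norms of modules over the complex numbers are complex valued; this is the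
    real number behind. *)
Definition nrm (v : V) : R := complex.Re `|v|.

Lemma nrmE (v : V) : `|v| = (nrm v)%:C.
Proof.
rewrite /nrm; have := normr_ge0 v; case: `|v| => a b.
by rewrite lecE /= => /andP[/eqP -> _].
Qed.

Lemma nrm_ge0 v : 0 <= nrm v.
Proof. by have := normr_ge0 v; rewrite nrmE lecR. Qed.

Lemma nrmD v w : nrm (v + w) <= nrm v + nrm w.
Proof. by have := ler_normD v w; rewrite !nrmE -rcD lecR. Qed.

Lemma nrmZ (k : C) v : nrm (k *: v) = normc k * nrm v.
Proof.
have h := normrZ k v; rewrite (nrmE v) (nrmE (k *: v)) normr_cnorm -rcM in h.
by move/complexI : h.
Qed.

Lemma nrmN v : nrm (- v) = nrm v.
Proof. by rewrite /nrm normrN. Qed.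

Lemma nrm0 : nrm 0 = 0.
Proof. by rewrite /nrm normr0. Qed.

Lemma nrm_eq0 v : (nrm v == 0) = (v == 0).
Proof. by rewrite -(normr_eq0 v) nrmE rc_eq0. Qed.

Lemma nrm_gt0 v : (0 < nrm v) = (v != 0).
Proof. by rewrite lt_def nrm_eq0 nrm_ge0 andbT. Qed.

Lemma nearP (x : V) (A : V -> Prop) :
  (\forall y \near x, A y) <->
  (exists d : R, 0 < d /\ forall y, nrm (y - x) < d -> A y).
Proof.
split=> [/nbhs_normP[d /= d0 h]|[d [d0 h]]].
  have dE : d = (complex.Re d)%:C.
    by move: d0; case: (d) => a b; rewrite ltcE /= => /andP[/eqP -> _].
  exists (complex.Re d); split.
    by move: d0; rewrite dE ltcR.
  move=> y hy; apply: h => /=; rewrite /ball_ /= -normrN opprB nrmE dE ltcR //.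
apply/nbhs_normP; exists (d%:C) => /=; first by rewrite ltcR.
move=> y /=; rewrite -normrN opprB nrmE ltcR; exact: h.
Qed.

End RealNorm.

Lemma nrmC (R : realType) (z : CC R) : nrm z = normc z.
Proof. by []. Qed.

Section DiffEps.
Variables (R : realType) (V : normedModType (CC R)).
Local Notation C := (CC R).

Lemma diff_eps (f : V -> C) (x : V) : differentiable f x ->
  forall e, 0 < e -> exists d, 0 < d /\ forall h, nrm h < d ->
    normc (f (h + x) - f x - 'd f x h) <= e * nrm h.
Proof.
move=> /diff_locally df e e0.
have eC : 0 < (e%:C : C) by rewrite ltcR.
have /eqaddoP /(_ (e%:C) eC) /nearP [d [d0 hd]] := df.
exists d; split => // h hh; have := hd h; rewrite subr0 => /(_ hh).
have -> : `|(id : V -> V) h| = (nrm h)%:C by rewrite nrmE.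
have -> : (f \o shift x - (cst (f x) + 'd f x)) h = f (h + x) - f x - 'd f x h.
  by rewrite -[LHS]/(f (h + x) - (f x + 'd f x h)) opprD addrA.
by rewrite nrmE -rcM lecR.
Qed.

Lemma diff_of_eps (f : V -> C) (x : V) (L : {linear V -> C}) (K : R) :
  (forall h, normc (L h) <= K * nrm h) ->
  (forall e, 0 < e -> exists d, 0 < d /\ forall h, nrm h < d ->
    normc (f (h + x) - f x - L h) <= e * nrm h) ->
  differentiable f x /\ ('d f x : V -> C) = L.
Proof.
move=> LK fL.
have Lc : continuous L.
  apply: bounded_linear_continuous; apply/ex_bound; exists (`|K|%:C).
  apply/nearP; exists 1; split => // y /=; rewrite subr0 => y1.
  rewrite nrmE lecR nrmC; apply: le_trans (LK y) _.
  apply: le_trans (ler_wpM2r (nrm_ge0 _) (ler_norm K)) _.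
  by rewrite ler_piMr // ltW.
have fo : f \o shift x = cst (f x) + L +o_ 0 id.
  apply/eqaddoP => e e0.
  have eE : e = (complex.Re e)%:C.
    by move: e0; case: (e) => a b; rewrite ltcE /= => /andP[/eqP -> _].
  rewrite eE; move: e0; rewrite eE ltcR => e0.
  have [d [d0 hd]] := fL _ e0.
  apply/nearP; exists d; split => // h; rewrite subr0 => hh.
  have -> : `|(id : V -> V) h| = (nrm h)%:C by rewrite nrmE.
  have -> : (f \o shift x - (cst (f x) + L)) h = f (h + x) - f x - L h.
    by rewrite -[LHS]/(f (h + x) - (f x + L h)) opprD addrA.
  by rewrite nrmE -rcM lecR; exact: hd.
have dE := diff_unique Lc fo; split; last exact: dE.
apply/diff_locallyP; rewrite dE; split; [exact: Lc|exact: fo].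
Qed.

(** The form in which holomorphy is obtained for limits: the candidate for the
    differential is a limit too, and a quadratic remainder survives. *)
Lemma diff_of_quad (f : V -> C) (x : V) (L : {linear V -> C}) (K C0 d : R) :
  (forall h, normc (L h) <= K * nrm h) ->
  0 < d -> (forall h, nrm h < d -> normc (f (h + x) - f x - L h) <= C0 * nrm h ^+ 2) ->
  differentiable f x /\ ('d f x : V -> C) = L.
Proof.
move=> LK d0 hd; apply: (@diff_of_eps _ _ _ K) => // e e0.
have c0 : 0 < `|C0| + 1 by rewrite ltr_wpDl.
exists (Num.min d (e / (`|C0| + 1))); split.
  by rewrite lt_min d0 divr_gt0.
move=> h; rewrite lt_min => /andP[h1 h2]; apply: le_trans (hd h h1) _.
rewrite expr2 mulrA ler_wpM2r ?nrm_ge0 //.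
apply: le_trans (ler_wpM2r (nrm_ge0 _) (ler_norm C0)) _.
rewrite ltr_pdivlMr // in h2; apply: le_trans (ltW h2).
by rewrite mulrC ler_wpM2l ?nrm_ge0 // lerDl.
Qed.

Lemma diff_near (f g : V -> C) (x : V) : (\forall y \near x, f y = g y) ->
  differentiable f x -> differentiable g x /\ ('d g x : V -> C) = 'd f x.
Proof.
move=> /nearP [d0 [d00 hfg]] df.
have [K K0 hK] := linear_lipschitz (diff_continuous df).
apply: (@diff_of_eps _ _ _ (complex.Re K)).
  move=> h; have := hK h; rewrite !nrmE nrmC => hK'.
  have KE : K = (complex.Re K)%:C.
    by move: K0; case: (K) => a b; rewrite ltcE /= => /andP[/eqP -> _].
  by move: hK'; rewrite KE -rcM lecR.
move=> e e0; have [d [dp hd]] := diff_eps df e0.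
exists (Num.min d d0); split; first by rewrite lt_min dp d00.
move=> h; rewrite lt_min => /andP[h1 h2].
rewrite -!hfg; first exact: hd.
- by rewrite subrr nrm0.
- by rewrite addrK.
Qed.

End DiffEps.

Section ComplexDifferentiability.
Variable R : realType.
Local Notation C := (CC R).
Implicit Types (f g : C -> C) (c : C).

Definition cdiff f c := differentiable (f : C -> C) c.

Lemma cdiff_eps f c : cdiff f c -> exists l : C, forall e, 0 < e ->
  exists d, 0 < d /\ forall z, normc (z - c) < d ->
    normc (f z - f c - l * (z - c)) <= e * normc (z - c).
Proof.
move=> df; exists ('d f c 1) => e e0; have [d [d0 hd]] := diff_eps df e0.
exists d; split => // z hz; have := hd (z - c); rewrite !nrmC => /(_ hz).
rewrite subrK; suff -> : 'd f c (z - c) = 'd f c 1 * (z - c) by [].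
have e1 : z - c = (z - c) *: (1 : C) by exact: esym (mulr1 (z - c)).
by rewrite [in LHS]e1 linearZ; exact: mulrC.
Qed.

Lemma cdiff_cont f c : cdiff f c -> forall e, 0 < e ->
  exists d, 0 < d /\ forall z, normc (z - c) < d -> normc (f z - f c) < e.
Proof.
move=> /cdiff_eps [l hl] e e0; have [d [d0 hd]] := hl 1 ltr01.
have k0 : 0 < 1 + normc l by rewrite ltr_wpDr ?cnorm_ge0.
exists (Num.min d (e / (1 + normc l))); split.
  by rewrite lt_min d0 divr_gt0.
move=> z; rewrite lt_min ltr_pdivlMr // => /andP[z1 z2].
apply: le_lt_trans z2; rewrite -(subrK (l * (z - c)) (f z - f c)).
apply: le_trans (cnormD _ _) _; have := hd z z1; rewrite mul1r cnormM => h.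
by rewrite (mulrDr (normc (z - c))) mulr1 (mulrC (normc l)) lerD2r.
Qed.

Lemma cdiffB f g c : cdiff f c -> cdiff g c -> cdiff (fun z => f z - g z) c.
Proof. exact: differentiableB. Qed.
Lemma cdiffM f g c : cdiff f c -> cdiff g c -> cdiff (fun z => f z * g z) c.
Proof. exact: differentiableM. Qed.
Lemma cdiffV f c : cdiff f c -> f c != 0 -> cdiff (fun z => (f z)^-1) c.
Proof. move=> h1 h2; exact: differentiableV. Qed.
Lemma cdiff_cst (k : C) c : cdiff (fun=> k) c.
Proof. exact: differentiable_cst. Qed.
Lemma cdiff_id c : cdiff (fun z => z) c.
Proof. exact: (@ex_diff _ _ _ _ _ _ _ (is_diff_id c)). Qed.
Lemma cdiffX f n c : cdiff f c -> cdiff (fun z => f z ^+ n) c.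
Proof.
move=> h; elim: n => [|n IH]; first exact: cdiff_cst.
have -> : (fun z => f z ^+ n.+1) = (fun z => f z * f z ^+ n).
  by apply/funext => z; rewrite exprS.
exact: cdiffM.
Qed.
End ComplexDifferentiability.

(** * Sums over grids *)

Section GridSums.
Variable R : realType.
Local Notation C := (CC R).
Implicit Types (z w c : C) (a b h : R).

Definition hstep h : C := h +i* 0.
Definition vstep h : C := 0 +i* h.
Definition ii : C := 0 +i* 1.
Definition gpt a b h (k l : nat) : C := (a + k%:R * h) +i* (b + l%:R * h).

Lemma gptSk a b h k l : gpt a b h k.+1 l = gpt a b h k l + hstep h.
Proof. by apply/eqP; rewrite eq_complex /= addr0 eqxx andbT -natr1; apply/eqP; ring. Qed.
Lemma gptSl a b h k l : gpt a b h k l.+1 = gpt a b h k l + vstep h.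
Proof. by apply/eqP; rewrite eq_complex /= addr0 eqxx /= -natr1; apply/eqP; ring. Qed.

Lemma hstepE h : hstep h = h%:C. Proof. by []. Qed.
Lemma vstepE h : vstep h = ii * h%:C.
Proof. by apply/eqP; rewrite eq_complex /=; apply/andP; split; apply/eqP; ring. Qed.
Lemma iiM : ii * ii = -1 :> C.
Proof. by apply/eqP; rewrite eq_complex /=; apply/andP; split; apply/eqP; ring. Qed.
Lemma cnorm_ii : normc (ii : C) = 1.
Proof. by rewrite cnormE /= expr0n /= add0r expr1n sqrtr1. Qed.
Lemma cnorm_hstep h : 0 <= h -> normc (hstep h : C) = h.
Proof. by move=> h0; rewrite hstepE cnorm_real ger0_norm. Qed.
Lemma cnorm_vstep h : 0 <= h -> normc (vstep h : C) = h.
Proof. by move=> h0; rewrite vstepE cnormM cnorm_ii mul1r cnorm_real ger0_norm. Qed.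

Definition rect (T : nmodType) (F : C -> T) a b h (n : nat) : T :=
  \sum_(k < n) \sum_(l < n) F (gpt a b h k l).

(** For a smooth [f], [2 h] times its antiholomorphic derivative, up to [o(h)]. *)
Definition dbar (f : C -> C) h z : C :=
  (f (z + hstep h) - f z) + ii * (f (z + vstep h) - f z).

Lemma eq_rect (T : nmodType) (F G : C -> T) a b h n :
  (forall z, F z = G z) -> rect F a b h n = rect G a b h n.
Proof. by move=> FG; apply: eq_bigr => k _; apply: eq_bigr => l _. Qed.

Lemma rectD (F G : C -> C) a b h n :
  rect (fun z => F z + G z) a b h n = rect F a b h n + rect G a b h n.
Proof.
by rewrite /rect -big_split; apply: eq_bigr => k _; rewrite -big_split.
Qed.

Lemma rectZ (t : C) (F : C -> C) a b h n :
  rect (fun z => t * F z) a b h n = t * rect F a b h n.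
Proof.
by rewrite /rect mulr_sumr; apply: eq_bigr => k _; rewrite mulr_sumr.
Qed.

Lemma cnorm_rect (F : C -> C) a b h n :
  normc (rect F a b h n) <= rect (fun z => normc (F z)) a b h n.
Proof.
apply: le_trans (cnorm_sum _ _ _) _; apply: ler_sum => k _; exact: cnorm_sum.
Qed.

Lemma le_rect (F G : C -> R) a b h n : (forall k l, F (gpt a b h k l) <= G (gpt a b h k l)) ->
  rect F a b h n <= rect G a b h n.
Proof. by move=> FG; apply: ler_sum => k _; apply: ler_sum => l _. Qed.

Lemma gpt_shift a b h k l m n :
  gpt a b h (m + k) (n + l) = gpt (a + m%:R * h) (b + n%:R * h) h k l.
Proof.
by apply/eqP; rewrite eq_complex /= !natrD; apply/andP; split; apply/eqP; ring.
Qed.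

Lemma rect_quarter (F : C -> C) a b h n :
  rect F a b h (n + n) =
  (rect F a b h n + rect F a (b + n%:R * h) h n) +
  (rect F (a + n%:R * h) b h n + rect F (a + n%:R * h) (b + n%:R * h) h n).
Proof.
rewrite /rect big_split_ord /=; congr (_ + _); rewrite -big_split /=.
  apply: eq_bigr => k _; rewrite big_split_ord /=; congr (_ + _).
  by apply: eq_bigr => l _; rewrite -[X in gpt a b h X _]add0n gpt_shift mul0r addr0.
apply: eq_bigr => k _; rewrite big_split_ord /=; congr (_ + _).
  by apply: eq_bigr => l _; rewrite -[X in gpt a b h _ X]add0n gpt_shift mul0r addr0.
by apply: eq_bigr => l _; rewrite gpt_shift.
Qed.

Lemma sum_shrink (T : nmodType) (f : nat -> T) (m n p : nat) :
  (forall k, (k < m)%N -> f k = 0) -> (forall k, (m + n <= k)%N -> f k = 0) ->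
  \sum_(k < m + n + p) f k = \sum_(k < n) f (m + k)%N.
Proof.
move=> f1 f2; rewrite big_split_ord /= [X in _ + X]big1 ?addr0; last first.
  by move=> k _; rewrite f2 // leq_addr.
by rewrite big_split_ord /= [X in X + _]big1 ?add0r // => k _; rewrite f1.
Qed.

Lemma rect_shrink (F : C -> C) a b h (m n p : nat) :
  (forall k l, ~~ [&& m <= k, k < m + n, m <= l & l < m + n]%N -> F (gpt a b h k l) = 0) ->
  rect F a b h (m + n + p) = rect F (a + m%:R * h) (b + m%:R * h) h n.
Proof.
move=> F0; rewrite /rect.
rewrite (@sum_shrink _ (fun k => \sum_(l < m + n + p) F (gpt a b h k l))).
- apply: eq_bigr => k _; rewrite (@sum_shrink _ (fun l => F (gpt a b h (m + k) l))).
  + by apply: eq_bigr => l _; rewrite gpt_shift.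
  + move=> l lm; apply: F0; apply/negP => /and4P[_ _ h1 _].
    by move: (leq_ltn_trans h1 lm); rewrite ltnn.
  + move=> l lm; apply: F0; apply/negP => /and4P[_ _ _ h1].
    by move: (leq_ltn_trans lm h1); rewrite ltnn.
- move=> k km; apply: big1 => l _; apply: F0; apply/negP => /and4P[h1 _ _ _].
  by move: (leq_ltn_trans h1 km); rewrite ltnn.
- move=> k km; apply: big1 => l _; apply: F0; apply/negP => /and4P[_ h1 _ _].
  by move: (leq_ltn_trans km h1); rewrite ltnn.
Qed.

(* a monotone clamp majorises the indicator, and its increments telescope *)
Lemma count_line a h (c rho : R) n : 0 < h -> 0 <= rho ->
  (\sum_(k < n) (if `|a + k%:R * h - c| <= rho then 1 else 0)) * h <= 2 * rho + h.
Proof.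
move=> h0 r0; pose g (k : nat) : R :=
  Num.max (c - rho) (Num.min (a + k%:R * h) (c + rho + h)).
have gS k : (if `|a + k%:R * h - c| <= rho then 1 else 0) * h <= g k.+1 - g k.
  rewrite /g -natr1; set x := k%:R * h.
  have -> : (k%:R + 1) * h = x + h by rewrite mulrDl mul1r.
  case: ifPn => [|_].
    rewrite ler_norml => /andP[h1 h2].
    rewrite [X in _ <= Num.max _ X - _]min_l; last by lra.
    rewrite [X in _ <= _ - Num.max _ X]min_l; last by lra.
    rewrite max_r; last by lra.
    by rewrite max_r; lra.
  rewrite mul0r subr_ge0 ge_max le_max lexx /=.
  by rewrite le_max; apply/orP; right; rewrite le_min !ge_min lexx orbT andbT lerD2l ler_wpDr // ltW.
rewrite mulr_suml.
apply: (@le_trans _ _ (\sum_(k < n) (g k.+1 - g k))).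
  by apply: ler_sum => k _; exact: gS.
rewrite -(big_mkord xpredT (fun k => g k.+1 - g k)) telescope_sumr //.
have gle k : g k <= c + rho + h.
  by rewrite /g ge_max ge_min lexx orbT andbT; lra.
have gge k : c - rho <= g k by rewrite /g le_max lexx.
have := gle n; have := gge 0%N; lra.
Qed.

(** A disc of radius [rho] contains [O((rho / h) ^+ 2)] points of the grid. *)
Lemma rect_count (F : C -> C) (c : C) a b h (rho B : R) n : 0 < h -> 0 <= rho -> 0 <= B ->
  (forall z, normc (F z) <= B) ->
  (forall z, F z != 0 -> normc (z - c) <= rho) ->
  normc (rect F a b h n) * h ^+ 2 <= B * (2 * rho + h) ^+ 2.
Proof.
move=> h0 r0 B0 FB Fc.
pose ind (x y : R) : R := if `|x - y| <= rho then 1 else 0.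
pose G z : R := B * (ind (complex.Re z) (complex.Re c) * ind (complex.Im z) (complex.Im c)).
have FG z : normc (F z) <= G z.
  rewrite /G; have [->|/Fc hz] := eqVneq (F z) 0.
    rewrite cnorm0 mulr_ge0 // mulr_ge0 // /ind; by case: ifP.
  rewrite /ind -ReB -ImB (le_trans (Re_le_cnorm _) hz) (le_trans (Im_le_cnorm _) hz).
  by rewrite !mulr1.
have cnt (x y : R) : 0 <= \sum_(k < n) ind (x + k%:R * h) y.
  by apply: sumr_ge0 => k _; rewrite /ind; case: ifP.
have GE : rect G a b h n =
    B * ((\sum_(k < n) ind (a + k%:R * h) (complex.Re c)) *
         (\sum_(k < n) ind (b + k%:R * h) (complex.Im c))).
  rewrite /rect big_distrl mulr_sumr; apply: eq_bigr => k _ /=.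
  by rewrite !mulr_sumr.
apply: (@le_trans _ _ (rect G a b h n * h ^+ 2)).
  rewrite ler_wpM2r ?sqr_ge0 //; apply: le_trans (cnorm_rect _ _ _ _ _) _.
  by apply: le_rect => k l; exact: FG.
rewrite GE -mulrA ler_wpM2l // expr2 mulrACA expr2.
apply: ler_pM; rewrite ?mulr_ge0 ?cnt ?(ltW h0) //; exact: count_line.
Qed.

Lemma dbarM (f g : C -> C) h z :
  dbar (fun z => f z * g z) h z = dbar f h z * g z +
   (f (z + hstep h) * (g (z + hstep h) - g z) +
    ii * (f (z + vstep h) * (g (z + vstep h) - g z))).
Proof. rewrite /dbar; ring. Qed.

Lemma dbarD (f g : C -> C) h z :
  dbar (fun z => f z + g z) h z = dbar f h z + dbar g h z.
Proof. rewrite /dbar; ring. Qed.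

Lemma dbarB (f g : C -> C) h z :
  dbar (fun z => f z - g z) h z = dbar f h z - dbar g h z.
Proof. rewrite /dbar; ring. Qed.

Definition lip (f : C -> C) (L : R) :=
  forall z w, normc (f z - f w) <= L * normc (z - w).

Lemma dbar_le (f : C -> C) (L : R) h z : 0 <= h -> lip f L ->
  normc (dbar f h z) <= 2 * L * h.
Proof.
move=> h0 fL; apply: le_trans (cnormD _ _) _.
have := fL (z + hstep h) z; have := fL (z + vstep h) z.
rewrite cnormM cnorm_ii mul1r ![z + _]addrC !addrK cnorm_hstep // cnorm_vstep //.
lra.
Qed.

Lemma dbar_supp (f : C -> C) h z : dbar f h z != 0 ->
  [\/ f z != 0, f (z + hstep h) != 0 | f (z + vstep h) != 0].
Proof.
move=> H; have [fz|fz] := eqVneq (f z) 0; last by constructor 1.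
have [f1|f1] := eqVneq (f (z + hstep h)) 0; last by constructor 2.
have [f2|f2] := eqVneq (f (z + vstep h)) 0; last by constructor 3.
by move: H; rewrite /dbar fz f1 f2 !subrr mulr0 addr0 eqxx.
Qed.

(** Green's formula for a function that agrees on opposite sides: each
    difference quotient telescopes along the lines of the grid. *)
Lemma rect_dbar (f : C -> C) a b h n :
  (forall l, f (gpt a b h n l) = f (gpt a b h 0 l)) ->
  (forall k, f (gpt a b h k n) = f (gpt a b h k 0)) ->
  rect (dbar f h) a b h n = 0.
Proof.
move=> f1 f2; rewrite /rect.
have -> : \sum_(k < n) \sum_(l < n) dbar f h (gpt a b h k l) =
  (\sum_(l < n) \sum_(k < n) (f (gpt a b h k.+1 l) - f (gpt a b h k l))) +
  ii * (\sum_(k < n) \sum_(l < n) (f (gpt a b h k l.+1) - f (gpt a b h k l))).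
  rewrite [X in _ = X + _]exchange_big mulr_sumr -big_split; apply: eq_bigr => k _.
  rewrite mulr_sumr -[RHS]big_split; apply: eq_bigr => l _.
  by rewrite gptSk gptSl.
rewrite !big1 ?mulr0 ?addr0 // => k _.
- rewrite -(big_mkord xpredT (fun l => f (gpt a b h k l.+1) - f (gpt a b h k l))).
  by rewrite telescope_sumr // f2 subrr.
- rewrite -(big_mkord xpredT (fun l => f (gpt a b h l.+1 k) - f (gpt a b h l k))).
  by rewrite telescope_sumr // f1 subrr.
Qed.

Lemma abel (A r : nat -> C) n : \sum_(k < n) A k.+1 * (r k.+1 - r k) =
  A n * r n - A 0%N * r 0%N - \sum_(k < n) (A k.+1 - A k) * r k.
Proof.
elim: n => [|n IH]; first by rewrite !big_ord0 subrr subr0.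
rewrite !big_ord_recr /= IH; ring.
Qed.

(** Used with [A] the cutoff function and [r] the remainder of [q] along a line
    of the grid: the increments fall on the Lipschitz function, and no
    regularity of the remainder enters. *)
Lemma abel_le (A r : nat -> C) n (K L rr : R) :
  (forall k, (k <= n)%N -> normc (A k) <= K) ->
  (forall k, (k < n)%N -> normc (A k.+1 - A k) <= L) ->
  (forall k, (k <= n)%N -> normc (r k) <= rr) ->
  normc (\sum_(k < n) A k.+1 * (r k.+1 - r k)) <= (2 * K + n%:R * L) * rr.
Proof.
move=> AK AL rrr; rewrite abel.
apply: le_trans (cnormB _ _) _; rewrite mulrDl; apply: lerD.
  apply: le_trans (cnormB _ _) _; rewrite !cnormM mulrDl mul1r mulrDl.
  by apply: lerD; apply: ler_pM; rewrite ?cnorm_ge0 ?AK ?rrr.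
apply: le_trans (cnorm_sum _ _ _) _.
apply: (@le_trans _ _ (\sum_(k < n) (L * rr))).
  apply: ler_sum => k _; rewrite cnormM; apply: ler_pM; rewrite ?cnorm_ge0 //.
    exact: AL.
  by apply: rrr; apply: ltnW.
by rewrite sumr_const card_ord -mulrA mulr_natl.
Qed.

End GridSums.

(** * Subdivision *)

Section Green.
Variable R : realType.
Local Notation C := (CC R).
Implicit Types (z w c : C) (a b h : R) (k q : C -> C).

Definition mesh (N : nat) : R := (2 ^+ N)^-1.

Lemma mesh_gt0 N : 0 < mesh N.
Proof. by rewrite invr_gt0 exprn_gt0. Qed.

Lemma mesh_small e : 0 < e -> exists N0, forall N, (N0 <= N)%N -> mesh N <= e.
Proof.
move=> e0; have [n hn] : exists n : nat, e^-1 < n%:R.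
  by exists (Num.bound e^-1); apply: archi_boundP; rewrite invr_ge0 ltW.
exists n => N nN; rewrite /mesh -[e]invrK lef_pV2 ?posrE ?exprn_gt0 ?invr_gt0 //.
apply: le_trans (ltW hn) _; rewrite -natrX ler_nat.
by apply: leq_trans nN _; apply: ltnW; exact: ltn_expl.
Qed.

(** What is left of the difference quotient of [k * q] once [q] times the
    difference quotient of [k] has been subtracted. *)
Definition dbar_def k q h z : C :=
  k (z + hstep h) * (q (z + hstep h) - q z) +
  ii R * (k (z + vstep h) * (q (z + vstep h) - q z)).

(** The property that Goursat's bisection needs at the point on which the
    squares concentrate. *)
Definition locally_small k q c := forall e, 0 < e -> exists d, 0 < d /\
  forall a b s, 0 < s -> s < d -> a <= complex.Re c <= a + s ->
   b <= complex.Im c <= b + s ->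
   exists N0, forall N, (N0 <= N)%N -> forall n, n%:R * mesh N = s ->
    normc ((mesh N)%:C * rect (dbar_def k q (mesh N)) a b (mesh N) n) <= e * s ^+ 2.

Lemma gpt_near a b s c h n (k l : nat) : 0 <= h -> n%:R * h = s ->
  a <= complex.Re c <= a + s -> b <= complex.Im c <= b + s ->
  (k <= n.+1)%N -> (l <= n.+1)%N ->
  normc (gpt a b h k l - c) <= 2 * (s + h).
Proof.
move=> h0 nh ac bc kn ln.
have s0 : 0 <= s by rewrite -nh mulr_ge0.
have lk (m : nat) : (m <= n.+1)%N -> m%:R * h <= s + h.
  move=> mn; rewrite -nh -{3}[h]mul1r -mulrDl natr1 ler_wpM2r // ler_nat //.
apply: le_trans (cnorm_le_ReIm _) _; rewrite ReB ImB /=.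
have hk := lk _ kn; have hl := lk _ ln.
have pk : 0 <= k%:R * h by rewrite mulr_ge0.
have pl : 0 <= l%:R * h by rewrite mulr_ge0.
have h1 : `|a + k%:R * h - complex.Re c| <= s + h by rewrite ler_norml; lra.
have h2 : `|b + l%:R * h - complex.Im c| <= s + h by rewrite ler_norml; lra.
lra.
Qed.

Lemma locally_small0 k q c :
  (exists d, 0 < d /\ forall z, normc (z - c) < d -> k z = 0) -> locally_small k q c.
Proof.
move=> [d [d0 kd]] e e0; exists (d / 4); split; first by rewrite divr_gt0.
move=> a b s s0 sd ac bc; have [N0 hN] := mesh_small s0.
exists N0 => N /hN hs n nh.
have h0 := mesh_gt0 N.
rewrite (_ : rect _ _ _ _ _ = 0) ?mulr0 ?cnorm0; last first.
  rewrite /rect big1 // => i _; rewrite big1 // => j _.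
  rewrite /dbar_def -gptSk -gptSl !kd ?mul0r ?mulr0 ?addr0 //.
    apply: le_lt_trans (gpt_near (ltW h0) nh ac bc _ _) _.
    - by apply: ltnW; apply: ltnW; exact: ltn_ord.
    - by rewrite ltnS; apply: ltnW; exact: ltn_ord.
    - lra.
  apply: le_lt_trans (gpt_near (ltW h0) nh ac bc _ _) _.
  - by rewrite ltnS; apply: ltnW; exact: ltn_ord.
  - by apply: ltnW; apply: ltnW; exact: ltn_ord.
  - lra.
by rewrite mulr_ge0 ?sqr_ge0 // ltW.
Qed.

(** On a small square around [c] the increments of [q] are those of an affine
    function, which cancel between the two directions by the Cauchy-Riemann
    equations, plus a remainder [o(s)] that summation by parts controls. *)
Lemma locally_small_diff k q c (L K : R) : lip k L -> (forall z, normc (k z) <= K) ->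
  cdiff q c -> locally_small k q c.
Proof.
move=> kL kK /cdiff_eps [l hl] e e0.
have L0 : 0 <= L.
  have := le_trans (cnorm_ge0 _) (kL 1 0); by rewrite subr0 cnorm1 mulr1.
have K0 : 0 <= K by apply: le_trans (cnorm_ge0 _) (kK 0).
pose eta := e / (16 * (2 * K + L + 1)).
have D0 : 0 < 16 * (2 * K + L + 1) by lra.
have eta0 : 0 < eta by rewrite divr_gt0.
have [d [d0 hd]] := hl _ eta0.
exists (Num.min 1 (d / 4)); split; first by rewrite lt_min ltr01 divr_gt0.
move=> a b s s0; rewrite lt_min => /andP[s1 sd] ac bc.
have T0 : 0 < e / (4 * (normc l * L + 1)).
  by rewrite divr_gt0 // mulr_gt0 // ltr_wpDl // mulr_ge0 // cnorm_ge0.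
have m0 : 0 < Num.min s (e / (4 * (normc l * L + 1))) by rewrite lt_min s0 T0.
have [N0 hN] := mesh_small m0.
exists N0 => N /hN; rewrite le_min => /andP[hs hT] n nh.
set h := mesh N; have h0 : 0 < h := mesh_gt0 N.
pose r z := q z - q c - l * (z - c).
have rle (i j : nat) : (i <= n.+1)%N -> (j <= n.+1)%N ->
    normc (r (gpt a b h i j)) <= 4 * eta * s.
  move=> hi hj; have near := gpt_near (ltW h0) nh ac bc hi hj.
  apply: (@le_trans _ _ (eta * normc (gpt a b h i j - c))).
    by apply: hd; apply: le_lt_trans near _; rewrite -/h in hs *; lra.
  rewrite (_ : 4 * eta * s = eta * (4 * s)); last by ring.
  apply: ler_wpM2l; first exact: ltW.
  by apply: le_trans near _; rewrite -/h in hs *; lra.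
have split_mu z : dbar_def k q h z =
    l * h%:C * (k (z + hstep h) - k (z + vstep h)) +
    (k (z + hstep h) * (r (z + hstep h) - r z) +
     ii R * (k (z + vstep h) * (r (z + vstep h) - r z))).
  have e1 : q (z + hstep h) - q z = l * h%:C + (r (z + hstep h) - r z).
    by rewrite /r hstepE; ring.
  have e2 : q (z + vstep h) - q z = l * (ii R * h%:C) + (r (z + vstep h) - r z).
    by rewrite /r vstepE; ring.
  rewrite /dbar_def e1 e2.
  have iiE : ii R * (k (z + vstep h) * (l * (ii R * h%:C))) =
    - (l * h%:C * k (z + vstep h)).
    rewrite (_ : _ * _ = ii R * ii R * (l * h%:C * k (z + vstep h))); last by ring.
    by rewrite iiM mulN1r.
  rewrite (mulrDr (k (z + vstep h))) (mulrDr (ii R)) iiE; ring.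
have Abound : normc (rect (fun z => l * h%:C * (k (z + hstep h) - k (z + vstep h))) a b h n)
    <= n%:R * n%:R * (normc l * h * (L * (2 * h))).
  apply: le_trans (cnorm_rect _ _ _ _ _) _.
  apply: (@le_trans _ _ (rect (fun=> normc l * h * (L * (2 * h))) a b h n)).
    apply: le_rect => i j; rewrite !cnormM cnorm_real (gtr0_norm h0).
    apply: ler_wpM2l; first by rewrite mulr_ge0 ?cnorm_ge0 ?(ltW h0).
    apply: le_trans (kL _ _) _; apply: ler_wpM2l => //.
    rewrite opprD addrACA subrr add0r.
    apply: le_trans (cnormB _ _) _.
    rewrite cnorm_hstep ?(ltW h0) // cnorm_vstep ?(ltW h0) //; lra.
  by rewrite /rect !sumr_const !card_ord -mulrnA -[leLHS]mulr_natl natrM.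
have rowb (A : nat -> C) (B : nat -> C) :
   (forall i, (i <= n)%N -> normc (A i) <= K) ->
   (forall i, (i < n)%N -> normc (A i.+1 - A i) <= L * h) ->
   (forall i, (i <= n)%N -> normc (B i) <= 4 * eta * s) ->
   normc (\sum_(i < n) A i.+1 * (B i.+1 - B i)) <= (2 * K + s * L) * (4 * eta * s).
  move=> A1 A2 B1; apply: le_trans (abel_le A1 A2 B1) _.
  by rewrite (_ : n%:R * (L * h) = s * L) // -nh -/h; ring.
have Bbound : normc (rect (fun z => k (z + hstep h) * (r (z + hstep h) - r z)) a b h n)
    <= n%:R * ((2 * K + s * L) * (4 * eta * s)).
  rewrite /rect exchange_big; apply: le_trans (cnorm_sum _ _ _) _.
  apply: (@le_trans _ _ (\sum_(j < n) (2 * K + s * L) * (4 * eta * s))); last first.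
    by rewrite sumr_const card_ord [leRHS]mulr_natl.
  apply: ler_sum => j _.
  rewrite (eq_bigr (fun i : 'I_n => k (gpt a b h i.+1 j) *
     (r (gpt a b h i.+1 j) - r (gpt a b h i j)))); last by move=> i _; rewrite gptSk.
  apply: (rowb (fun i => k (gpt a b h i j)) (fun i => r (gpt a b h i j))) => i hi.
  - exact: kK.
  - apply: le_trans (kL _ _) _.
    by rewrite gptSk addrC addKr cnorm_hstep ?(ltW h0).
  - by apply: rle; [exact: leqW|apply: ltnW; apply: leqW; exact: ltn_ord].
have Cbound : normc (rect (fun z => k (z + vstep h) * (r (z + vstep h) - r z)) a b h n)
    <= n%:R * ((2 * K + s * L) * (4 * eta * s)).
  rewrite /rect; apply: le_trans (cnorm_sum _ _ _) _.
  apply: (@le_trans _ _ (\sum_(j < n) (2 * K + s * L) * (4 * eta * s))); last first.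
    by rewrite sumr_const card_ord [leRHS]mulr_natl.
  apply: ler_sum => j _.
  rewrite (eq_bigr (fun i : 'I_n => k (gpt a b h j i.+1) *
     (r (gpt a b h j i.+1) - r (gpt a b h j i)))); last by move=> i _; rewrite gptSl.
  apply: (rowb (fun i => k (gpt a b h j i)) (fun i => r (gpt a b h j i))) => i hi.
  - exact: kK.
  - apply: le_trans (kL _ _) _.
    by rewrite gptSl addrC addKr cnorm_vstep ?(ltW h0).
  - by apply: rle; [apply: ltnW; apply: leqW; exact: ltn_ord|exact: leqW].
rewrite (eq_rect _ _ _ _ split_mu) !rectD (rectZ (ii R)) cnormM cnorm_real (gtr0_norm h0).
set X := rect _ _ _ _ _ in Abound *.
set Y := rect _ _ _ _ _ in Bbound *.
set Z := rect _ _ _ _ _ in Cbound *.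
have XYZ : normc (X + (Y + ii R * Z)) <= normc X + (normc Y + normc Z).
  apply: le_trans (cnormD _ _) _; rewrite lerD2l.
  by apply: le_trans (cnormD _ _) _; rewrite cnormM cnorm_ii mul1r.
apply: (@le_trans _ _ (h * (n%:R * n%:R * (normc l * h * (L * (2 * h))) +
   (n%:R * ((2 * K + s * L) * (4 * eta * s)) + n%:R * ((2 * K + s * L) * (4 * eta * s)))))).
  by apply: ler_wpM2l; [exact: ltW|apply: le_trans XYZ _; rewrite !lerD].
rewrite (_ : h * _ = s ^+ 2 * (2 * (normc l * L) * h + 8 * eta * (2 * K + s * L))); last first.
  by rewrite -nh -/h; ring.
rewrite [leRHS]mulrC ler_wpM2l ?sqr_ge0 //.
have f1 : 2 * (normc l * L) * h <= e / 2.
  have P0 : 0 <= normc l * L by rewrite mulr_ge0 ?cnorm_ge0.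
  rewrite -/h ler_pdivlMr in hT; last by lra.
  have : normc l * L * h <= e / 4; last lra.
  nra.
have f2 : 8 * eta * (2 * K + s * L) <= e / 2.
  have : eta * (16 * (2 * K + L + 1)) = e by rewrite /eta mulfVK // gt_eqF.
  have : s * L <= L by rewrite ler_piMl // ltW.
  nra.
lra.
Qed.

End Green.

(** * Goursat's lemma *)

Section Goursat.
Variable R : realType.
Local Notation C := (CC R).
Implicit Types (z w c : C) (a b h : R) (k q : C -> C).

Lemma mesh_mul (n0 m N : nat) : (m <= N)%N ->
  (n0 * 2 ^ (N - m))%:R * mesh R N = n0%:R * mesh R m.
Proof.
move=> mN; rewrite natrM natrX /mesh -mulrA; congr (_ * _).
rewrite -{2}(subnK mN) exprD invfM mulrA divff ?mul1r //.
Qed.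

(** Goursat's argument: a square on which the discrete boundary sums stay large
    compared with its area contains a quarter with the same defect, and the
    nested squares obtained in this way shrink to a point where the sums are
    small by differentiability. *)
Lemma goursat k q a0 b0 (n0 : nat) : (0 < n0)%N ->
  (forall c, a0 <= complex.Re c <= a0 + n0%:R -> b0 <= complex.Im c <= b0 + n0%:R ->
     locally_small k q c) ->
  forall e, 0 < e -> exists N0, forall N, (N0 <= N)%N ->
    normc ((mesh R N)%:C * rect (dbar_def k q (mesh R N)) a0 b0 (mesh R N) (n0 * 2 ^ N))
      <= e * n0%:R ^+ 2.
Proof.
move=> n00 loc e e0.
pose s m := n0%:R * mesh R m : R.
have s0 m : 0 < s m by rewrite mulr_gt0 ?ltr0n ?mesh_gt0.
have sS m : s m = s m.+1 + s m.+1.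
  by rewrite /s /mesh exprS invfM; lra.
pose T N a b m : C :=
  (mesh R N)%:C * rect (dbar_def k q (mesh R N)) a b (mesh R N) (n0 * 2 ^ (N - m)).
pose good m a b := exists N0, forall N, (N0 <= N)%N -> normc (T N a b m) <= e * s m ^+ 2.
suff : good 0%N a0 b0.
  move=> [N0 hN]; exists N0 => N /hN; rewrite /T subn0 /s /mesh expr0 invr1 mulr1 //.
apply: contrapT => bad0.
have quarter m a b : ~ good m a b -> exists p : R * R,
    [/\ p.1 = a \/ p.1 = a + s m.+1, p.2 = b \/ p.2 = b + s m.+1 & ~ good m.+1 p.1 p.2].
  move=> bad; apply: contrapT => nex; apply: bad.
  have g (x y : R) : x = a \/ x = a + s m.+1 -> y = b \/ y = b + s m.+1 -> good m.+1 x y.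
    move=> hx hy; apply: contrapT => ng; apply: nex; exists (x, y); split => //.
  have [N1 h1] := g a b (or_introl erefl) (or_introl erefl).
  have [N2 h2] := g a (b + s m.+1) (or_introl erefl) (or_intror erefl).
  have [N3 h3] := g (a + s m.+1) b (or_intror erefl) (or_introl erefl).
  have [N4 h4] := g (a + s m.+1) (b + s m.+1) (or_intror erefl) (or_intror erefl).
  exists (maxn m.+1 (maxn (maxn N1 N2) (maxn N3 N4))) => N.
  rewrite !geq_max => /andP[Nm /andP[/andP[n1 n2] /andP[n3 n4]]].
  have -> : T N a b m = (T N a b m.+1 + T N a (b + s m.+1) m.+1) +
     (T N (a + s m.+1) b m.+1 + T N (a + s m.+1) (b + s m.+1) m.+1).
    rewrite /T -!mulrDr; congr (_ * _).
    have -> : (n0 * 2 ^ (N - m) = n0 * 2 ^ (N - m.+1) + n0 * 2 ^ (N - m.+1))%N.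
      by rewrite addnn -mul2n mulnCA -expnS -subSn // subSS.
    by rewrite rect_quarter mesh_mul.
  rewrite (sS m); apply: le_trans (cnormD _ _) _.
  have -> : e * (s m.+1 + s m.+1) ^+ 2 = (e * s m.+1 ^+ 2 + e * s m.+1 ^+ 2) +
     (e * s m.+1 ^+ 2 + e * s m.+1 ^+ 2) by ring.
  by apply: lerD; apply: le_trans (cnormD _ _) _; apply: lerD; [exact: h1|exact: h2|exact: h3|exact: h4].
have stepP : exists f : nat -> R * R -> R * R, forall m p, ~ good m p.1 p.2 ->
    [/\ (f m p).1 = p.1 \/ (f m p).1 = p.1 + s m.+1,
        (f m p).2 = p.2 \/ (f m p).2 = p.2 + s m.+1 & ~ good m.+1 (f m p).1 (f m p).2].
  have := choice (fun mp : nat * (R * R) => _ : exists p', ~ good mp.1 mp.2.1 mp.2.2 ->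
    [/\ p'.1 = mp.2.1 \/ p'.1 = mp.2.1 + s mp.1.+1,
        p'.2 = mp.2.2 \/ p'.2 = mp.2.2 + s mp.1.+1 & ~ good mp.1.+1 p'.1 p'.2]).
  case.
    move=> [m [a b]] /=; have [g|ng] := pselect (good m a b); first by exists (0, 0).
    by have [p hp] := quarter _ _ _ ng; exists p.
  by move=> f hf; exists (fun m p => f (m, p)) => m p; exact: (hf (m, p)).
have [f fP] := stepP.
pose u := fix u m := if m is m'.+1 then f m' (u m') else (a0, b0).
have ubad m : ~ good m (u m).1 (u m).2.
  by elim: m => [//|m IH]; have [] := fP m (u m) IH.
have uS m := fP m (u m) (ubad m).
(* the corners increase and the opposite corners decrease, so they enclose a point *)
have encl (x : nat -> R) (x0 : R) : x 0%N = x0 ->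
    (forall m, x m.+1 = x m \/ x m.+1 = x m + s m.+1) ->
    exists y, forall m, x m <= y <= x m + s m.
  move=> x00 xS.
  have xle m p : x m <= x (m + p)%N /\ x (m + p)%N + s (m + p)%N <= x m + s m.
    elim: p => [|p [IH1 IH2]]; first by rewrite addn0.
    rewrite addnS; have := sS (m + p)%N; have := s0 (m + p).+1.
    by case: (xS (m + p)%N) => ->; lra.
  have xle2 m p : x m <= x p + s p.
    have [mp|pm] := leqP m p.
      have [h _] := xle m (p - m)%N; rewrite subnKC // in h.
      by apply: le_trans h _; rewrite lerDl ltW.
    have [_ h] := xle p (m - p)%N; rewrite subnKC ?(ltnW pm) // in h.
    by apply: le_trans h; rewrite lerDl ltW.
  have hs : has_sup (range x).
    split; first by exists (x 0%N); exists 0%N.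
    by exists (x 0%N + s 0%N) => _ [m _ <-].
  exists (sup (range x)) => m; apply/andP; split.
    by apply: ub_le_sup; [case: hs|exists m].
  by apply: ge_sup; [case: hs|move=> _ [p _ <-]].
have [x hx] : exists y, forall m, (u m).1 <= y <= (u m).1 + s m.
  by apply: (encl (fun m => (u m).1) a0) => // m; have [] := uS m.
have [y hy] : exists y, forall m, (u m).2 <= y <= (u m).2 + s m.
  by apply: (encl (fun m => (u m).2) b0) => // m; have [] := uS m.
have s00 : s 0%N = n0%:R by rewrite /s /mesh expr0 invr1 mulr1.
have [|| d [d0 hd]] := loc (x +i* y) _ _ e e0.
- by have := hx 0%N; rewrite /= s00.
- by have := hy 0%N; rewrite /= s00.
have dn : 0 < d / (n0%:R + 1) by rewrite divr_gt0 // ltr_wpDl.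
have [m hm] := mesh_small dn.
have sm : s m < d.
  have := hm m (leqnn _); rewrite ler_pdivlMr ?ltr_wpDl // => h.
  apply: lt_le_trans h; rewrite /s (mulrC n0%:R) ltr_pM2l ?mesh_gt0 // ltrDl //.
have [N0 hN] := hd _ _ _ (s0 m) sm (hx m) (hy m).
apply: (ubad m); exists (maxn N0 m) => N; rewrite geq_max => /andP[NN0 Nm].
by apply: hN => //; rewrite mesh_mul.
Qed.

End Goursat.

(** * The discrete Cauchy-Green formula *)

Section GreenSums.
Variable R : realType.
Local Notation C := (CC R).
Implicit Types (z w c : C) (a b h L K rho Q : R) (k q : C -> C).

(** Riemann sums, over finer and finer grids on larger and larger squares, for
    the integral of [2 * (dk/dzbar) * q]. *)
Definition gsum k q (N : nat) : C :=
  (mesh R N)%:C * rect (fun z => dbar k (mesh R N) z * q z)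
    (- 2 ^+ N) (- 2 ^+ N) (mesh R N) (2 ^ N * 2 ^ N + 2 ^ N * 2 ^ N).

Definition supp_in k c rho := forall z, k z != 0 -> normc (z - c) <= rho.

(** A bound for [q] is only asked where [k] is not locally constant: this is
    what allows poles inside the plateau of a cutoff function. *)
Definition bounded_off k q Q := exists eta, 0 < eta /\
  forall z, normc (q z) <= Q \/ (forall w, normc (w - z) < eta -> k w = k z).

Lemma gsumDl k1 k2 q N : gsum (fun z => k1 z + k2 z) q N = gsum k1 q N + gsum k2 q N.
Proof.
by rewrite /gsum -mulrDr -rectD; congr (_ * _); apply: eq_rect => z; rewrite dbarD mulrDl.
Qed.
Lemma gsumBl k1 k2 q N : gsum (fun z => k1 z - k2 z) q N = gsum k1 q N - gsum k2 q N.
Proof.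
rewrite /gsum -mulrBr -[X in _ = _ * (_ + X)]mulN1r -(rectZ (-1)) -rectD; congr (_ * _).
by apply: eq_rect => z; rewrite dbarB mulrBl mulN1r.
Qed.
Lemma gsumDr k q1 q2 N : gsum k (fun z => q1 z + q2 z) N = gsum k q1 N + gsum k q2 N.
Proof.
by rewrite /gsum -mulrDr -rectD; congr (_ * _); apply: eq_rect => z; rewrite mulrDr.
Qed.
Lemma gsumZr k q (t : C) N : gsum k (fun z => t * q z) N = t * gsum k q N.
Proof.
by rewrite /gsum [RHS]mulrCA -(rectZ t); congr (_ * _); apply: eq_rect => z; rewrite mulrCA.
Qed.
Lemma gsumBr k q1 q2 N : gsum k (fun z => q1 z - q2 z) N = gsum k q1 N - gsum k q2 N.
Proof.
rewrite -[X in _ = _ + X]mulN1r -(gsumZr _ _ (-1)) -gsumDr; congr gsum.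
by apply/funext => z; rewrite mulN1r.
Qed.

Lemma lip_ge0 k L : lip k L -> 0 <= L.
Proof.
by move=> kL; have := le_trans (cnorm_ge0 _) (kL 1 0); rewrite subr0 cnorm1 mulr1.
Qed.

Lemma lip_bounded k L c rho : 0 <= rho -> lip k L -> supp_in k c rho ->
  forall z, normc (k z) <= L * (2 * rho + 1).
Proof.
move=> r0 kL kc z; have L0 := lip_ge0 kL.
have [->|k0] := eqVneq (k z) 0; first by rewrite cnorm0 mulr_ge0 //; lra.
pose w := c + (rho + 1)%:C.
have wc : normc (w - c) = rho + 1 by rewrite /w addrC addKr cnorm_real ger0_norm //; lra.
have kw : k w = 0.
  by apply/eqP/negPn/negP => /kc; rewrite wc; lra.
have := kL z w; rewrite kw subr0 => h; apply: le_trans h _.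
rewrite ler_wpM2l //; apply: le_trans (cdist_triangle c _ _) _.
by rewrite [X in _ + X]cdistC wc; have := kc _ k0; lra.
Qed.

Lemma gsum_le k q L c rho Q N : 0 <= rho -> 0 <= Q -> lip k L -> supp_in k c rho ->
  (forall z, dbar k (mesh R N) z != 0 -> normc (q z) <= Q) ->
  normc (gsum k q N) <= 2 * L * Q * (2 * rho + 3 * mesh R N) ^+ 2.
Proof.
move=> r0 Q0 kL kc qQ; have L0 := lip_ge0 kL.
set h := mesh R N in qQ *; have h0 : 0 < h := mesh_gt0 R N.
rewrite /gsum cnormM cnorm_real (gtr0_norm h0).
have B0 : 0 <= 2 * L * h * Q by rewrite !mulr_ge0 // ltW.
have r1 : 0 <= rho + h by lra.
pose F z := dbar k h z * q z.
have FB z : normc (F z) <= 2 * L * h * Q.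
  rewrite /F; have [->|d0] := eqVneq (dbar k h z) 0; first by rewrite mul0r cnorm0.
  rewrite cnormM; apply: ler_pM; rewrite ?cnorm_ge0 //; last exact: qQ.
  by apply: dbar_le => //; exact: ltW.
have Fc z : F z != 0 -> normc (z - c) <= rho + h.
  rewrite /F mulf_eq0 negb_or => /andP[/dbar_supp[/kc|/kc|/kc] hz _]; first by lra.
    have := cdist_triangle (z + hstep h) z c.
    rewrite opprD addNKr cnormN cnorm_hstep ?(ltW h0) //; lra.
  have := cdist_triangle (z + vstep h) z c.
  rewrite opprD addNKr cnormN cnorm_vstep ?(ltW h0) //; lra.
have := rect_count (- 2 ^+ N) (- 2 ^+ N) (2 ^ N * 2 ^ N + 2 ^ N * 2 ^ N) h0 r1 B0 FB Fc.
set X := normc _ => hX.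
have e1 : (2 * (rho + h) + h) = 2 * rho + 3 * h by ring.
rewrite e1 in hX.
rewrite -(ler_pM2r h0).
have -> : h * X * h = X * h ^+ 2 by ring.
apply: le_trans hX _; rewrite le_eqVlt; apply/orP; left; apply/eqP; ring.
Qed.

(** Only the points where [k] varies matter; there are [O((rho / h) ^+ 2)] of
    them, and each contributes [O(h ^+ 2 * L * Q)]. *)
Lemma gsum_ev k q L c rho Q : 0 < rho -> 0 <= Q -> lip k L -> supp_in k c rho ->
  bounded_off k q Q -> ev_le (gsum k q) (18 * L * Q * rho ^+ 2).
Proof.
move=> r0 Q0 kL kc [eta [eta0 qQ]]; have L0 := lip_ge0 kL.
have m0 : 0 < Num.min (eta / 2) (rho / 3) by rewrite lt_min !divr_gt0.
have [N0 hN] := mesh_small m0; exists N0 => N /hN; rewrite le_min => /andP[h1 h2].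
apply: le_trans (gsum_le (ltW r0) Q0 kL kc (N:=N) _) _.
  move=> z; case: (qQ z) => // cst; rewrite /dbar !cst ?subrr ?mulr0 ?addr0 ?eqxx //.
    by rewrite addrC addKr cnorm_vstep ?ltW ?mesh_gt0 //; apply: le_lt_trans h1 _; lra.
  by rewrite addrC addKr cnorm_hstep ?ltW ?mesh_gt0 //; apply: le_lt_trans h1 _; lra.
have h0 : 0 < mesh R N := mesh_gt0 R N.
have -> : 18 * L * Q * rho ^+ 2 = 2 * L * Q * (3 * rho) ^+ 2 by ring.
rewrite ler_wpM2l ?mulr_ge0 // ler_pXn2r ?nnegrE //; lra.
Qed.

(** Summation by parts moves the difference quotient from [k] to [q], where it
    is small by Goursat's argument; the boundary terms vanish with [k]. *)
Lemma green k q L rho : lip k L -> supp_in k 0 rho ->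
  (forall c, cdiff q c \/ exists d, 0 < d /\ forall z, normc (z - c) < d -> k z = 0) ->
  nul (gsum k q).
Proof.
move=> kL kc kq.
have [rho1 [rho10 kc1]] : exists r, 0 <= r /\ supp_in k 0 r.
  exists (Num.max 0 rho); split; first by rewrite le_max lexx.
  by move=> z /kc h; rewrite le_max h orbT.
have loc c : locally_small k q c.
  case: (kq c) => [h|h]; last exact: locally_small0.
  exact: (locally_small_diff kL (lip_bounded rho10 kL kc1) h).
have [p hp] : exists p, rho1 + 1 < 2 ^+ p.
  have h1 : 0 <= rho1 + 1 by lra.
  exists (Num.bound (rho1 + 1)); apply: (lt_le_trans (archi_boundP h1)).
  by rewrite -natrX ler_nat ltnW // ltn_expl.
move=> e e0.
pose n0 := (2 ^ p + 2 ^ p)%N.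
have n00 : (0 < n0)%N by rewrite addn_gt0 expn_gt0.
have n02 : 0 < n0%:R ^+ 2 :> R by rewrite exprn_gt0 // ltr0n.
have [N0 hN] := goursat (k := k) (q := q) (a0 := - 2 ^+ p) (b0 := - 2 ^+ p) n00 (fun c _ _ => loc c)
  (divr_gt0 e0 n02).
have [N1 hN1] := mesh_small (ltr01 : 0 < 1 :> R).
exists (maxn p (maxn N0 N1)) => N; rewrite !geq_max => /andP[pN /andP[/hN h /hN1 hm]].
rewrite divfK ?gt_eqF // in h.
set h0 := mesh R N in h hm *.
have hp0 : 0 < h0 by exact: mesh_gt0.
have h2N : (2 ^ N)%:R * h0 = 1 by rewrite /h0 /mesh natrX divff // expf_neq0 // pnatr_eq0.
have kout z : 2 ^+ p - 1 <= `|complex.Re z| \/ 2 ^+ p - 1 <= `|complex.Im z| -> k z = 0.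
  move=> hz; apply/eqP/negPn/negP => /kc1; rewrite subr0 => hk.
  by case: hz; have := Re_le_cnorm z; have := Im_le_cnorm z; lra.
pose b0 : R := - 2 ^+ p.
have shrink (F : C -> C) : (forall z, dbar k h0 z = 0 -> F z = 0) ->
   rect F (- 2 ^+ N) (- 2 ^+ N) h0 (2 ^ N * 2 ^ N + 2 ^ N * 2 ^ N) =
   rect F b0 b0 h0 (n0 * 2 ^ N).
  move=> F0.
  have nE : (2 ^ N * 2 ^ N + 2 ^ N * 2 ^ N =
     (2 ^ N - 2 ^ p) * 2 ^ N + n0 * 2 ^ N + (2 ^ N - 2 ^ p) * 2 ^ N)%N.
    rewrite -!mulnDl /n0; congr (_ * _)%N.
    have : (2 ^ p <= 2 ^ N)%N by rewrite leq_exp2l.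
    lia.
  have cornE : - 2 ^+ N + ((2 ^ N - 2 ^ p) * 2 ^ N)%:R * h0 = b0.
    rewrite natrM -mulrA h2N mulr1 natrB ?leq_exp2l // !natrX /b0; ring.
  rewrite nE rect_shrink ?cornE // => i j H; apply: F0.
  have far (m : nat) : ~~ ((2 ^ N - 2 ^ p) * 2 ^ N <= m < (2 ^ N - 2 ^ p) * 2 ^ N + n0 * 2 ^ N)%N ->
     forall t, t = 0 \/ t = h0 -> 2 ^+ p - 1 <= `| - 2 ^+ N + m%:R * h0 + t|.
    rewrite negb_and -ltnNge -leqNgt => /orP[hm1|hm1] t ht.
      have : (m.+1%:R : R) * h0 <= ((2 ^ N - 2 ^ p) * 2 ^ N)%:R * h0.
        by rewrite ler_wpM2r ?ler_nat // ltW.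
      rewrite -natr1 mulrDl mul1r natrM -mulrA h2N mulr1 natrB ?leq_exp2l // !natrX => h3.
      by rewrite -normrN; apply: le_trans _ (ler_norm _); case: ht => ->; lra.
    have : ((2 ^ N - 2 ^ p) * 2 ^ N + n0 * 2 ^ N)%:R * h0 <= m%:R * h0.
      by rewrite ler_wpM2r ?ler_nat // ltW.
    rewrite natrD !natrM /n0 mulrDl -!mulrA h2N !mulr1 natrB ?leq_exp2l // natrD !natrX => h3.
    by apply: le_trans _ (ler_norm _); case: ht => ->; lra.
  have kz z : (forall t, t = 0 \/ t = h0 -> 2 ^+ p - 1 <= `|complex.Re z + t|) \/
              (forall t, t = 0 \/ t = h0 -> 2 ^+ p - 1 <= `|complex.Im z + t|) ->
      dbar k h0 z = 0.
    move=> H1; rewrite /dbar !kout ?subrr ?mulr0 ?addr0 //;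
      (case: H1 => H1; [left|right]); rewrite ?ReD ?ImD /= ?addr0;
      first [by apply: H1; right | by rewrite -[X in `|X|]addr0; apply: H1; left].
  apply: kz; rewrite andbA negb_and in H; case/orP: H => H; [left|right]; exact: (far _ H).
rewrite /gsum -/h0 shrink; last by move=> z ->; rewrite mul0r.
have z0 : rect (dbar (fun z => k z * q z) h0) b0 b0 h0 (n0 * 2 ^ N) = 0.
  have e1 : b0 + (n0 * 2 ^ N)%:R * h0 = 2 ^+ p.
    by rewrite natrM -mulrA h2N mulr1 /n0 natrD natrX /b0; ring.
  have p0 : 0 < (2 ^+ p : R) by rewrite exprn_gt0.
  apply: rect_dbar => i; rewrite !kout ?mul0r //; rewrite /= ?e1 ?mul0r ?addr0.
  + by left; rewrite normrN gtr0_norm // lerBlDl lerDr.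
  + by left; rewrite gtr0_norm // lerBlDl lerDr.
  + by right; rewrite normrN gtr0_norm // lerBlDl lerDr.
  + by right; rewrite gtr0_norm // lerBlDl lerDr.
have -> : rect (fun z => dbar k h0 z * q z) b0 b0 h0 (n0 * 2 ^ N) =
  - rect (dbar_def k q h0) b0 b0 h0 (n0 * 2 ^ N).
  apply/eqP; rewrite -addr_eq0 -rectD -[X in _ == X]z0; apply/eqP.
  by apply: eq_rect => z; rewrite dbarM.
by rewrite mulrN cnormN.
Qed.

End GreenSums.

(** * Cutting out exceptional points *)

Section Bump.
Variable R : realType.
Local Notation C := (CC R).
Implicit Types (z w c : C) (r L rho Q : R) (k q g : C -> C).

Definition bump c r : C -> C :=
  fun z => (Num.max 0 (Num.min 1 (2 - normc (z - c) / r)))%:C.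

Lemma clamp_lip (x y : R) :
  `|Num.max 0 (Num.min 1 x) - Num.max 0 (Num.min 1 y)| <= `|x - y|.
Proof.
wlog xy : x y / x <= y => [hw|].
  case: (leP x y) => h; first exact: hw.
  by rewrite distrC [leRHS]distrC; apply: hw; exact: ltW.
rewrite [leRHS]distrC [leRHS]ger0_norm ?subr_ge0 //.
rewrite /Num.max /Num.min; do 4?case: ifPn; rewrite -?leNgt => *; rewrite ler_norml; apply/andP; split; lra.
Qed.

Lemma bump_lip c r : 0 < r -> lip (bump c r) r^-1.
Proof.
move=> r0 z w; rewrite /bump -rcB cnorm_real; apply: le_trans (clamp_lip _ _) _.
have -> : 2 - normc (z - c) / r - (2 - normc (w - c) / r) =
  (normc (w - c) - normc (z - c)) / r by field; rewrite gt_eqF.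
rewrite normrM mulrC (@gtr0_norm _ r^-1) ?invr_gt0 // ler_wpM2l ?invr_ge0 ?(ltW r0) //.
by apply: le_trans (cnorm_dist _ _) _; rewrite opprB addrA subrK cdistC.
Qed.

Lemma bump_le1 c r z : normc (bump c r z) <= 1.
Proof.
rewrite /bump cnorm_real ger0_norm ?le_max ?lexx // ge_max ler01 /=.
by rewrite ge_min lexx.
Qed.

Lemma bump1 c r z : 0 < r -> normc (z - c) <= r -> bump c r z = 1.
Proof.
move=> r0 h; have h1 : normc (z - c) / r <= 1 by rewrite ler_pdivrMr // mul1r.
by rewrite /bump min_l ?max_r //; lra.
Qed.

Lemma bump0 c r z : 0 < r -> 2 * r <= normc (z - c) -> bump c r z = 0.
Proof.
move=> r0 h; have h1 : 2 <= normc (z - c) / r by rewrite ler_pdivlMr.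
by rewrite /bump min_r ?max_l //; lra.
Qed.

Lemma bump_supp c r : 0 < r -> supp_in (bump c r) c (2 * r).
Proof.
move=> r0 z; apply: contraNT; rewrite -ltNge => h; apply/eqP; apply: bump0 => //.
exact: ltW.
Qed.

Lemma supp_in_shift k c c' rho : supp_in k c rho -> supp_in k c' (rho + normc (c - c')).
Proof.
by move=> h z /h hz; apply: le_trans (cdist_triangle c _ _) _; rewrite lerD2r.
Qed.

Lemma lipM k1 k2 (L1 L2 K1 K2 : R) : lip k1 L1 -> lip k2 L2 ->
  (forall z, normc (k1 z) <= K1) -> (forall z, normc (k2 z) <= K2) ->
  lip (fun z => k1 z * k2 z) (L1 * K2 + K1 * L2).
Proof.
move=> h1 h2 b1 b2 z w.
have -> : k1 z * k2 z - k1 w * k2 w = (k1 z - k1 w) * k2 z + k1 w * (k2 z - k2 w) by ring.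
apply: le_trans (cnormD _ _) _; rewrite !cnormM mulrDl; apply: lerD.
  rewrite mulrAC; apply: ler_pM; rewrite ?cnorm_ge0 //.
by rewrite -mulrA; apply: ler_pM; rewrite ?cnorm_ge0.
Qed.

Lemma lipB k1 k2 (L1 L2 : R) : lip k1 L1 -> lip k2 L2 -> lip (fun z => k1 z - k2 z) (L1 + L2).
Proof.
move=> h1 h2 z w; have -> : k1 z - k2 z - (k1 w - k2 w) = (k1 z - k1 w) - (k2 z - k2 w) by ring.
apply: le_trans (cnormB _ _) _; rewrite mulrDl; exact: lerD.
Qed.

Lemma lip_cst (t : C) : lip (fun=> t) 0.
Proof. by move=> z w; rewrite subrr cnorm0 mul0r. Qed.

Definition bounded_near q c := exists d M, 0 < d /\ forall z, normc (z - c) < d -> normc (q z) <= M.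
Definition zero_near k c := exists d : R, 0 < d /\ forall z, normc (z - c) < d -> k z = 0.

(** Finitely many points where [q] is only bounded do not matter: cutting out a
    disc of radius [d] around such a point costs at most a multiple of [d]. *)
Lemma green_exc (Z : seq C) : forall k q L rho, lip k L -> supp_in k 0 rho ->
  (forall c, [\/ cdiff q c, zero_near k c | c \in Z /\ bounded_near q c]) ->
  nul (gsum k q).
Proof.
elim: Z => [|z0 Z IH] k q L rho kL kc kq.
  apply: (green kL kc) => c; case: (kq c) => [h|h|[]]; [by left|by right|by []].
have [dd|nz] := pselect (cdiff q z0 \/ zero_near k z0).
  apply: (IH _ _ _ _ kL kc) => c; case: (kq c) => [h|h|[]]; [by constructor 1|by constructor 2|].
  rewrite in_cons => /orP[/eqP ->|h] h2; last by constructor 3.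
  by case: dd => h; [constructor 1|constructor 2].
have [d [M [d0 qM]]] : bounded_near q z0.
  by case: (kq z0) => [h|h|[_ //]]; exfalso; apply: nz; [left|right].
have M0 : 0 <= M.
  by have := qM z0; rewrite subrr cnorm0 => /(_ d0); apply: le_trans; exact: cnorm_ge0.
have [K [K0 kK]] : exists K, 0 <= K /\ forall z, normc (k z) <= K.
  have kc' : supp_in k 0 (Num.max 0 rho).
    by move=> z /kc h; rewrite le_max h orbT.
  have r0 : 0 <= Num.max 0 rho by rewrite le_max lexx.
  exists (L * (2 * Num.max 0 rho + 1)); split; last exact: (lip_bounded r0 kL kc').
  by rewrite mulr_ge0 ?(lip_ge0 kL) //; lra.
have L0 := lip_ge0 kL.
move=> e e0.
have D0 : 0 < 72 * (L + K) * M + 1 by rewrite ltr_wpDl // !mulr_ge0 //; lra.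
pose r := Num.min (Num.min 1 (d / 5)) (e / 2 / (72 * (L + K) * M + 1)).
have r0 : 0 < r by rewrite !lt_min ltr01 !divr_gt0.
have [rd r1 re] : [/\ r <= d / 5, r <= 1 & r <= e / 2 / (72 * (L + K) * M + 1)].
  by rewrite /r; split; rewrite !ge_min ?lexx ?orbT.
pose b := bump z0 r.
have kE : k = fun z => k z * (1 - b z) + k z * b z by apply/funext => z; ring.
have sE N : gsum k q N = gsum (fun z => k z * (1 - b z)) q N + gsum (fun z => k z * b z) q N.
  by rewrite {1}kE gsumDl.
have bL : lip b r^-1 by exact: bump_lip.
have kbL : lip (fun z => k z * b z) (L * 1 + K * r^-1).
  by apply: lipM => //; exact: bump_le1.
have b1L : lip (fun z => 1 - b z) (0 + r^-1).
  exact: (lipB (lip_cst 1) bL).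
have b1b z : normc (1 - b z) <= 2.
  by apply: le_trans (cnormB _ _) _; rewrite cnorm1; have := bump_le1 z0 r z; rewrite -/(b z); lra.
have h1 : nul (gsum (fun z => k z * (1 - b z)) q).
  apply: (IH _ _ _ rho (lipM kL b1L kK b1b)).
    by move=> z; rewrite mulf_eq0 negb_or => /andP[/kc].
  move=> c; case: (kq c) => [h|[t [t0 ht]]|[]]; first by constructor 1.
    by constructor 2; exists t; split => // z /ht ->; rewrite mul0r.
  rewrite in_cons => /orP[/eqP ->|h] h2; last by constructor 3.
  constructor 2; exists r; split => // z hz.
  by rewrite /b bump1 ?subrr ?mulr0 // ltW.
have h2 : ev_le (gsum (fun z => k z * b z) q) (18 * (L * 1 + K * r^-1) * M * (2 * r) ^+ 2).
  apply: (@gsum_ev _ _ _ _ z0) => //.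
  - by lra.
  - by move=> z; rewrite mulf_eq0 negb_or => /andP[_ h]; apply: bump_supp.
  - exists r; split => // z; case: (leP (3 * r) (normc (z - z0))) => hz.
      right => w hw; have := cdist_triangle w z z0; rewrite (cdistC z w) => ht.
      by rewrite /b !bump0 ?mulr0 //; lra.
    by left; apply: qM; lra.
have -> : gsum k q = fun N => gsum (fun z => k z * (1 - b z)) q N + gsum (fun z => k z * b z) q N.
  by apply/funext.
rewrite [e]splitr; apply: ev_leD; first by apply: h1; lra.
apply: ev_le_mono h2.
have -> : 18 * (L * 1 + K * r^-1) * M * (2 * r) ^+ 2 = 72 * (L * r + K) * M * r.
  by field; rewrite gt_eqF.
rewrite ler_pdivlMr // in re.
have : L * r <= L by rewrite ler_piMr.
have rM : 0 <= r * M by rewrite mulr_ge0 // ltW.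
nra.
Qed.

Lemma gsum_eq_near k1 k2 q L1 L2 rho (Z : seq C) : lip k1 L1 -> lip k2 L2 ->
  supp_in k1 0 rho -> supp_in k2 0 rho ->
  (forall c, [\/ cdiff q c, zero_near (fun z => k1 z - k2 z) c | c \in Z /\ bounded_near q c]) ->
  nul (fun N => gsum k1 q N - gsum k2 q N).
Proof.
move=> h1 h2 s1 s2 hq.
apply: (@nul_ext _ (gsum (fun z => k1 z - k2 z) q)); first by move=> N; rewrite gsumBl.
apply: (green_exc (Z := Z) (lipB h1 h2) (rho := rho)) => // z.
have [->|k1z] := eqVneq (k1 z) 0; last by move=> _; exact: s1.
by rewrite sub0r oppr_eq0; exact: s2.
Qed.

End Bump.

(** * The constant of the Cauchy kernel *)

Section Normalisation.
Variable R : realType.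
Local Notation C := (CC R).
Implicit Types (z w c : C) (r L rho Q : R) (k q g : C -> C).

Definition c0seq : nat -> C := gsum (bump 0 1) (fun z => z^-1).
(** The value of the integral of the Cauchy kernel, by which [cint] is
    normalized. Only that it is nonzero matters. *)
Definition c0 : C := clim c0seq.

Lemma cdiff_invB w z : z != w -> cdiff (fun z => (z - w)^-1 : C) z.
Proof.
move=> zw; apply: cdiffV; last by rewrite subr_eq0.
by apply: cdiffB; [exact: cdiff_id|exact: cdiff_cst].
Qed.

Lemma bump_cst_near c r z : 0 < r -> normc (z - c) < r ->
  exists d, 0 < d /\ forall w, normc (w - z) < d -> bump c r w = 1.
Proof.
move=> r0 h; exists (r - normc (z - c)); split; first by rewrite subr_gt0.
move=> w hw; apply: bump1 => //; have := cdist_triangle z w c; lra.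
Qed.

Lemma bump_diff_near c r c' r' z : 0 < r -> 0 < r' -> normc (z - c) < r ->
  normc (z - c') < r' -> zero_near (fun z => bump c r z - bump c' r' z) z.
Proof.
move=> r0 r0' h h'; have [d [d0 hd]] := bump_cst_near r0 h.
have [d' [d0' hd']] := bump_cst_near r0' h'.
exists (Num.min d d'); split; first by rewrite lt_min d0 d0'.
by move=> w; rewrite lt_min => /andP[/hd -> /hd' ->]; rewrite subrr.
Qed.

Lemma bump_supp0 c r : 0 < r -> supp_in (bump c r) 0 (2 * r + normc c).
Proof. by move=> r0; have := supp_in_shift 0 (@bump_supp _ c _ r0); rewrite subr0. Qed.

Lemma supp_in_le k c rho rho' : rho <= rho' -> supp_in k c rho -> supp_in k c rho'.
Proof. by move=> h kc z /kc hz; apply: le_trans h. Qed.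

(** The difference of two cutoff functions equal to 1 near the pole [w] vanishes
    near [w], so Green's formula applies to it. *)
Lemma gsum_bump_eq q c r c' r' w (Z : seq C) : 0 < r -> 0 < r' -> normc (w - c) < r ->
  normc (w - c') < r' -> (forall z, z != w -> cdiff q z) ->
  nul (fun N => gsum (bump c r) q N - gsum (bump c' r') q N).
Proof.
move=> r0 r0' h h' hq.
pose rho := Num.max (2 * r + normc c) (2 * r' + normc c').
apply: (@gsum_eq_near _ _ _ _ _ _ rho [::] (@bump_lip _ _ _ r0) (@bump_lip _ _ _ r0')).
- have h1 : 2 * r + normc c <= rho by rewrite le_max lexx.
  exact: (supp_in_le h1 (@bump_supp0 c r r0)).
- have h1 : 2 * r' + normc c' <= rho by rewrite le_max lexx orbT.
  exact: (supp_in_le h1 (@bump_supp0 c' r' r0')).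
move=> z; have [->|zw] := eqVneq z w; last by constructor 1; exact: hq.
by constructor 2; exact: bump_diff_near.
Qed.

(** The center [c] need not lie on the grids. The discs of radius [M] about [c]
    and about 0 give nearly the same integral when [M] is large, and the radius
    may be changed by Green's formula. *)
Lemma c0_bump c r : 0 < r ->
  nul (fun N => gsum (bump c r) (fun z => (z - c)^-1) N - c0seq N).
Proof.
move=> r0 e e0.
pose M : R := Num.max (4 * normc c + 1) (576 * normc c / (e / 4) + 1).
have M1 : 4 * normc c + 1 <= M by rewrite le_max lexx.
have M2 : 576 * normc c / (e / 4) + 1 <= M by rewrite le_max lexx orbT.
have M0 : 0 < M by have := cnorm_ge0 c; lra.
have e4 : 0 < e / 4 by rewrite divr_gt0.
have d1 : forall z, z != c -> cdiff (fun z => (z - c)^-1 : C) z by move=> z; exact: cdiff_invB.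
have cc r1 : 0 < r1 -> normc (c - c) < r1 by rewrite subrr cnorm0.
have s1 := @gsum_bump_eq _ c r c M c [::] r0 M0 (cc _ r0) (cc _ M0) d1 _ e4.
have cM : normc (c - 0) < M by rewrite subr0; have := cnorm_ge0 c; lra.
have s2 := @gsum_bump_eq _ c M 0 M c [::] M0 M0 (cc _ M0) cM d1 _ e4.
have d2 : forall z, z != 0 -> cdiff (fun z => z^-1 : C) z.
  by move=> z z0; apply: cdiffV => //; exact: cdiff_id.
have oo r1 : 0 < r1 -> normc (0 - 0 : C) < r1 by rewrite subrr cnorm0.
have s4 := @gsum_bump_eq _ 0 M 0 1 0 [::] M0 ltr01 (oo _ M0) (oo _ ltr01) d2 _ e4.
have Q0 : 0 <= 8 * normc c / M ^+ 2.
  by rewrite divr_ge0 ?mulr_ge0 ?cnorm_ge0 ?exprn_ge0 // ltW.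
have s3 : ev_le (gsum (bump 0 M) (fun z => (z - c)^-1 - z^-1)) (e / 4).
  apply: (@ev_le_mono _ _ (18 * M^-1 * (8 * normc c / M ^+ 2) * (2 * M) ^+ 2)).
    have -> : 18 * M^-1 * (8 * normc c / M ^+ 2) * (2 * M) ^+ 2 = 576 * normc c / M.
      by field; rewrite gt_eqF.
    rewrite ler_pdivrMr // [leRHS]mulrC -ler_pdivrMr //; lra.
  apply: (@gsum_ev _ _ _ _ 0) => //.
  - by rewrite mulr_gt0.
  - exact: bump_lip.
  - exact: bump_supp.
  exists (M / 4); split; first by rewrite divr_gt0.
  move=> z; case: (leP (M / 2) (normc z)) => hz.
    left; have zc : M / 4 <= normc (z - c).
      by have := cnorm_sub z c; lra.
    have z0 : z != 0 by rewrite -cnorm_gt0; lra.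
    have zc0 : z - c != 0 by rewrite -cnorm_gt0; lra.
    have -> : (z - c)^-1 - z^-1 = c / ((z - c) * z) by field; rewrite z0 zc0.
    rewrite cnormM cnormV cnormM.
    rewrite ler_pdivrMr ?mulr_gt0 ?cnorm_gt0 //.
    rewrite mulrAC ler_pdivlMr ?exprn_gt0 //.
    have := cnorm_ge0 c.
    have : M / 4 * (M / 2) <= normc (z - c) * normc z by apply: ler_pM => //; lra.
    nra.
  right => w hw; rewrite !bump1 ?subr0 //; try lra.
  by have := cdist_triangle z w 0; rewrite !subr0; lra.
have -> : (fun N => gsum (bump c r) (fun z => (z - c)^-1) N - c0seq N) = fun N =>
  ((gsum (bump c r) (fun z => (z - c)^-1) N - gsum (bump c M) (fun z => (z - c)^-1) N) +
  (gsum (bump c M) (fun z => (z - c)^-1) N - gsum (bump 0 M) (fun z => (z - c)^-1) N)) +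
  (gsum (bump 0 M) (fun z => (z - c)^-1 - z^-1) N +
  (gsum (bump 0 M) (fun z => z^-1) N - gsum (bump 0 1) (fun z => z^-1) N)).
  by apply/funext => N; rewrite gsumBr /c0seq; ring.
have -> : e = (e / 4 + e / 4) + (e / 4 + e / 4) by field.
by apply: ev_leD; apply: ev_leD.
Qed.

Lemma c0_bdd : bdd c0seq.
Proof.
exists (18 * 1^-1 * 2 * (2 * 1) ^+ 2); apply: (@gsum_ev _ _ _ _ 0) => //.
- exact: bump_lip.
- exact: bump_supp.
exists (1 / 2); split; first by rewrite divr_gt0.
move=> z; case: (leP (1 / 2) (normc z)) => hz.
  left; rewrite cnormV -[2]invrK lef_pV2 ?posrE ?invr_gt0 //; lra.
right => w hw; rewrite !bump1 ?subr0 //; try lra.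
by have := cdist_triangle z w 0; rewrite !subr0; lra.
Qed.

End Normalisation.

Section NonVanishing.
Variable R : realType.
Local Notation C := (CC R).

Lemma rect_sub_le (G : C -> R) a b h (m n p : nat) :
  (forall k l, 0 <= G (gpt a b h k l)) ->
  rect G (a + m%:R * h) (b + m%:R * h) h n <= rect G a b h (m + n + p).
Proof.
move=> G0; rewrite /rect.
have sub (f : nat -> R) : (forall k, 0 <= f k) ->
    \sum_(k < n) f (m + k)%N <= \sum_(k < m + n + p) f k.
  move=> f0; rewrite big_split_ord /= big_split_ord /=.
  have h1 : 0 <= \sum_(i < m) f i by apply: sumr_ge0.
  have h2 : 0 <= \sum_(i < p) f (m + n + i)%N by apply: sumr_ge0.
  lra.
apply: (@le_trans _ _ (\sum_(k < n) \sum_(l < m + n + p) G (gpt a b h (m + k) l))).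
  apply: ler_sum => k _.
  apply: le_trans (sub (fun l => G (gpt a b h (m + k) l)) _) => //.
  by rewrite le_eqVlt; apply/orP; left; apply/eqP; apply: eq_bigr => l _; rewrite gpt_shift.
apply: (sub (fun k => \sum_(l < m + n + p) G (gpt a b h k l))) => k.
exact: sumr_ge0.
Qed.

Let phi (u : R) := Num.max 0 (Num.min 1 (2 - u)).

Lemma phi_mono u v : u <= v -> phi v <= phi u.
Proof.
move=> uv; rewrite /phi ge_max le_max lexx /= le_max; apply/orP; right.
by rewrite le_min !ge_min lexx /=; apply/orP; right; lra.
Qed.

Let A h (z : C) := phi (normc (z + hstep h)) - phi (normc z).
Let B h (z : C) := phi (normc (z + vstep h)) - phi (normc z).

Lemma Re_dbar_bump h (z : C) :
  complex.Re (dbar (bump 0 1) h z * z^-1) =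
  (A h z * complex.Re z + B h z * complex.Im z) / normc z ^+ 2.
Proof.
have bE (w : C) : bump 0 1 w = (phi (normc w))%:C by rewrite /bump subr0 divr1.
rewrite /dbar !bE -!rcB -/(A h z) -/(B h z) sqr_cnorm.
by case: z => x y; rewrite /ii /=; ring.
Qed.

(** The cutoff function decreases away from the axis in each variable. *)
Lemma sgn_step (h x y : R) (z : C) (f : R -> C) : 0 < h -> 
  normc z ^+ 2 = x ^+ 2 + y ^+ 2 ->
  normc (f h) ^+ 2 = (x + h) ^+ 2 + y ^+ 2 -> (0 <= x \/ x <= - h) ->
  (phi (normc (f h)) - phi (normc z)) * x <= 0.
Proof.
move=> h0 hz hf [x0|xh].
  apply: mulr_le0_ge0 => //; rewrite subr_le0; apply: phi_mono.
  by rewrite -(@ler_pXn2r _ 2) ?nnegrE ?cnorm_ge0 // hz hf; nra.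
apply: mulr_ge0_le0; last lra; rewrite subr_ge0; apply: phi_mono.
by rewrite -(@ler_pXn2r _ 2) ?nnegrE ?cnorm_ge0 // hz hf; nra.
Qed.

(** A definite decrease on a square contained in the ramp of the cutoff
    function, which makes the total nonzero. *)
Lemma ramp_step (h x y : R) (z w : C) : 0 < h -> h <= 1 / 16 -> 
  normc z ^+ 2 = x ^+ 2 + y ^+ 2 ->
  normc w ^+ 2 = (x + h) ^+ 2 + y ^+ 2 -> 1 <= x <= 5 / 4 -> 1 <= y <= 5 / 4 ->
  (phi (normc w) - phi (normc z)) * x <= - (h / 2).
Proof.
move=> h0 h1 hz hw xb yb.
have nz := cnorm_ge0 z; have nw := cnorm_ge0 w.
have z1 : 1 <= normc z by nra.
have w1 : 1 <= normc w by nra.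
have z2 : normc z <= 2 by nra.
have w2 : normc w <= 2 by nra.
have pE u : 1 <= u -> u <= 2 -> phi u = 2 - u.
  by move=> u1 u2; rewrite /phi min_r ?max_r //; lra.
rewrite !pE //.
have : h / 2 <= normc w - normc z by nra.
nra.
Qed.

(** In the real part of the sum all terms have the same sign, and those of a
    fixed square add up to a definite amount. *)
Lemma c0_neq0 : c0 R != 0.
Proof.
suff h : complex.Re (c0 R) <= - (1 / 64).
  apply/eqP => e; move: h; rewrite e {e} => h; have {}h : (0 : R) <= - (1 / 64) := h; lra.
rewrite /c0 /clim /=; apply: rlim_le; first by apply: bddRe; exact: c0_bdd.
exists 4%N => N N4; set h := mesh R N.
have h0 : 0 < h := mesh_gt0 R N.
have h16 : h <= 1 / 16.
  rewrite /h /mesh -[1 / 16]invrK lef_pV2 ?posrE ?exprn_gt0 ?invr_gt0 ?divr_gt0 //.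
  apply: (@le_trans _ _ (2 ^+ 4)); first by rewrite div1r invrK; lra.
  by rewrite ler_eXn2l // ltr1n.
have h2N : (2 ^ N)%:R * h = 1 by rewrite /h /mesh natrX divff // expf_neq0 // pnatr_eq0.
pose G (z : C) := - complex.Re (dbar (bump 0 1) h z * z^-1).
have ReS : complex.Re (c0seq R N) =
    - (h * rect G (- 2 ^+ N) (- 2 ^+ N) h (2 ^ N * 2 ^ N + 2 ^ N * 2 ^ N)).
  rewrite /c0seq /gsum -/h.
  have -> : forall w : C, complex.Re (h%:C * w) = h * complex.Re w by case=> x y /=; ring.
  rewrite -mulrN; congr (_ * _).
  have Re_sum (I : finType) (F : I -> C) :
      complex.Re (\sum_i F i) = \sum_i complex.Re (F i).
    by elim/big_rec2: _ => // i y1 y2 _ <-; rewrite ReD.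
  rewrite /rect Re_sum -sumrN; apply: eq_bigr => k _; rewrite Re_sum -sumrN.
  by apply: eq_bigr => l _; rewrite /G opprK.
have side (k : nat) : let x := - 2 ^+ N + k%:R * h in 0 <= x \/ x <= - h.
  have e1 : (2 ^ N * 2 ^ N)%:R * h = 2 ^+ N by rewrite natrM -mulrA h2N mulr1 natrX.
  move=> x; have [kN|kN] := leqP (2 ^ N * 2 ^ N) k; [left|right]; rewrite /x.
    have : (2 ^ N * 2 ^ N)%:R * h <= k%:R * h by rewrite ler_wpM2r ?ler_nat // ltW.
    lra.
  have : k.+1%:R * h <= (2 ^ N * 2 ^ N)%:R * h by rewrite ler_wpM2r ?ler_nat // ltW.
  rewrite -natr1; lra.
have Ab (z : C) : 0 <= complex.Re z \/ complex.Re z <= - h -> A h z * complex.Re z <= 0.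
  move=> H; apply: (@sgn_step h _ (complex.Im z) z (fun h => z + hstep h)) => //.
    exact: sqr_cnorm.
  by rewrite sqr_cnorm ReD ImD /= addr0.
have Bb (z : C) : 0 <= complex.Im z \/ complex.Im z <= - h -> B h z * complex.Im z <= 0.
  move=> H; apply: (@sgn_step h _ (complex.Re z) z (fun h => z + vstep h)) => //.
    by rewrite addrC; exact: sqr_cnorm.
  by rewrite sqr_cnorm ReD ImD /= addr0 addrC.
have G0 k l : 0 <= G (gpt (- 2 ^+ N) (- 2 ^+ N) h k l).
  rewrite /G Re_dbar_bump oppr_ge0 mulr_le0_ge0 ?invr_ge0 ?sqr_ge0 //.
  have := Ab (gpt (- 2 ^+ N) (- 2 ^+ N) h k l) (side k).
  have := Bb (gpt (- 2 ^+ N) (- 2 ^+ N) h k l) (side l).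
  lra.
pose m := (2 ^ N * 2 ^ N + 2 ^ N)%N.
pose n := (2 ^ (N - 2))%N.
have n4 : (n * 4 = 2 ^ N)%N by rewrite /n -[4%N]/(2 ^ 2)%N -expnD subnK // (leq_trans _ N4).
pose p := (2 ^ N * 2 ^ N - 2 ^ N - n)%N.
have tot : (2 ^ N * 2 ^ N + 2 ^ N * 2 ^ N = m + n + p)%N.
  have : (2 ^ N * 2 <= 2 ^ N * 2 ^ N)%N.
    by rewrite leq_mul2l (_ : (2 <= 2 ^ N)%N) ?orbT // -{1}[2%N]expn1 leq_exp2l // (leq_trans _ N4).
  rewrite /m /p; lia.
have := rect_sub_le m n p G0; rewrite -tot.
have -> : - 2 ^+ N + m%:R * h = 1.
  rewrite /m natrD mulrDl h2N natrM -mulrA h2N mulr1 natrX; ring.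
have nh : n%:R * h = 1 / 4.
  have e2 : (n * 4)%:R * h = 1 :> R by rewrite n4.
  by rewrite natrM in e2; lra.
have Gb (k l : 'I_n) : h / 4 <= G (gpt 1 1 h k l).
  set z := gpt _ _ _ _ _.
  have lt_n (i : 'I_n) : 0 <= i%:R * h <= 1 / 4.
    rewrite -nh mulr_ge0 ?(ltW h0) //= ler_wpM2r ?(ltW h0) // ler_nat ltnW //.
  have xb : 1 <= complex.Re z <= 5 / 4 by have := lt_n k; rewrite /z /=; lra.
  have yb : 1 <= complex.Im z <= 5 / 4 by have := lt_n l; rewrite /z /=; lra.
  have hA : A h z * complex.Re z <= - (h / 2).
    apply: (@ramp_step h _ (complex.Im z)) => //; first exact: sqr_cnorm.
    by rewrite sqr_cnorm ReD ImD /= addr0.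
  have hB : B h z * complex.Im z <= - (h / 2).
    apply: (@ramp_step h _ (complex.Re z)) => //; first by rewrite addrC; exact: sqr_cnorm.
    by rewrite sqr_cnorm ReD ImD /= addr0 addrC.
  rewrite /G Re_dbar_bump -mulNr ler_pdivlMr ?sqr_cnorm; last by nra.
  have s4 : complex.Re z ^+ 2 + complex.Im z ^+ 2 <= 4 by clear -xb yb; nra.
  have h40 : 0 <= h / 4 by lra.
  have := ler_wpM2l h40 s4; lra.
have : n%:R * (n%:R * (h / 4)) <= rect G 1 1 h n.
  rewrite /rect; apply: (@le_trans _ _ (\sum_(k < n) \sum_(l < n) (h / 4))).
    by rewrite !sumr_const card_ord -mulrnA -[leRHS]mulr_natl natrM mulrA.
  by apply: ler_sum => k _; apply: ler_sum => l _; exact: Gb.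
rewrite ReS; set T1 := rect _ _ _ _ _; set T2 := rect _ _ _ _ _ => t1 t2.
have : h * (n%:R * (n%:R * (h / 4))) <= h * T2.
  by rewrite ler_wpM2l ?(ltW h0) //; lra.
have -> : h * (n%:R * (n%:R * (h / 4))) = (n%:R * h) ^+ 2 / 4 by field.
rewrite nh; lra.
Qed.

End NonVanishing.

(** * Cauchy's formula *)

Section Cauchy.
Variable R : realType.
Local Notation C := (CC R).
Implicit Types (z w c : C) (r L rho Q M : R) (k q g : C -> C).

(** The functional that replaces the normalized contour integral. *)
Definition cint k q : C := clim (gsum k q) / c0 R.

Lemma gsum_cong k q1 q2 : (exists eta, 0 < eta /\
    forall z, q1 z = q2 z \/ (forall w, normc (w - z) < eta -> k w = k z)) ->
  exists N0, forall N, (N0 <= N)%N -> gsum k q1 N = gsum k q2 N.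
Proof.
move=> [eta [eta0 h]].
have [N0 hN] := mesh_small (divr_gt0 eta0 (ltr0n _ 2)).
exists N0 => N /hN hm; have h0 := mesh_gt0 R N.
rewrite /gsum; congr (_ * _); apply: eq_rect => z.
case: (h z) => [-> //|cst].
rewrite /dbar !cst ?subrr ?mulr0 ?addr0 ?mul0r //.
  rewrite addrC addKr cnorm_vstep ?(ltW h0) //; lra.
rewrite addrC addKr cnorm_hstep ?(ltW h0) //; lra.
Qed.

Lemma clim_ev_eq (u v : nat -> C) : bdd u ->
  (exists N0, forall N, (N0 <= N)%N -> v N = u N) -> clim v = clim u.
Proof.
move=> bu [N0 h]; apply: clim_eq => // e e0; exists N0 => n /h ->.
by rewrite subrr cnorm0 ltW.
Qed.

Lemma bdd_ev_eq (u v : nat -> C) : bdd u ->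
  (exists N0, forall N, (N0 <= N)%N -> v N = u N) -> bdd v.
Proof.
move=> [M [N1 h1]] [N0 h]; exists M, (maxn N0 N1) => n; rewrite geq_max => /andP[n0 n1].
by rewrite h // h1.
Qed.

Lemma cintD k q1 q2 : bdd (gsum k q1) -> bdd (gsum k q2) ->
  cint k (fun z => q1 z + q2 z) = cint k q1 + cint k q2.
Proof.
move=> h1 h2; rewrite /cint -mulrDl -climD //; congr (clim _ / _).
by apply/funext => N; rewrite gsumDr.
Qed.

Lemma cintZ k q (t : C) : bdd (gsum k q) -> cint k (fun z => t * q z) = t * cint k q.
Proof.
move=> h1; rewrite /cint mulrA -climZ //; congr (clim _ / _).
by apply/funext => N; rewrite gsumZr.
Qed.

Lemma cint_le k q M : ev_le (gsum k q) M -> normc (cint k q) <= M / normc (c0 R).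
Proof.
move=> h; rewrite /cint cnormM cnormV ler_wpM2r ?invr_ge0 ?cnorm_ge0 //.
exact: clim_le.
Qed.

Lemma cint_ev_eq k q1 q2 : bdd (gsum k q1) ->
  (exists N0, forall N, (N0 <= N)%N -> gsum k q2 N = gsum k q1 N) ->
  cint k q2 = cint k q1.
Proof. by move=> h1 h2; rewrite /cint (clim_ev_eq h1 h2). Qed.

(** The annulus where [bump c r] varies, with some room on both sides. *)
Definition on_ring c r z := 3 / 4 * r <= normc (z - c) <= 9 / 4 * r.

Lemma bump_off_ring c r z : 0 < r -> ~ on_ring c r z ->
  forall w, normc (w - z) < r / 4 -> bump c r w = bump c r z.
Proof.
move=> r0 nr w hw.
have t1 := cdist_triangle z w c; have t2 := cdist_triangle w z c.
rewrite (cdistC z w) in t2.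
have [h1|h1] := ltP (normc (z - c)) (3 / 4 * r).
  by rewrite !bump1 //; lra.
have [h2|h2] := leP (normc (z - c)) (9 / 4 * r).
  by exfalso; apply: nr; rewrite /on_ring h1 h2.
by rewrite !bump0 //; lra.
Qed.

Lemma bounded_off_ring c r q Q : 0 < r ->
  (forall z, on_ring c r z -> normc (q z) <= Q) -> bounded_off (bump c r) q Q.
Proof.
move=> r0 hq; exists (r / 4); split; first by rewrite divr_gt0.
move=> z; have [h|h] := pselect (on_ring c r z); first by left; exact: hq.
by right; exact: bump_off_ring.
Qed.

Lemma gsum_ring_ev c r q Q : 0 < r -> 0 <= Q ->
  (forall z, on_ring c r z -> normc (q z) <= Q) -> ev_le (gsum (bump c r) q) (72 * r * Q).
Proof.
move=> r0 Q0 hq.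
have -> : 72 * r * Q = 18 * r^-1 * Q * (2 * r) ^+ 2 by field; rewrite gt_eqF.
apply: (gsum_ev (c := c)) => //; first by rewrite mulr_gt0.
- exact: bump_lip.
- exact: bump_supp.
exact: bounded_off_ring.
Qed.

(** The constant of all Cauchy estimates below. *)
Definition K0 : R := 72 / normc (c0 R).

Lemma K0_gt0 : 0 < K0.
Proof. by rewrite divr_gt0 // cnorm_gt0 c0_neq0. Qed.

Lemma cint_ring_le c r q Q : 0 < r -> 0 <= Q ->
  (forall z, on_ring c r z -> normc (q z) <= Q) ->
  normc (cint (bump c r) q) <= K0 * r * Q.
Proof.
move=> r0 Q0 /(gsum_ring_ev r0 Q0)/cint_le h; apply: le_trans h _.
rewrite /K0 le_eqVlt; apply/orP; left; apply/eqP; field.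
by rewrite cnorm_eq0 c0_neq0.
Qed.

Lemma cint_ring_eq c r q1 q2 : 0 < r -> bdd (gsum (bump c r) q1) ->
  (forall z, on_ring c r z -> q2 z = q1 z) ->
  bdd (gsum (bump c r) q2) /\ cint (bump c r) q2 = cint (bump c r) q1.
Proof.
move=> r0 h1 h2.
have h : exists N0, forall N, (N0 <= N)%N -> gsum (bump c r) q2 N = gsum (bump c r) q1 N.
  apply: gsum_cong; exists (r / 4); split; first by rewrite divr_gt0.
  move=> z; have [h|h] := pselect (on_ring c r z); first by left; exact: h2.
  by right; exact: bump_off_ring.
split; [exact: bdd_ev_eq h|exact: cint_ev_eq].
Qed.

Lemma cint_nul k q (t : C) : nul (fun N => gsum k q N - c0seq R N * t) ->
  bdd (gsum k q) /\ cint k q = t.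
Proof.
move=> h.
have b1 : bdd (fun N => c0seq R N * t).
  have := bddZ t (@c0_bdd R); congr bdd; apply/funext => N; exact: mulrC.
have e : gsum k q = fun N => (gsum k q N - c0seq R N * t) + c0seq R N * t.
  by apply/funext => N; rewrite subrK.
split; first by rewrite e; apply: bddD => //; exact: nul_bdd.
rewrite /cint e climD //; last exact: nul_bdd.
rewrite (clim0 h) add0r climM; last exact: c0_bdd.
by rewrite mulrAC divff ?c0_neq0 // mul1r.
Qed.

(** Cauchy's integral formula, for functions that may be merely bounded around
    finitely many points. *)
Lemma cauchy k L rho g w d0 (Z : seq C) : lip k L -> supp_in k 0 rho -> 0 < d0 ->
  (forall z, normc (z - w) < d0 -> k z = 1) ->
  (forall z, [\/ cdiff g z, zero_near k z | z \in Z /\ bounded_near g z]) ->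
  cdiff g w ->
  nul (fun N => gsum k (fun z => g z / (z - w)) N - c0seq R N * g w).
Proof.
move=> kL kc d00 k1 hg gw.
pose b := bump w (d0 / 2).
have d2 : 0 < d0 / 2 by rewrite divr_gt0.
have n1 : nul (gsum k (fun z => (g z - g w) / (z - w))).
  apply: (green_exc (Z := w :: Z) kL kc) => z; have [->|zw] := eqVneq z w.
    constructor 3; rewrite mem_head; split => //.
    have [l hl] := cdiff_eps gw; have [d [dp hd]] := hl 1 ltr01.
    exists d, (1 + normc l); split => // y hy.
    have [->|yw] := eqVneq y w.
      by rewrite !subrr mul0r cnorm0 addr_ge0 ?cnorm_ge0.
    rewrite cnormM cnormV ler_pdivrMr ?cnorm_gt0 ?subr_eq0 //.
    rewrite -(subrK (l * (y - w)) (g y - g w)); apply: le_trans (cnormD _ _) _.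
    by rewrite [leRHS]mulrDl -cnormM lerD2r; exact: hd.
  case: (hg z) => [h|h|[zZ [d [M [dp hd]]]]].
  - constructor 1; apply: cdiffM; last exact: cdiff_invB.
    exact: (cdiffB h (cdiff_cst (g w) z)).
  - by constructor 2.
  constructor 3; rewrite in_cons zZ orbT; split => //.
  have zw0 : 0 < normc (z - w) by rewrite cnorm_gt0 subr_eq0.
  exists (Num.min d (normc (z - w) / 2)), ((M + normc (g w)) / (normc (z - w) / 2)).
  split; first by rewrite lt_min dp divr_gt0.
  move=> y; rewrite lt_min => /andP[/hd y1 y2].
  rewrite cnormM cnormV; apply: ler_pM; rewrite ?invr_ge0 ?cnorm_ge0 //.
    by apply: le_trans (cnormB _ _) _; rewrite lerD2r.
  have := cdist_triangle y z w; rewrite (cdistC z y) => t.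
  by rewrite lef_pV2 ?posrE ?divr_gt0 //; lra.
have n2 : nul (fun N => gsum k (fun z => (z - w)^-1) N - gsum b (fun z => (z - w)^-1) N).
  pose rho' := Num.max rho (2 * (d0 / 2) + normc w).
  apply: (@gsum_eq_near _ _ _ _ _ _ rho' [::] kL (@bump_lip _ _ _ d2)).
  - by move=> z /kc h; rewrite le_max h.
  - by move=> z /(@bump_supp0 _ w _ d2) h; rewrite le_max h orbT.
  move=> z; have [->|zw] := eqVneq z w; last by constructor 1; exact: cdiff_invB.
  constructor 2; exists (d0 / 2); split => // y hy.
  by rewrite k1 ?bump1 ?subrr // ?ltW //; lra.
have n3 := @c0_bump _ w _ d2.
apply: (@nul_ext _ (fun N => gsum k (fun z => (g z - g w) / (z - w)) N +
   (g w * (gsum k (fun z => (z - w)^-1) N - gsum b (fun z => (z - w)^-1) N) +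
    g w * (gsum b (fun z => (z - w)^-1) N - c0seq R N)))).
  move=> N; have -> : (fun z => g z / (z - w)) = fun z => (g z - g w) / (z - w) + g w * (z - w)^-1.
    by apply/funext => z; rewrite -mulrDl subrK.
  rewrite gsumDr gsumZr; ring.
by apply: nulD => //; apply: nulD; apply: nulZ.
Qed.

Definition hol_exc g c (r : R) (Z : seq C) :=
  forall z, normc (z - c) < r -> cdiff g z \/ (z \in Z /\ bounded_near g z).

Lemma cauchy_bump g c r w (Z : seq C) : 0 < r -> hol_exc g c (3 * r) Z ->
  cdiff g w -> normc (w - c) < r ->
  bdd (gsum (bump c r) (fun z => g z / (z - w))) /\
  cint (bump c r) (fun z => g z / (z - w)) = g w.
Proof.
move=> r0 hg gw wr; have [d [d0 hd]] := bump_cst_near r0 wr.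
apply: cint_nul.
apply: (cauchy (Z := Z) (@bump_lip _ c _ r0) (@bump_supp0 _ c _ r0) d0 hd _ gw).
move=> z; case: (ltP (normc (z - c)) (3 * r)) => h.
  by case: (hg z h) => [h1|h1]; [constructor 1|constructor 3].
constructor 2; exists r; split => // y hy; apply: bump0 => //.
have := cdist_triangle y z c; rewrite (cdistC z y); lra.
Qed.

Definition hol_on g c (r : R) := forall z, normc (z - c) < r -> cdiff g z.

Lemma hol_on_exc g c r : hol_on g c r -> hol_exc g c r [::].
Proof. by move=> h z hz; left; exact: h. Qed.

(** Cauchy's formula with the kernel expanded to second order in [t / z]. *)
Lemma taylor2 g r M : 0 < r -> hol_on g 0 (3 * r) ->
  (forall z, normc z < 3 * r -> normc (g z) <= M) ->
  exists l, normc l <= 2 * K0 * M / r /\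
    forall t, normc t <= r / 2 -> normc (g t - g 0 - l * t) <= 8 * K0 * M / r ^+ 2 * normc t ^+ 2.
Proof.
move=> r0 hg gM.
have M0 : 0 <= M.
  have := gM 0; rewrite cnorm0 mulr_gt0 // => /(_ isT); apply: le_trans; exact: cnorm_ge0.
pose b := bump (0 : C) r.
have ringE z : on_ring 0 r z -> [/\ 3 / 4 * r <= normc z, normc (g z) <= M & z != 0].
  rewrite /on_ring subr0 => /andP[h1 h2]; split => //; first by apply: gM; lra.
  by rewrite -cnorm_gt0; lra.
pose q2 z := g z / z ^+ 2.
have q2Q z : on_ring 0 r z -> normc (q2 z) <= M / (3 / 4 * r) ^+ 2.
  move=> /ringE[z1 z2 z3]; rewrite cnormM cnormV cnormX.
  apply: ler_pM; rewrite ?invr_ge0 ?cnorm_ge0 ?exprn_ge0 ?cnorm_ge0 //.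
  by rewrite lef_pV2 ?posrE ?exprn_gt0 ?cnorm_gt0 ?mulr_gt0 // ler_pXn2r ?nnegrE ?cnorm_ge0 ?mulr_ge0 ?(ltW r0).
have Q20 : 0 <= M / (3 / 4 * r) ^+ 2 by rewrite divr_ge0 // sqr_ge0.
exists (cint b q2); split.
  apply: le_trans (cint_ring_le r0 Q20 q2Q) _.
  have -> : K0 * r * (M / (3 / 4 * r) ^+ 2) = 16 / 9 * (K0 * M / r) by field; rewrite gt_eqF.
  have -> : 2 * K0 * M / r = 2 * (K0 * M / r) by rewrite !mulrA.
  apply: ler_wpM2r; last lra.
  exact: (divr_ge0 (mulr_ge0 (ltW K0_gt0) M0) (ltW r0)).
move=> t tr.
have t3 : normc (t - 0) < 3 * r by rewrite subr0; lra.
have t1 : normc (t - 0) < r by rewrite subr0; lra.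
have o3 : normc (0 - 0 : C) < 3 * r by rewrite subrr cnorm0 mulr_gt0.
have o1 : normc (0 - 0 : C) < r by rewrite subrr cnorm0.
have [bt et] := cauchy_bump r0 (hol_on_exc hg) (hg t t3) t1.
have [bo eo] := cauchy_bump r0 (hol_on_exc hg) (hg 0 o3) o1.
have b2 : bdd (gsum b q2) by exists (72 * r * (M / (3 / 4 * r) ^+ 2)); exact: gsum_ring_ev.
pose q3 z := (g z / (z - t) + (-1) * (g z / (z - 0))) + (- t) * q2 z.
have b3 : bdd (gsum b (fun z => g z / (z - t) + (-1) * (g z / (z - 0)))).
  have := bddD bt (bddZ (-1) bo); congr bdd; apply/funext => N.
  by rewrite gsumDr gsumZr.
have bZ (u : C) q : bdd (gsum b q) -> bdd (gsum b (fun z => u * q z)).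
  by move=> h; have := bddZ u h; congr bdd; apply/funext => N; rewrite gsumZr.
have e3 : cint b q3 = g t - g 0 - cint b q2 * t.
  rewrite /q3 cintD //; last exact: bZ.
  rewrite cintD //; last exact: bZ.
  rewrite !cintZ // -/b in et eo *.
  by rewrite et eo; ring.
rewrite -e3.
have q3Q z : on_ring 0 r z -> normc (q3 z) <= normc t ^+ 2 * M / ((3 / 4 * r) ^+ 2 * (r / 4)).
  move=> /ringE[z1 z2 z3].
  have zt : r / 4 <= normc (z - t) by have := cnorm_sub z t; lraR.
  have zt0 : z - t != 0 by rewrite -cnorm_gt0; lra.
  have -> : q3 z = t ^+ 2 * g z / (z ^+ 2 * (z - t)).
    by rewrite /q3 /q2 subr0; field; rewrite z3 zt0.
  rewrite !cnormM cnormV cnormM !cnormX.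
  have p1 : 0 <= normc t ^+ 2 by exact: sqr_ge0.
  have p2 : 0 < normc z ^+ 2 * normc (z - t).
    by apply: mulr_gt0; [apply: exprn_gt0|]; rewrite cnorm_gt0.
  have p3 : 0 < (3 / 4 * r) ^+ 2 * (r / 4).
    by apply: mulr_gt0; [apply: exprn_gt0|]; lra.
  apply: ler_pM.
  - exact: (mulr_ge0 p1 (cnorm_ge0 _)).
  - by rewrite invr_ge0 ltW.
  - exact: (ler_wpM2l p1 z2).
  rewrite (lef_pV2 p2 p3).
  apply: ler_pM; rewrite ?sqr_ge0 //; first by lra.
  by rewrite ler_pXn2r ?nnegrE ?cnorm_ge0 //; lraR.
have Q30 : 0 <= normc t ^+ 2 * M / ((3 / 4 * r) ^+ 2 * (r / 4)).
  apply: divr_ge0; first exact: (mulr_ge0 (sqr_ge0 _) M0).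
  by apply: mulr_ge0; [exact: sqr_ge0|lraR].
apply: le_trans (cint_ring_le r0 Q30 q3Q) _.
have -> : K0 * r * (normc t ^+ 2 * M / ((3 / 4 * r) ^+ 2 * (r / 4))) =
   64 / 9 * (K0 * M / r ^+ 2 * normc t ^+ 2) by field; rewrite gt_eqF.
have -> : 8 * K0 * M / r ^+ 2 * normc t ^+ 2 = 8 * (K0 * M / r ^+ 2 * normc t ^+ 2).
  by rewrite !mulrA.
apply: ler_wpM2r; last lra.
by apply: mulr_ge0; [apply: mulr_ge0; [exact: (mulr_ge0 (ltW K0_gt0) M0)|]|];
  rewrite ?invr_ge0 sqr_ge0.
Qed.

End Cauchy.

(** * Bounded holomorphic functions on balls *)

Section Holomorphic.
Variables (R : realType) (V : normedModType (CC R)).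
Local Notation C := (CC R).
Local Notation K0 := (K0 R).
Implicit Types (f : V -> C) (x y h : V) (M rho : R).

Definition ball_hol f y rho M := forall w, nrm (w - y) < rho ->
  differentiable f w /\ normc (f w) <= M.

Lemma ball_hol_ge0 f y rho M : 0 < rho -> ball_hol f y rho M -> 0 <= M.
Proof.
move=> r0 h; have [|_] := h y; first by rewrite subrr nrm0.
by apply: le_trans; exact: cnorm_ge0.
Qed.

Lemma ball_hol_sub f y rho M y' rho' : nrm (y' - y) + rho' <= rho ->
  ball_hol f y rho M -> ball_hol f y' rho' M.
Proof.
move=> le hf w hw; apply: hf; apply: lt_le_trans le.
rewrite -(subrKA y'); apply: le_lt_trans (nrmD _ _) _.
by rewrite addrC ltrD2l.
Qed.

Lemma cdiff_line f y h (t : C) : differentiable f (t *: h + y) ->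
  cdiff (fun t => f (t *: h + y)) t.
Proof.
move=> df; rewrite /cdiff.
have -> : (fun t => f (t *: h + y)) = f \o (fun t : C => t *: h + y) by [].
exact: differentiable_comp.
Qed.

Lemma diff_dir f y h (l : C) (d A : R) : differentiable f y -> 0 < d ->
  (forall t : C, normc t <= d -> normc (f (t *: h + y) - f y - l * t) <= A * normc t ^+ 2) ->
  'd f y h = l.
Proof.
move=> df d0 hl; apply/eqP; rewrite -subr_eq0 -cnorm_eq0 eq_le cnorm_ge0 andbT.
have [h0|h0] := eqVneq h 0.
  rewrite h0 in hl *; rewrite linear0 sub0r cnormN; apply/ler_addgt0Pl => e e0; rewrite addr0.
  have A0 : 0 < `|A| + 1 by rewrite ltr_wpDl.
  pose t := Num.min d (e / (`|A| + 1)).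
  have t0 : 0 < t by rewrite lt_min d0 divr_gt0.
  have td : t <= d by rewrite /t ge_min lexx.
  have te : t <= e / (`|A| + 1) by rewrite /t ge_min lexx orbT.
  have := hl t%:C; rewrite cnorm_real gtr0_norm // => /(_ td).
  rewrite scaler0 add0r subrr sub0r cnormN cnormM cnorm_real gtr0_norm // => h1.
  have h2 : normc l <= A * t by rewrite -(ler_pM2r t0); apply: le_trans h1 _; rewrite expr2 mulrA.
  rewrite ler_pdivlMr // in te.
  have := ler_norm A; nra.
have nh : 0 < nrm h by rewrite nrm_gt0.
apply/ler_addgt0Pl => e e0; rewrite addr0.
have [d1 [d10 hd1]] := diff_eps df (divr_gt0 (divr_gt0 e0 (ltr0n _ 2)) nh).
have A0 : 0 < `|A| + 1 by rewrite ltr_wpDl.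
pose t := Num.min (Num.min d (d1 / 2 / nrm h)) (e / 2 / (`|A| + 1)).
have t0 : 0 < t by rewrite !lt_min d0 !divr_gt0.
have td : t <= d by rewrite /t !ge_min lexx.
have td1 : t <= d1 / 2 / nrm h by rewrite /t !ge_min lexx orbT.
have te : t <= e / 2 / (`|A| + 1) by rewrite /t ge_min lexx orbT.
have nt : normc (t%:C : C) = t by rewrite cnorm_real gtr0_norm.
have h1 := hl t%:C; rewrite nt in h1; have {}h1 := h1 td.
have h2 := hd1 (t%:C *: h); rewrite nrmZ nt in h2.
rewrite ler_pdivlMr // in td1.
have {}h2 : normc (f (t%:C *: h + y) - f y - 'd f y (t%:C *: h)) <=
   e / 2 / nrm h * (t * nrm h) by apply: h2; lra.
have e1 : 'd f y (t%:C *: h) = 'd f y h * t%:C by rewrite linearZ; exact: mulrC.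
rewrite e1 in h2.
have h3 : normc (('d f y h - l) * t%:C) <= A * t ^+ 2 + e / 2 / nrm h * (t * nrm h).
  have -> : ('d f y h - l) * t%:C = (f (t%:C *: h + y) - f y - l * t%:C) -
     (f (t%:C *: h + y) - f y - 'd f y h * t%:C) by ring.
  by apply: le_trans (cnormB _ _) _; apply: lerD.
rewrite cnormM nt in h3.
have e2 : e / 2 / nrm h * (t * nrm h) = e / 2 * t by field; rewrite gt_eqF.
rewrite e2 in h3.
rewrite ler_pdivlMr // in te.
rewrite -(ler_pM2r t0); apply: le_trans h3 _.
have h4 : A * t <= e / 2 by have := ler_norm A; nra.
have : A * t ^+ 2 <= e / 2 * t by rewrite expr2 mulrA ler_wpM2r ?(ltW t0).
lra.
Qed.

(** Cauchy's estimates for the differential and the second order remainder,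
    obtained on each complex line. *)
Lemma taylor2_ball f y rho M h : 0 < rho -> ball_hol f y rho M -> nrm h <= rho / 6 ->
  normc ('d f y h) <= 6 * K0 * M / rho * nrm h /\
  normc (f (h + y) - f y - 'd f y h) <= 72 * K0 * M / rho ^+ 2 * nrm h ^+ 2.
Proof.
move=> r0 hf hr.
have M0 := ball_hol_ge0 r0 hf.
have [->|h0] := eqVneq h 0.
  by rewrite linear0 nrm0 add0r !subrr cnorm0 expr0n /= !mulr0.
have nh : 0 < nrm h by rewrite nrm_gt0.
pose g (t : C) := f (t *: h + y).
pose r := rho / (3 * nrm h).
have rp : 0 < r by rewrite divr_gt0 // mulr_gt0.
have inb (t : C) : normc t < 3 * r -> nrm (t *: h + y - y) < rho.
  rewrite addrK nrmZ => ht; have -> : rho = 3 * r * nrm h by rewrite /r; field; rewrite gt_eqF.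
  by rewrite ltr_pM2r.
have gh : hol_on g 0 (3 * r).
  by move=> t; rewrite subr0 => /inb/hf[df _]; exact: cdiff_line.
have gM t : normc t < 3 * r -> normc (g t) <= M by move=> /inb/hf[].
have [l [lM lt]] := taylor2 rp gh gM.
have y0 : nrm (y - y) < rho by rewrite subrr nrm0.
have df : differentiable f y := (hf y y0).1.
have g0 : g 0 = f y by rewrite /g scale0r add0r.
have dl : 'd f y h = l.
  have r2 : 0 < r / 2 by rewrite divr_gt0.
  apply: (@diff_dir f y h l (r / 2) (8 * K0 * M / r ^+ 2) df r2).
  by move=> t ht; have := lt t ht; rewrite g0.
rewrite dl; split.
  apply: le_trans lM _; rewrite /r le_eqVlt; apply/orP; left; apply/eqP.
  by field; rewrite !gt_eqF.
have := lt 1; rewrite cnorm1 g0 /g scale1r mulr1 => h1.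
have r2 : 1 <= r / 2.
  by rewrite /r -mulrA -invfM ler_pdivlMr ?mulr_gt0 //; lra.
apply: le_trans (h1 r2) _; rewrite /r le_eqVlt; apply/orP; left; apply/eqP.
by field; rewrite !gt_eqF.
Qed.

Lemma lip_ball f y rho M h : 0 < rho -> ball_hol f y rho M -> nrm h <= rho / 6 ->
  normc (f (h + y) - f y) <= 18 * K0 * M / rho * nrm h.
Proof.
move=> r0 hf hr; have [h1 h2] := taylor2_ball r0 hf hr.
rewrite -(subrK ('d f y h) (f (h + y) - f y)).
apply: le_trans (cnormD _ _) _.
have M0 := ball_hol_ge0 r0 hf.
have K1 : 0 <= K0 * M / rho.
  exact: (divr_ge0 (mulr_ge0 (ltW (K0_gt0 R)) M0) (ltW r0)).
have e : 72 * K0 * M / rho ^+ 2 * nrm h ^+ 2 =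
   (K0 * M / rho * nrm h) * (72 * (nrm h / rho)) by field; rewrite gt_eqF.
have h3 : 72 * (nrm h / rho) <= 12.
  have : nrm h / rho <= 1 / 6 by rewrite ler_pdivrMr //; lra.
  lra.
have n0 := nrm_ge0 h.
have h4 : (K0 * M / rho * nrm h) * (72 * (nrm h / rho)) <= (K0 * M / rho * nrm h) * 12.
  exact: (ler_wpM2l (mulr_ge0 K1 n0) h3).
have e1 : 6 * K0 * M / rho * nrm h = (K0 * M / rho * nrm h) * 6 by ring.
have e2 : 18 * K0 * M / rho * nrm h = (K0 * M / rho * nrm h) * 18 by ring.
rewrite e in h2; rewrite e1 in h1; rewrite e2; lra.
Qed.

(** A bounded family of holomorphic functions has a holomorphic generalized
    limit: the quadratic remainders are uniformly controlled. *)
Lemma clim_hol (F : nat -> V -> C) y rho M : 0 < rho ->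
  (exists N0, forall N, (N0 <= N)%N -> ball_hol (F N) y rho M) ->
  ball_hol (fun x => clim (fun N => F N x)) y rho M.
Proof.
move=> r0 [N0 hF] w hw; split; last first.
  by apply: clim_le; exists N0 => n /hF h; have [] := h w hw.
pose rho' := rho - nrm (w - y).
have r0' : 0 < rho' by rewrite subr_gt0.
have hF' N : (N0 <= N)%N -> ball_hol (F N) w rho' M.
  move=> /hF; apply: ball_hol_sub; rewrite /rho'; lra.
have M0 := ball_hol_ge0 r0' (hF' N0 (leqnn _)).
have dle N h : (N0 <= N)%N -> normc ('d (F N) w h) <= 6 * K0 * M / rho' * nrm h.
  move=> NN; have [->|h0] := eqVneq h 0; first by rewrite linear0 cnorm0 nrm0 mulr0.
  have nh : 0 < nrm h by rewrite nrm_gt0.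
  pose t : R := rho' / 6 / nrm h.
  have t0 : 0 < t by rewrite !divr_gt0.
  have [] := @taylor2_ball (F N) w rho' M (t%:C *: h) r0' (hF' N NN).
    by rewrite nrmZ cnorm_real gtr0_norm // /t divfK ?gt_eqF.
  have -> : 'd (F N) w (t%:C *: h) = t%:C * 'd (F N) w h by rewrite linearZ.
  rewrite cnormM nrmZ cnorm_real gtr0_norm // mulrCA ler_pM2l //.
have bd h : bdd (fun N => 'd (F N) w h).
  by exists (6 * K0 * M / rho' * nrm h), N0 => N NN; exact: dle.
pose L h := clim (fun N => 'd (F N) w h).
have Llin : linear L.
  move=> k u v; rewrite /L.
  have -> : (fun N => 'd (F N) w (k *: u + v)) = (fun N => k * 'd (F N) w u + 'd (F N) w v).
    by apply/funext => N; rewrite linearP.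
  by rewrite climD ?climZ //; exact: bddZ.
pose LM := GRing.isLinear.Build _ _ _ _ _ Llin.
pose LL : {linear V -> C} := HB.pack L LM.
have r6 : 0 < rho' / 6 by rewrite divr_gt0.
have [] // := @diff_of_quad _ _ (fun x => clim (fun N => F N x)) w LL (6 * K0 * M / rho')
  (72 * K0 * M / rho' ^+ 2) (rho' / 6) _ r6.
  by move=> h; apply: clim_le; exists N0 => N NN; exact: dle.
move=> h hh.
have bF x : nrm (x - w) < rho' -> bdd (fun N => F N x).
  by move=> hx; exists M, N0 => N NN; have [] := hF' N NN x hx.
have b1 : bdd (fun N => F N (h + w)) by apply: bF; rewrite addrK; lra.
have b2 : bdd (fun N => F N w) by apply: bF; rewrite subrr nrm0.
have -> : clim (fun N => F N (h + w)) - clim (fun N => F N w) - LL h =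
  clim (fun N => F N (h + w) + ((-1) * F N w + (-1) * 'd (F N) w h)).
  rewrite climD ?climD ?climZ //; try exact: bddZ; last by apply: bddD; exact: bddZ.
  by rewrite !mulN1r addrA.
apply: clim_le; exists N0 => N NN.
have -> : F N (h + w) + ((-1) * F N w + (-1) * 'd (F N) w h) =
   F N (h + w) - F N w - 'd (F N) w h by ring.
by have [] := taylor2_ball r0' (hF' N NN) (ltW hh).
Qed.

End Holomorphic.

(** * Derivatives and orders of vanishing *)

Section Derivatives.
Variables (R : realType) (V : normedModType (CC R)).
Local Notation C := (CC R).
Local Notation K0 := (K0 R).
Implicit Types (f g u : V -> C) (x y h v : V) (M rho : R).

Lemma diff_ball_le f y rho M h : 0 < rho -> ball_hol f y rho M ->
  normc ('d f y h) <= 6 * K0 * M / rho * nrm h.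
Proof.
move=> r0 hf; have [->|h0] := eqVneq h 0; first by rewrite linear0 cnorm0 nrm0 mulr0.
have nh : 0 < nrm h by rewrite nrm_gt0.
pose t : R := rho / 6 / nrm h.
have t0 : 0 < t by rewrite !divr_gt0.
have [] := @taylor2_ball _ _ f y rho M (t%:C *: h) r0 hf.
  by rewrite nrmZ cnorm_real gtr0_norm // /t divfK ?gt_eqF.
have -> : 'd f y (t%:C *: h) = t%:C * 'd f y h by rewrite linearZ.
by rewrite cnormM nrmZ cnorm_real gtr0_norm // mulrCA ler_pM2l.
Qed.

(** The difference quotients are bounded by Cauchy's estimates, and their
    generalized limit is holomorphic. *)
Lemma derive_hol f y rho M v : 0 < rho -> ball_hol f y rho M ->
  ball_hol ('D_v f) y (rho / 2) (36 * K0 * M / rho * nrm v).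
Proof.
move=> r0 hf.
have M0 := ball_hol_ge0 r0 hf.
have r2 : 0 < rho / 2 by rewrite divr_gt0.
pose F N x : C := (mesh R N)^-1%:C * (f ((mesh R N)%:C *: v + x) - f x).
have hx x : nrm (x - y) < rho / 2 -> ball_hol f x (rho / 2) M.
  by move=> hxy; apply: ball_hol_sub hf; lra.
have v0 := nrm_ge0 v.
have m0 : 0 < rho / 12 / (nrm v + 1) by rewrite !divr_gt0 //; lra.
have [N0 hN] := mesh_small m0.
have hmv N : (N0 <= N)%N -> nrm ((mesh R N)%:C *: v) <= rho / 2 / 6.
  move=> /hN h; rewrite nrmZ cnorm_real gtr0_norm ?mesh_gt0 //.
  rewrite ler_pdivlMr in h; last by lra.
  have := mesh_gt0 R N; nra.
have nv N : nrm ((mesh R N)%:C *: v) = mesh R N * nrm v.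
  by rewrite nrmZ cnorm_real gtr0_norm ?mesh_gt0.
have hF : exists N0, forall N, (N0 <= N)%N ->
    ball_hol (F N) y (rho / 2) (36 * K0 * M / rho * nrm v).
  exists N0 => N NN x hxy; split.
    have d1 : differentiable f x by have [] := hx x hxy x; rewrite ?subrr ?nrm0.
    have d2 : differentiable f ((mesh R N)%:C *: v + x).
      have [] // := hx x hxy ((mesh R N)%:C *: v + x).
      rewrite addrK; have := hmv N NN; lra.
    rewrite /F; apply: (@differentiableZ _ _ _ (fun x => f ((mesh R N)%:C *: v + x) - f x)).
    by apply: differentiableB => //; exact: differentiable_comp.
  have := lip_ball r2 (hx x hxy) (hmv N NN); rewrite nv => h.
  rewrite /F cnormM cnorm_real ger0_norm ?invr_ge0 ?(ltW (mesh_gt0 R N)) //.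
  rewrite ler_pdivrMl ?mesh_gt0 //; apply: le_trans h _.
  by rewrite le_eqVlt; apply/orP; left; apply/eqP; field; rewrite gt_eqF.
have DF x : nrm (x - y) < rho / 2 -> 'D_v f x = clim (fun N => F N x).
  move=> hxy.
  have dfx : differentiable f x by have [] := hx x hxy x; rewrite ?subrr ?nrm0.
  rewrite deriveE // -[LHS]clim_cst; symmetry; apply: clim_eq.
    by exists (normc ('d f x v)); exists 0%N.
  move=> e e0.
  pose A := 72 * K0 * M / (rho / 2) ^+ 2 * nrm v ^+ 2.
  have A0 : 0 <= A.
    have K00 : 0 <= 72 * K0 by rewrite mulr_ge0 // ltW // K0_gt0.
    exact: (mulr_ge0 (divr_ge0 (mulr_ge0 K00 M0) (sqr_ge0 _)) (sqr_ge0 _)).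
  have A1 : 0 < A + 1 by lra.
  have [N1 h1] := mesh_small (divr_gt0 e0 A1).
  exists (maxn N0 N1) => N; rewrite geq_max => /andP[NN /h1 hm].
  have [_] := taylor2_ball r2 (hx x hxy) (hmv N NN).
  have -> : 'd f x ((mesh R N)%:C *: v) = (mesh R N)%:C * 'd f x v by rewrite linearZ.
  have mp := mesh_gt0 R N.
  have m0C : (mesh R N)%:C != 0 :> C by rewrite rc_eq0 gt_eqF.
  rewrite nv => h2.
  have -> : F N x - 'd f x v = (mesh R N)^-1%:C *
      (f ((mesh R N)%:C *: v + x) - f x - (mesh R N)%:C * 'd f x v).
    by rewrite /F rcV; field.
  rewrite cnormM cnorm_real ger0_norm ?invr_ge0 ?(ltW mp) //.
  rewrite ler_pdivrMl //; apply: le_trans h2 _.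
  rewrite ler_pdivlMr // in hm.
  have -> : 72 * K0 * M / (rho / 2) ^+ 2 * (mesh R N * nrm v) ^+ 2 = A * mesh R N * mesh R N.
    by rewrite /A; ring.
  nra.
move=> x hxy.
have [d1 d2] := clim_hol r2 hF hxy; split; last by rewrite DF.
have [] // := @diff_near _ _ (fun x => clim (fun N => F N x)) ('D_v f) x _ d1.
apply/nearP; exists (rho / 2 - nrm (x - y)); split; first by rewrite subr_gt0.
move=> z hz; rewrite DF //; rewrite -(subrKA x).
apply: le_lt_trans (nrmD _ _) _; lra.
Qed.

Definition hol0 f := exists rho M, 0 < rho /\ ball_hol f 0 rho M.
Definition eq0 f g := exists rho, 0 < rho /\ forall x, nrm x < rho -> f x = g x.
(** Order of vanishing at 0 through growth: it passes to derivatives by Cauchy's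
    estimates on balls whose radius is proportional to the distance to 0. *)
Definition vanish f n := exists rho M K, [/\ 0 < rho, ball_hol f 0 rho M &
  forall x, nrm x < rho -> normc (f x) <= K * nrm x ^+ n].

Lemma hol0_derive f v : hol0 f -> hol0 ('D_v f).
Proof.
move=> [rho [M [r0 hf]]].
exists (rho / 2), (36 * K0 * M / rho * nrm v); split; first by rewrite divr_gt0.
exact: derive_hol.
Qed.

Lemma hol0_diff f : hol0 f -> exists rho, 0 < rho /\ forall x, nrm x < rho -> differentiable f x.
Proof.
by move=> [rho [M [r0 hf]]]; exists rho; split => // x hx; have [] := hf x; rewrite ?subr0.
Qed.

Lemma eq0_derive u f g v : hol0 f -> hol0 g -> eq0 u (fun x => f x - g x) ->
  eq0 ('D_v u) (fun x => 'D_v f x - 'D_v g x).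
Proof.
move=> /hol0_diff[r1 [r10 hf]] /hol0_diff[r2 [r20 hg]] [r3 [r30 hu]].
exists (Num.min r1 (Num.min r2 r3)); split; first by rewrite !lt_min r10 r20.
move=> x; rewrite !lt_min => /and3P[x1 x2 x3].
have df := hf x x1; have dg := hg x x2.
have dB : differentiable (f - g) x by exact: differentiableB.
have near : \forall y \near x, (f - g) y = u y.
  apply/nearP; exists (r3 - nrm x); split; first by rewrite subr_gt0.
  move=> y hy; rewrite hu // -(subrK x y).
  by apply: le_lt_trans (nrmD _ _) _; lra.
have [du e] := diff_near near dB.
rewrite (deriveE v du) e (deriveE v df) (deriveE v dg).
have := congr1 (fun F : V -> C => F v) (diffB df dg); exact.
Qed.

Lemma vanish_derive f n v : vanish f n.+1 -> vanish ('D_v f) n.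
Proof.
move=> [rho [M [K [r0 hf hK]]]].
have v0 := nrm_ge0 v.
have K00 : 0 <= K0 by rewrite ltW // K0_gt0.
have K'0 : 0 <= `|K| by [].
have hK' x : nrm x < rho -> normc (f x) <= `|K| * nrm x ^+ n.+1.
  move=> hx; apply: le_trans (hK x hx) _.
  by rewrite ler_wpM2r ?exprn_ge0 ?nrm_ge0 // ler_norm.
have r4 : 0 < Num.min 1 (rho / 4) by rewrite lt_min ltr01 divr_gt0.
pose K2 := 6 * K0 * (`|K| * 2 ^+ n.+1) * nrm v.
exists (Num.min 1 (rho / 4)), (36 * K0 * M / rho * nrm v), K2.
split => //.
  move=> w hw; apply: (derive_hol v r0 hf).
  by move: hw; rewrite lt_min => /andP[_]; lra.
move=> x; rewrite lt_min => /andP[x1 x2].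
have dfx : differentiable f x.
  by have [] // := hf x; rewrite subr0; have := nrm_ge0 x; lra.
rewrite (deriveE v dfx).
have p2 : 0 <= (2 : R) ^+ n.+1 by exact: exprn_ge0.
have k6 : 0 <= 6 * K0 by lra.
have K20 : 0 <= K2 by exact: (mulr_ge0 (mulr_ge0 k6 (mulr_ge0 K'0 p2)) v0).
(* Cauchy's estimate on the ball of radius [t] about [x] *)
have est t : 0 < t -> nrm x <= t -> t <= rho / 4 -> normc ('d f x v) <= K2 * t ^+ n.
  move=> t0 xt tr.
  have hb : ball_hol f x t (`|K| * (2 * t) ^+ n.+1).
    move=> w hw; have wr : nrm w < 2 * t.
      rewrite -(subrK x w); apply: le_lt_trans (nrmD _ _) _; lra.
    split; first by have [] // := hf w; rewrite subr0; lra.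
    apply: le_trans (hK' w _) _; first by lra.
    by rewrite ler_wpM2l // ler_pXn2r ?nnegrE ?nrm_ge0 //; lra.
  apply: le_trans (diff_ball_le v t0 hb) _.
  by rewrite /K2 le_eqVlt; apply/orP; left; apply/eqP; rewrite !exprMn exprS [t ^+ n.+1]exprS; field; rewrite gt_eqF.
have [x0|x0] := eqVneq x 0; last by apply: est; rewrite ?nrm_gt0 //; lra.
case: n @K2 hK hK' p2 K20 est => [|n] K2 hK hK' p2 K20 est.
  by have := est (rho / 4); rewrite !expr0; apply; rewrite ?x0 ?nrm0 ?divr_gt0 //; lra.
have -> : nrm x ^+ n.+1 = 0 by rewrite x0 nrm0 expr0n.
rewrite mulr0; apply/ler_addgt0Pl => e e0; rewrite addr0.
have K21 : 0 < K2 + 1 by lra.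
pose t := Num.min (Num.min 1 (rho / 4)) (e / (K2 + 1)).
have t0 : 0 < t by rewrite lt_min r4 divr_gt0.
have t1 : t <= 1 by rewrite /t !ge_min lexx.
have t2 : t <= rho / 4 by rewrite /t !ge_min lexx orbT.
have t3 : t <= e / (K2 + 1) by rewrite /t ge_min lexx orbT.
apply: le_trans (est t t0 _ t2) _; first by rewrite x0 nrm0 ltW.
rewrite ler_pdivlMr // in t3.
have t4 : t ^+ n.+1 <= t.
  by rewrite exprS ler_piMr ?(ltW t0) // exprn_ile1 // ltW.
apply: le_trans (ler_wpM2l K20 t4) _; lra.
Qed.

Lemma vanish0 f n : vanish f n.+1 -> f 0 = 0.
Proof.
move=> [rho [M [K [r0 _ h]]]]; have := h 0; rewrite nrm0 expr0n /= mulr0 => /(_ r0) h0.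
by apply/eqP; rewrite -cnorm_eq0 eq_le h0 cnorm_ge0.
Qed.

End Derivatives.

(** * Formal power series *)

Section TaylorSeries.
Variables (R : realType) (d : nat).
Local Notation C := (CC R).
Local Notation V := 'rV[C]_d.
Implicit Types (f g u : V -> C).

Lemma polydiscE (r : R) (x : V) : 0 < r -> polydisc r x <-> nrm x < r.
Proof.
move=> r0.
have e : ball (0 : V) r%:C x <-> nrm x < r.
  by rewrite -ball_normE /ball_ /= sub0r normrN nrmE ltcR.
rewrite -e; split=> [h|[_ h] j].
  split=> [|i j]; first by rewrite ltcR.
  by rewrite -ball_normE /ball_ /= mxE sub0r normrN (ord1 i) nrmE ltcR; exact: h.
have := h 0 j; rewrite -ball_normE /ball_ /= mxE sub0r normrN nrmE ltcR; exact.
Qed.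

Lemma hol0_iter f (v : V) n : hol0 f -> hol0 (iter n (fun h x => 'D_v h x) f).
Proof. by move=> hf; elim: n => //= n IH; exact: hol0_derive. Qed.

Lemma eq0_iter u f g (v : V) n : hol0 f -> hol0 g -> eq0 u (fun x => f x - g x) ->
  eq0 (iter n (fun h x => 'D_v h x) u)
   (fun x => iter n (fun h x => 'D_v h x) f x - iter n (fun h x => 'D_v h x) g x).
Proof.
move=> hf hg hu; elim: n => //= n IH.
exact: (eq0_derive v (hol0_iter v n hf) (hol0_iter v n hg) IH).
Qed.

Lemma vanish_iter f (v : V) n k : vanish f (n + k) -> vanish (iter n (fun h x => 'D_v h x) f) k.
Proof.
by elim: n k => //= n IH k; rewrite addSnnS => /IH /(@vanish_derive _ _ _ _ v).
Qed.

Lemma partial_derive_sub f g al : hol0 f -> hol0 g ->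
  eq0 (partial_derive al (fun x => f x - g x))
      (fun x => partial_derive al f x - partial_derive al g x).
Proof.
rewrite /partial_derive => hf hg.
have H s h : hol0 h -> hol0 (foldr (fun (j : 'I_d) g =>
    iter (al j) (fun h x => 'D_(delta_mx 0 j) h x) g) h s).
  by move=> hh; elim: s => //= j s IH; exact: hol0_iter.
elim: (enum 'I_d) => [|j s IH] /=; first by exists 1.
exact: (eq0_iter _ _ (H s f hf) (H s g hg) IH).
Qed.

Lemma partial_derive_vanish f (al : {ffun 'I_d -> nat}) k : vanish f (\sum_(j < d) al j + k) ->
  vanish (partial_derive al f) k.
Proof.
have -> : (\sum_(j < d) al j = \sum_(j <- enum 'I_d) al j)%N by rewrite big_enum.
rewrite /partial_derive.
elim: (enum 'I_d) k => [|j s IH] k /=; first by rewrite big_nil.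
by rewrite big_cons -addnA addnCA => /IH /vanish_iter.
Qed.

(** Each derivative lowers the order of vanishing by one. *)
Lemma taylor_eq f g (al : {ffun 'I_d -> nat}) n : hol0 f -> hol0 g ->
  vanish (fun x => f x - g x) n -> (\sum_(j < d) al j < n)%N -> taylor f al = taylor g al.
Proof.
move=> hf hg hv ln; rewrite /taylor; congr (_ / _); apply/eqP; rewrite -subr_eq0.
have [rho [r0 h]] := partial_derive_sub al hf hg.
rewrite -h ?nrm0 //; apply/eqP.
apply: (@vanish0 _ _ _ (n - (\sum_(j < d) al j).+1)); apply: partial_derive_vanish.
by rewrite -addSnnS subnKC.
Qed.

Definition degree (al : {ffun 'I_d -> nat}) := (\sum_(j < d) al j)%N.

Definition unit_index (i : 'I_d) : {ffun 'I_d -> nat} := [ffun j => (j == i) : nat].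
Definition fps_var (i : 'I_d) : fps R d := fun be => (be == unit_index i)%:R.

Lemma fps_mul_var i (g : fps R d) (al : {ffun 'I_d -> nat}) : fps_mul (fps_var i) g al =
  if (0 < al i)%N then g [ffun j => (al j - (j == i))%N] else 0.
Proof.
rewrite /fps_mul; case: ifPn => [ali|]; last first.
  rewrite -eqn0Ngt => /eqP ali; apply: big1 => be _.
  rewrite /fps_var; case: eqP => [/ffunP/(_ i)|]; last by rewrite mul0r.
  rewrite !ffunE eqxx /= => e; have := ltn_ord (be i); rewrite {2}ali => h.
  by move: h; rewrite e.
pose be0 : {dffun forall j : 'I_d, 'I_(al j).+1} := [ffun j => inord (j == i)].
have be0E j : (be0 j : nat) = (j == i).
  rewrite ffunE inordK //; case: eqP => [->|] //.
rewrite (bigD1 be0) //= big1 ?addr0; last first.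
  move=> be bne; rewrite /fps_var; case: eqP => [/ffunP e|]; last by rewrite mul0r.
  case/eqP: bne; apply/ffunP => j; apply: val_inj => /=.
  by have := e j; rewrite !ffunE => ->; rewrite inordK //; case: eqP => [->|].
rewrite /fps_var (_ : [ffun j => be0 j : nat] = unit_index i); last first.
  by apply/ffunP => j; rewrite [LHS]ffunE be0E ffunE.
rewrite eqxx mul1r; congr g; apply/ffunP => j; rewrite !ffunE.
by rewrite inordK //; case: eqP => [->|].
Qed.

Lemma madic_of_order (N : nat) (g : fps R d) :
  (forall al, (degree al < N)%N -> g al = 0) -> fps_max_ideal_pow N g.
Proof.
elim: N g => [//|N IH] g g0.
(* each monomial is divided by its first variable *)
pose first (i : 'I_d) (al : {ffun 'I_d -> nat}) :=
  (0 < al i)%N && [forall j : 'I_d, (j < i)%N ==> (al j == 0%N)].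
pose up (i : 'I_d) (be : {ffun 'I_d -> nat}) : {ffun 'I_d -> nat} := [ffun j => (be j + (j == i))%N].
pose h (i : 'I_d) : fps R d := fun be => if first i (up i be) then g (up i be) else 0.
exists d, fps_var, h; split.
  move=> i; split.
    rewrite /fps_max_ideal /fps_var /=; case: eqP => // /ffunP/(_ i).
    by rewrite !ffunE eqxx.
  apply: IH => be hbe; rewrite /h; case: ifP => // _; apply: g0.
  rewrite /degree (eq_bigr (fun j => be j + (j == i))%N); last by move=> j _; rewrite ffunE.
  rewrite big_split /= -/(degree be) (bigD1 i) //= eqxx big1 ?addn0 ?addn1 //.
  by move=> j /negbTE ->.
apply/funext => al.
have -> : (\sum_(i < d) fps_mul (fps_var i) (h i)) al =
   \sum_(i < d) fps_mul (fps_var i) (h i) al by elim/big_rec2: _ => // i y1 y2 _ <-.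
have e i : fps_mul (fps_var i) (h i) al = if first i al then g al else 0.
  rewrite fps_mul_var; case: ifPn => [ali|ali]; last by rewrite /first (negbTE ali).
  have upE : up i [ffun j => (al j - (j == i))%N] = al.
    apply/ffunP => j; rewrite !ffunE subnK //; by case: eqP => [->|].
  by rewrite /h upE.
rewrite (eq_bigr (fun i => if first i al then g al else 0)); last by move=> i _; exact: e.
have [i0 [ai0|noi]] : exists i0 : option 'I_d, (exists2 i, i0 = Some i & first i al) \/ (forall i, al i = 0%N).
  case: (pickP (fun i : 'I_d => (0 < al i)%N)) => [i1 hi1|none]; last first.
    by exists None; right => i; have := none i; rewrite lt0n => /negbFE/eqP.
  case: (@arg_minnP _ i1 (fun i => (0 < al i)%N) (fun i : 'I_d => i : nat) hi1) => i hi hmin.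
  exists (Some i); left; exists i => //; rewrite /first hi; apply/forallP => j; apply/implyP => ji.
  by rewrite -leqn0 leqNgt; apply/negP => /hmin; rewrite leqNgt ji.
- have [i _ hi] := ai0; rewrite (bigD1 i) //= hi big1 ?addr0 // => j ji.
  case: ifP => // hj; exfalso; move: hi hj => /andP[ai /forallP fi] /andP[aj /forallP fj].
  case: (ltngtP i j) => [lt|lt|eq].
  + by have := fj i; rewrite lt /= => /eqP z; move: ai; rewrite z.
  + by have := fi j; rewrite lt /= => /eqP z; move: aj; rewrite z.
  + by move/eqP: ji; apply; apply: val_inj.
rewrite big1 => [|i _]; last by rewrite /first noi.
by apply: g0; rewrite /degree big1.
Qed.

(** The coefficients of total degree less than [n] are stationary from rank [n] on. *)
Lemma madic_limit (fn : nat -> V -> C) : (forall n, hol0 (fn n)) ->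
  (forall n, vanish (fun x => fn n.+1 x - fn n x) n) ->
  exists fhat, madic_cvg (fun n => taylor (fn n)) fhat.
Proof.
move=> hf hv; exists (fun al => taylor (fn (degree al).+1) al) => N.
exists N => n Nn; apply: madic_of_order => al hal.
have -> : (taylor (fn n) - (fun al => taylor (fn (degree al).+1) al)) al =
  taylor (fn n) al - taylor (fn (degree al).+1) al by [].
apply/eqP; rewrite subr_eq0; apply/eqP.
have ln : ((degree al).+1 <= n)%N by apply: leq_trans Nn.
rewrite -(subnKC ln); elim: (n - _)%N => [|p IH]; first by rewrite addn0.
rewrite addnS -IH; apply: (taylor_eq (hf _) (hf _) (hv _)).
by rewrite -/(degree al) ltn_addr.
Qed.

End TaylorSeries.

(** * Exponential flatness and the Gamma function *)

Section GammaBounds.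
Variable R : realType.
Local Notation mu := (@lebesgue_measure R).
Implicit Types (a t y s : R).

(** Half of the exponential absorbs the power; the other half is integrable. *)
Lemma powR_expR_le a : 0 <= a -> exists K : R, 0 < K /\
  forall t, 0 < t -> t `^ a * expR (- t) <= K * expR (- (t / 2)).
Proof.
move=> a0.
have [k hk] : exists k : nat, a <= k.+1%:R.
  exists (Num.bound a); apply: le_trans (ltW (archi_boundP a0)) _.
  by rewrite ler_nat.
pose b : R := 2 * k.+1%:R.
have b0 : 0 < b by rewrite mulr_gt0.
exists (1 + b ^+ k.+1); split; first by rewrite ltr_pwDl // exprn_ge0 // ltW.
move=> t t0.
have ta : t `^ a <= 1 + t ^+ k.+1.
  have [t1|t1] := leP t 1.
    apply: (@le_trans _ _ 1); last by rewrite lerDl exprn_ge0 // ltW.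
    have e : 1 = 1 `^ a :> R by rewrite powR1.
    by rewrite [leRHS]e ge0_ler_powR // ?nnegrE // ltW.
  apply: (@le_trans _ _ (t `^ k.+1%:R)).
    by rewrite ler_powR // ltW.
  by rewrite powR_mulrn ?(ltW t0) // lerDr.
have e1 : (1 + t / b) ^+ k.+1 <= expR (t / 2).
  have -> : expR (t / 2) = expR (t / b) ^+ k.+1.
    by rewrite -expRM_natl; congr expR; rewrite /b; field; rewrite addrC natr1 pnatr_eq0.
  rewrite ler_pXn2r ?nnegrE ?expR_ge0 //; first exact: expR_ge1Dx.
  by rewrite addr_ge0 // divr_ge0 // ltW.
have tb : 0 <= t / b by rewrite divr_ge0 // ltW.
have e2 : t ^+ k.+1 <= b ^+ k.+1 * expR (t / 2).
  apply: (@le_trans _ _ (b ^+ k.+1 * (t / b) ^+ k.+1)).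
    by rewrite -exprMn mulrCA divff ?mulr1 // gt_eqF.
  rewrite ler_wpM2l ?exprn_ge0 ?(ltW b0) //; apply: le_trans e1.
  by rewrite ler_pXn2r ?nnegrE ?addr_ge0 // lerDr.
have e3 : 1 <= expR (t / 2) by rewrite -expR0 ler_expR divr_ge0 // ltW.
have -> : expR (- t) = expR (- (t / 2)) * expR (- (t / 2)).
  by rewrite -expRD; congr expR; field.
rewrite mulrA ler_wpM2r ?expR_ge0 // expRN ler_pdivrMr ?expR_gt0 //.
apply: le_trans ta _; rewrite mulrDl mul1r; exact: lerD.
Qed.

Lemma gamma_integrable a : 0 <= a ->
  mu.-integrable `]0, +oo[ (EFin \o (fun t => t `^ a * expR (- t))).
Proof.
move=> a0; have [K [K0 hK]] := powR_expR_le a0.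
have mD : measurable (`]0%R, +oo[%classic : set (measurableTypeR R)) by [].
have h2 : 0 < 2^-1 :> R by rewrite invr_gt0.
apply: (@le_integrable _ _ _ mu _ mD _ (fun t => (2 * K)%:E * (exponential_pdf 2^-1 t)%:E)%E).
- apply/measurable_EFinP; apply: measurable_funTS; apply: measurable_funM.
    exact: measurable_powR.
  apply: measurableT_comp => //; exact: measurable_expR.
- move=> t; rewrite /= in_itv /= andbT => t0.
  rewrite exponential_pdfE ?(ltW t0) // lee_fin.
  rewrite ger0_norm ?mulr_ge0 ?powR_ge0 ?expR_ge0 //.
  rewrite ger0_norm ?mulr_ge0 ?expR_ge0 // ?(ltW K0) //.
  apply: le_trans (hK t t0) _.
  have -> : - 2^-1 * t = - (t / 2) by field.
  by rewrite le_eqVlt; apply/orP; left; apply/eqP; field.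
have gi : mu.-integrable `]0%R, +oo[%classic (EFin \o exponential_pdf (2^-1 : R)).
  apply: (@integrableS _ _ _ mu setT) => //.
  exact: integrable_exponential_pdf.
exact: (integrableZl mD (2 * K) gi).
Qed.

(** On the interval [y, y + 1] the integrand of [Gamma (a + 1)] is at least
    [y ^ a * exp (- y - 1)]. *)
Lemma gamma_lower a y : 0 <= a -> 0 < y -> y `^ a * expR (- y) <= expR 1 * Gamma (a + 1).
Proof.
move=> a0 y0; rewrite /Gamma addrK.
have gi := gamma_integrable a0.
set f := (fun t => _) in gi.
have sub : `[y, y + 1]%classic `<=` `]0, +oo[%classic.
  by move=> t; rewrite /= !in_itv /= andbT => /andP[h _]; apply: lt_le_trans h.
have mD : measurable (`]0%R, +oo[%classic : set (measurableTypeR R)) by [].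
have mI : measurable (`[y, y + 1]%classic : set (measurableTypeR R)) by [].
have gI : mu.-integrable `[y, y + 1] (EFin \o f) := integrableS mD mI sub gi.
have h1 : \int[mu]_(t in `[y, y + 1]) f t <= \int[mu]_(t in `]0, +oo[) f t.
  apply: fine_le; [exact: integrable_fin_num|exact: integrable_fin_num|].
  apply: ge0_subset_integral => //; first by case/integrableP : gi.
  by move=> t _; rewrite lee_fin /f mulr_ge0 ?powR_ge0 ?expR_ge0.
pose c := y `^ a * expR (- (y + 1)).
have muI : mu `[y, y + 1]%classic = 1%:E.
  by rewrite lebesgue_measure_itv /= lte_fin ltrDl ltr01 -EFinB addrAC subrr add0r.
have ci : mu.-integrable `[y, y + 1] (EFin \o (fun=> c)).
  apply/integrableP; split; first exact: measurable_cst.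
  rewrite integral_cst //. rewrite [X in (_ * X)%E](_ : _ = 1%:E) ?mule1 ?ltry //; exact: muI.
have h2 : c <= \int[mu]_(t in `[y, y + 1]) f t.
  have -> : c = \int[mu]_(t in `[y, y + 1]) c.
    rewrite Rintegral_cst // (_ : fine _ = 1) ?mulr1 //.
    exact: (congr1 fine muI).
  apply: le_Rintegral => // t; rewrite /= in_itv /= => /andP[t1 t2].
  rewrite /c /f; apply: ler_pM; rewrite ?powR_ge0 ?expR_ge0 //.
    by apply: ge0_ler_powR; rewrite ?nnegrE //; lra.
  by rewrite ler_expR lerN2.
have -> : y `^ a * expR (- y) = expR 1 * c.
  by rewrite /c mulrCA -expRD; congr (_ * expR _); ring.
by rewrite ler_wpM2l ?expR_ge0 //; exact: le_trans h1.
Qed.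

(** One half of the exponential gives the [n]-th power of [e] with the Gamma
    factor, the other half six more powers, which the division by [P ^+ 2] and
    the pole of Cauchy's kernel will use up. *)
Lemma gevrey_flat s gam : 0 < s -> 0 < gam -> exists K A : R, [/\ 0 < K, 0 < A &
  forall n e, 0 < e -> expR (- (gam / e `^ s^-1)) <=
     K * A ^+ n * Gamma (s * n%:R + 1) * e ^+ (n + 6)].
Proof.
move=> s0 g0.
have flat n e : 0 < e -> expR (- (gam / 2 / e `^ s^-1)) <=
    expR 1 * (((gam / 2) `^ s)^-1) ^+ n * Gamma (s * n%:R + 1) * e ^+ n.
  move=> e0; set y := gam / 2 / e `^ s^-1.
  have ep : 0 < e `^ s^-1 by rewrite powR_gt0.
  have g2 : 0 < gam / 2 by rewrite divr_gt0.
  have y0 : 0 < y by rewrite divr_gt0.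
  have sn : 0 <= s * n%:R by rewrite mulr_ge0 // ltW.
  have := gamma_lower sn y0.
  have gs : 0 < (gam / 2) `^ s by rewrite powR_gt0.
  have -> : y `^ (s * n%:R) = ((gam / 2) `^ s) ^+ n * (e ^+ n)^-1.
    rewrite powRrM powR_mulrn ?powR_ge0 // /y powRM ?invr_ge0 ?(ltW g2) ?(ltW ep) //.
    have -> : ((e `^ s^-1)^-1) `^ s = e^-1.
      by rewrite -powRN -powRrM mulNr mulVf ?gt_eqF // powR_inv1 // ltW.
    by rewrite exprMn exprVn.
  have en : 0 < e ^+ n by rewrite exprn_gt0.
  have gn : 0 < ((gam / 2) `^ s) ^+ n by rewrite exprn_gt0.
  rewrite exprVn; set G := Gamma _; set X := _ ^+ n in gn *; set E := e ^+ n in en *.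
  move=> h; rewrite -(ler_pM2l (mulr_gt0 gn (_ : 0 < E^-1))) ?invr_gt0 //.
  apply: le_trans h _; rewrite le_eqVlt; apply/orP; left; apply/eqP.
  by field; rewrite !gt_eqF.
pose A := ((gam / 2) `^ s)^-1.
have A0 : 0 < A by rewrite invr_gt0 powR_gt0 // divr_gt0.
pose K := (expR 1 * A ^+ 6 * Gamma (s * 6%:R + 1)) * expR 1.
have Gpos n : 0 < Gamma (s * n%:R + 1).
  have sn : 0 <= s * n%:R by rewrite mulr_ge0 // ltW.
  have := gamma_lower sn ltr01; rewrite powR1 mul1r => h.
  by rewrite -(pmulr_rgt0 _ (expR_gt0 1)); apply: lt_le_trans h; exact: expR_gt0.
exists K, A; split => //.
  by rewrite /K !mulr_gt0 ?expR_gt0 ?exprn_gt0.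
move=> n e e0.
have -> : expR (- (gam / e `^ s^-1)) =
   expR (- (gam / 2 / e `^ s^-1)) * expR (- (gam / 2 / e `^ s^-1)).
  by rewrite -expRD; congr expR; field; rewrite gt_eqF // powR_gt0.
apply: le_trans (ler_pM (expR_ge0 _) (expR_ge0 _) (flat n e e0) (flat 6%N e e0)) _.
rewrite le_eqVlt; apply/orP; left; apply/eqP; rewrite /K /A exprD; ring.
Qed.

Lemma Gamma_lower_cst s n : 0 < s -> expR (- 2) <= Gamma (s * n%:R + 1).
Proof.
move=> s0; have sn : 0 <= s * n%:R by rewrite mulr_ge0 // ltW.
have := gamma_lower sn ltr01; rewrite powR1 mul1r => h.
rewrite -(ler_pM2l (expR_gt0 1)) -expRD.
by have -> : 1 + - 2 = - 1 :> R by ring.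
Qed.

End GammaBounds.

(** * Holomorphic dependence on parameters *)

Section ParametricSums.
Variables (R : realType) (W : normedModType (CC R)).
Local Notation C := (CC R).

(** Each sum is a finite linear combination of functions holomorphic in the
    parameter, and all of them obey the same bound. *)
Lemma gsum_hol (k : C -> C) (L : R) (c : C) (rho : R) (q : W -> C -> C) (y0 : W) (r Q : R) :
  0 < rho -> 0 <= Q -> 0 < r -> lip k L -> supp_in k c rho ->
  (exists eta, 0 < eta /\ forall z,
     (ball_hol (fun y => q y z) y0 r Q) \/ (forall w, normc (w - z) < eta -> k w = k z)) ->
  ball_hol (fun y => clim (gsum k (q y))) y0 r (18 * L * Q * rho ^+ 2).
Proof.
move=> r0 Q0 rr kL kc [eta [eta0 hq]].
apply: (@clim_hol _ _ (fun N y => gsum k (q y) N)) => //.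
have m0 : 0 < Num.min (eta / 2) (rho / 3) by rewrite lt_min !divr_gt0.
have [N0 hN] := mesh_small m0; exists N0 => N /hN; rewrite le_min => /andP[h1 h2].
have h0 := mesh_gt0 R N.
have dbar0 z : (forall w, normc (w - z) < eta -> k w = k z) -> dbar k (mesh R N) z = 0.
  move=> hk; rewrite /dbar !hk ?subrr ?mulr0 ?addr0 //.
    rewrite addrC addKr cnorm_vstep ?(ltW h0) //; lra.
  rewrite addrC addKr cnorm_hstep ?(ltW h0) //; lra.
have L0 := lip_ge0 kL.
move=> y hy; split.
  have dz z : differentiable (fun y => dbar k (mesh R N) z * q y z) y.
    case: (hq z) => [hb|/dbar0 ->].
      by apply: differentiableM; [exact: differentiable_cst|have [] := hb y hy].
    have -> : (fun y => 0 * q y z) = cst 0 by apply/funext => u; rewrite mul0r.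
    exact: differentiable_cst.
  rewrite /gsum /rect.
  have dsum (n : nat) (f : 'I_n -> W -> C) : (forall i, differentiable (f i) y) ->
      differentiable (fun y => \sum_i f i y) y.
    move=> hf; have -> : (fun y => \sum_i f i y) = \sum_i f i.
      by apply/funext => u; rewrite fct_sumE.
    exact: differentiable_sum.
  apply: differentiableM; first exact: differentiable_cst.
  by apply: (dsum _ _) => i; apply: (dsum _ _) => j; exact: dz.
apply: le_trans (gsum_le (ltW r0) Q0 kL kc (N:=N) _) _.
  move=> z d0; case: (hq z) => [hb|/dbar0 e]; last by rewrite e eqxx in d0.
  by have [] := hb y hy.
have -> : 18 * L * Q * rho ^+ 2 = 2 * L * Q * (3 * rho) ^+ 2 by ring.
by apply: ler_wpM2l; [rewrite !mulr_ge0|rewrite ler_pXn2r ?nnegrE //; lra].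
Qed.

End ParametricSums.

Section LipBall.
Variables (R : realType) (V : normedModType (CC R)).
Local Notation C := (CC R).

Definition lip_const (M r : R) := (18 * K0 R + 12) * M / (r / 2).

Lemma lip_ball_global (f : V -> C) (r M : R) (x y : V) : 0 < r -> ball_hol f 0 r M ->
  nrm x < r / 2 -> nrm y < r / 2 ->
  normc (f x - f y) <= lip_const M r * nrm (x - y).
Proof.
move=> r0 hf hx hy; have M0 := ball_hol_ge0 r0 hf.
have r2 : 0 < r / 2 by rewrite divr_gt0.
have K00 : 0 <= K0 R by rewrite ltW // K0_gt0.
have hb : ball_hol f y (r / 2) M.
  by apply: ball_hol_sub hf; rewrite subr0; lra.
have MR : 0 <= M / (r / 2) by rewrite divr_ge0 // ltW.
have n0 := nrm_ge0 (x - y).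
rewrite /lip_const (_ : _ / _ = (18 * K0 R + 12) * (M / (r / 2))); last by rewrite mulrA.
set m := M / (r / 2) in MR *.
have K0m : 0 <= K0 R * m by exact: mulr_ge0.
have mn : 0 <= m * nrm (x - y) by exact: mulr_ge0.
have Kmn : 0 <= K0 R * m * nrm (x - y) by exact: mulr_ge0.
have [h|h] := leP (nrm (x - y)) (r / 2 / 6).
  have := lip_ball r2 hb h; rewrite subrK => h1; apply: le_trans h1 _.
  rewrite (_ : 18 * K0 R * M / (r / 2) = 18 * (K0 R * m)); last by rewrite /m !mulrA.
  lra.
have fx : normc (f x) <= M by have [|_] := hf x; rewrite ?subr0 //; lra.
have fy : normc (f y) <= M by have [|_] := hf y; rewrite ?subr0 //; lra.
apply: (@le_trans _ _ (2 * M)); first by apply: le_trans (cnormB _ _) _; lra.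
have -> : 2 * M = 12 * (m * (r / 2 / 6)) by rewrite /m; field; rewrite gt_eqF.
have := ler_wpM2l MR (ltW h); lra.
Qed.

Lemma lip_mul_bump (k : C -> C) (L : R) : 0 <= L ->
  (forall z, normc (k z) <= 1) ->
  (forall z w, normc z < 2 -> normc w < 2 -> normc (k z - k w) <= L * normc (z - w)) ->
  lip (fun z => k z * bump 0 1 z) (L + 1).
Proof.
move=> L0 k1 kL z w; pose b := bump (0 : C) 1.
have bL := @bump_lip _ (0 : C) 1 ltr01; rewrite -/b in bL *.
have b1 u : normc (b u) <= 1 by exact: bump_le1.
have bz u : 2 <= normc u -> b u = 0 by move=> hu; apply: bump0; rewrite // subr0; lra.
have n0 := cnorm_ge0 (z - w).
have Lz : 0 <= L * normc (z - w) by rewrite mulr_ge0.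
have half u u' : b u' = 0 -> normc (k u * b u) <= normc (u - u').
  move=> bu; rewrite cnormM; apply: (@le_trans _ _ (1 * normc (b u))).
    by rewrite ler_wpM2r ?cnorm_ge0.
  by rewrite mul1r; have := bL u u'; rewrite bu subr0 invr1 mul1r.
have [hz|hz] := ltP (normc z) 2; last first.
  rewrite bz // mulr0 sub0r cnormN; apply: le_trans (half w z (bz _ hz)) _.
  by rewrite cdistC mulrDl mul1r lerDr.
have [hw|hw] := ltP (normc w) 2; last first.
  rewrite (bz w) // mulr0 subr0; apply: le_trans (half z w (bz _ hw)) _.
  by rewrite mulrDl mul1r lerDr.
have -> : k z * b z - k w * b w = (k z - k w) * b z + k w * (b z - b w) by ring.
apply: le_trans (cnormD _ _) _; rewrite !cnormM mulrDl; apply: lerD.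
  apply: (@le_trans _ _ (L * normc (z - w) * 1)); last by rewrite mulr1.
  by apply: ler_pM; rewrite ?cnorm_ge0 //; exact: kL.
apply: ler_pM; rewrite ?cnorm_ge0 //.
by have := bL z w; rewrite invr1 mul1r.
Qed.

End LipBall.

(** * Lifting functions along the fibres of P *)

Section Lift.
Variables (R : realType) (V : normedModType (CC R)).
Local Notation C := (CC R).
Implicit Types (x y : V) (t z c w : C).
Variables (P : V -> C) (v : V) (r1 M r0 T del : R).
Hypotheses (r10 : 0 < r1) (T0 : 0 < T) (T1 : T <= 1)
  (del0 : 0 < del) (del1 : del <= 1).
Hypothesis hP : ball_hol P 0 r1 M.
Hypothesis in_ball : forall x (z : C), nrm x < r0 -> normc z < 4 -> nrm (z *: v + x) < r1 / 2.
Hypothesis ring_low : forall x (z : C), nrm x < r0 -> 1 / 16 <= normc z -> normc z < 4 ->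
  4 * T <= normc (P (z *: v + x)).

Definition param_slope := lip_const M r1.
Local Notation LP := param_slope.
Definition line_slope := LP * nrm v + 1.
Local Notation Lv := line_slope.

Lemma LP_ge0 : 0 <= LP.
Proof.
have M0 := ball_hol_ge0 r10 hP.
rewrite /LP /lip_const divr_ge0 ?divr_ge0 ?(ltW r10) //.
by rewrite mulr_ge0 // addr_ge0 // mulr_ge0 // ltW // K0_gt0.
Qed.

Lemma Lv_gt0 : 0 < Lv.
Proof.
have h := mulr_ge0 LP_ge0 (nrm_ge0 v).
by rewrite /line_slope; lra.
Qed.

Definition line_val (x : V) (z : C) := P (z *: v + x).
Local Notation p := line_val.

Lemma line_lip x z w : nrm x < r0 -> normc z < 4 -> normc w < 4 ->
  normc (p x z - p x w) <= Lv * normc (z - w).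
Proof.
move=> hx hz hw; apply: le_trans (lip_ball_global r10 hP (in_ball hx hz) (in_ball hx hw)) _.
have -> : z *: v + x - (w *: v + x) = (z - w) *: v.
  by rewrite opprD addrACA subrr addr0 scalerBl.
rewrite nrmZ -/LP /Lv mulrCA mulrC mulrDl mul1r lerDl; exact: cnorm_ge0.
Qed.

Lemma param_lip x x' z : nrm x < r0 -> nrm x' < r0 -> normc z < 4 ->
  normc (p x z - p x' z) <= LP * nrm (x - x').
Proof.
move=> hx hx' hz; apply: le_trans (lip_ball_global r10 hP (in_ball hx hz) (in_ball hx' hz)) _.
by rewrite opprD addrACA subrr add0r.
Qed.

(** The cutoff function of the fibre over [t]: 1 near the zeros of [p x - t] in
    the disc and 0 away from them, with a transition zone where
    [p x - t] is comparable to [t]. *)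
Definition kap (t : C) (x : V) (z : C) : C :=
  bump t (del * normc t / 8) (p x z) * bump 0 1 z.

Definition kernel (g : V -> C) (x : V) (t z : C) : C :=
  g (z *: v + x) * (p x z - P x) / (z * (p x z - t)).

(** The value at [(x, t)] of a function [F (x, t)], holomorphic in both
    variables, with [F (x, P x) = g x]: it sums, over the zeros [z] of
    [P (z v + x) - t], residues of Cauchy's kernel with [1 / z] multiplied by
    [(P (z v + x) - P x) / (P (z v + x) - t)], which is 1 for [t = P x]. *)
Definition lift (g : V -> C) (x : V) (t : C) : C := cint (kap t x) (kernel g x t).

Definition opening (t : C) := del * normc t.
Local Notation a := opening.

(** Points of a cone around which the whole disc used by the lift stays in the
    cone. *)
Definition tame (S : C -> Prop) t :=
  [/\ 0 < normc t, normc t <= T & forall w, normc (w - t) < del * normc t -> S w].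

(** The ring [1 / 16 <= |z| < 4], on which [P] is not small, keeps the fibres
    over small [t] away from the edge of the disc. *)
Lemma kap_small x t z : nrm x < r0 -> normc t <= T -> normc z < 4 ->
  normc (p x z - t) <= a t / 2 -> normc z < 1 / 16.
Proof.
move=> hx ht hz h; rewrite ltNge; apply/negP => h16.
have h1 := ring_low hx h16 hz; rewrite -/(p x z) in h1.
have h2 := cnorm_sub (p x z) t.
have h3 : a t <= normc t by rewrite /a ler_piMl ?cnorm_ge0.
have := T0; lra.
Qed.

Lemma kap_eq1 x t c : nrm x < r0 -> 0 < normc t -> normc t <= T -> normc c < 4 ->
  normc (p x c - t) < a t / 8 ->
  exists d, 0 < d /\ forall w, normc (w - c) < d -> kap t x w = 1.
Proof.
move=> hx t0 tT hc h.
have at0 : 0 < a t by rewrite mulr_gt0.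
have c16 : normc c < 1 / 16 by apply: (kap_small hx tT hc); lra.
have e0 : 0 < (a t / 8 - normc (p x c - t)) / Lv by apply: divr_gt0 Lv_gt0; rewrite subr_gt0.
exists (Num.min (1 / 2) ((a t / 8 - normc (p x c - t)) / Lv)).
split; first by rewrite lt_min e0 andbT; lra.
move=> w; rewrite lt_min (ltr_pdivlMr _ _ Lv_gt0) => /andP[w1 w2].
have w3 : normc w < 1 by have := cnorm_sub w c; lra.
have w4 : normc w < 4 by lra.
have b1 : bump t (del * normc t / 8) (p x w) = 1.
  apply: bump1; first by rewrite divr_gt0.
  rewrite -/(a t); have := cdist_triangle (p x c) (p x w) t.
  have := line_lip hx w4 hc; lra.
have b2 : bump 0 1 w = 1 by apply: bump1 => //; rewrite subr0 ltW.
by rewrite /kap b1 b2 mulr1.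
Qed.

Lemma kap_eq0 x t c : nrm x < r0 -> 0 < normc t -> normc t <= T ->
  (normc c < 4 -> a t / 4 < normc (p x c - t)) -> zero_near (kap t x) c.
Proof.
move=> hx t0 tT h.
have at0 : 0 < a t by rewrite mulr_gt0.
have [hc|hc] := ltP (normc c) 4; last first.
  exists 1; split => // w hw; rewrite /kap (@bump0 _ 0 1) ?mulr0 // subr0.
  by have := cdist_triangle w c 0; rewrite !subr0 (cdistC c w); lra.
have {}h := h hc.
have e0 : 0 < (normc (p x c - t) - a t / 4) / Lv by apply: divr_gt0 Lv_gt0; rewrite subr_gt0.
have e1 : 0 < 4 - normc c by rewrite subr_gt0.
exists (Num.min (4 - normc c) ((normc (p x c - t) - a t / 4) / Lv)).
split; first by rewrite lt_min e1 e0.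
move=> w; rewrite lt_min (ltr_pdivlMr _ _ Lv_gt0) => /andP[w1 w2].
have w4 : normc w < 4 by have := cdist_triangle c w 0; rewrite !subr0; lra.
rewrite /kap (@bump0 _ t) ?mul0r //; first by rewrite divr_gt0.
rewrite -/(a t); have := cdist_triangle (p x w) (p x c) t.
have := line_lip hx hc w4; rewrite (cdistC c w); lra.
Qed.

Lemma kap_lip x t : nrm x < r0 -> 0 < normc t ->
  lip (kap t x) (Lv * (8 / a t) + 1).
Proof.
move=> hx t0; have at0 : 0 < a t by rewrite mulr_gt0.
have a8 : 0 < a t / 8 by rewrite divr_gt0.
apply: lip_mul_bump.
- by rewrite mulr_ge0 ?(ltW Lv_gt0) // divr_ge0 // ltW.
- by move=> z; exact: bump_le1.
have bl := @bump_lip _ t _ a8.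
move=> z w hz hw; apply: le_trans (bl (p x z) (p x w)) _.
have -> : Lv * (8 / a t) * normc (z - w) = (a t / 8)^-1 * (Lv * normc (z - w)).
  by field; rewrite gt_eqF.
by apply: ler_wpM2l; [rewrite invr_ge0 ltW|apply: line_lip => //; lra].
Qed.

Lemma kap_supp x t : supp_in (kap t x) 0 2.
Proof.
move=> z; rewrite /kap mulf_eq0 negb_or => /andP[_ h].
by have := bump_supp ltr01 h; lra.
Qed.

(** The three zones of the line for the cutoff function: two where it is locally
    constant, and one where [p x0 - t0] is bounded below. They are stable under
    small changes of [x0] and [t0]. *)
Lemma kap_zones x0 t0 : nrm x0 < r0 -> 0 < normc t0 -> normc t0 <= T ->
  exists eta, 0 < eta /\ forall z,
   (normc z < 1 / 16 /\ a t0 / 16 <= normc (p x0 z - t0) <= 3 / 8 * a t0) \/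
   (forall w, normc (w - z) < eta -> kap t0 x0 w = kap t0 x0 z).
Proof.
move=> hx t00 t0T.
have at0 : 0 < a t0 by rewrite mulr_gt0.
pose eta := Num.min (1 / 16) (a t0 / 64 / Lv).
have eta0 : 0 < eta.
  by rewrite lt_min divr_gt0 //=; apply: divr_gt0 Lv_gt0; rewrite divr_gt0.
exists eta; split => // z.
have etaL w : normc (w - z) < eta -> normc (w - z) < 1 / 16 /\ Lv * normc (w - z) < a t0 / 64.
  by rewrite lt_min (ltr_pdivlMr _ _ Lv_gt0) => /andP[-> h]; rewrite mulrC.
have [hz|hz] := leP 3 (normc z).
  right => w /etaL[hw _].
  have b0 u : 2 <= normc u -> kap t0 x0 u = 0.
    by move=> hu; rewrite /kap (@bump0 _ 0 1) ?mulr0 // subr0; lra.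
  rewrite !b0 //; first by lra.
  by have := cdist_triangle w z 0; rewrite !subr0 (cdistC z w); lra.
have hz4 : normc z < 4 by lra.
have plip w : normc (w - z) < eta -> normc w < 4 /\ normc (p x0 w - p x0 z) < a t0 / 64.
  move=> /etaL[hw h]; have w4 : normc w < 4 by have := cnorm_sub w z; lra.
  by split => //; apply: le_lt_trans (line_lip hx w4 hz4) h.
have [h1|h1] := ltP (normc (p x0 z - t0)) (a t0 / 16).
  have z16 : normc z < 1 / 16 by apply: (kap_small hx t0T hz4); lra.
  have k1 w : normc (w - z) < eta -> kap t0 x0 w = 1.
    move=> hw; have [_ h2] := plip w hw; have [h3 _] := etaL w hw.
    rewrite /kap !bump1 ?mulr1 ?subr0 //; first by have := cnorm_sub w z; lra.
      by rewrite divr_gt0.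
    by rewrite -/(a t0); have := cdist_triangle (p x0 z) (p x0 w) t0; lra.
  by right => w hw; rewrite !k1 ?subrr ?cnorm0.
have [h2|h2] := ltP (3 / 8 * a t0) (normc (p x0 z - t0)).
  have k0 w : normc (w - z) < eta -> kap t0 x0 w = 0.
    move=> hw; have [_ h3] := plip w hw.
    rewrite /kap (@bump0 _ t0) ?mul0r //; first by rewrite divr_gt0.
    rewrite -/(a t0); have := cdist_triangle (p x0 w) (p x0 z) t0.
    by rewrite (cdistC (p x0 z) (p x0 w)); lra.
  by right => w hw; rewrite !k0 ?subrr ?cnorm0.
left; split; last by apply/andP; split; lra.
by apply: (kap_small hx t0T hz4); lra.
Qed.

(** The parameters near [(x0, t0)] for which the cutoff function may be replaced
    by the one at [(x0, t0)]. *)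
Definition close x0 t0 x t := LP * nrm (x - x0) + normc (t - t0) <= a t0 / 64.

Lemma close_est x0 t0 x t z : nrm x0 < r0 -> nrm x < r0 -> normc z < 4 -> close x0 t0 x t ->
  normc ((p x z - t) - (p x0 z - t0)) <= a t0 / 64 /\ normc (p x z - p x0 z) <= a t0 / 64.
Proof.
move=> hx0 hx hz hc; have := param_lip hx hx0 hz; rewrite /close in hc.
have n1 := nrm_ge0 (x - x0); have n2 := cnorm_ge0 (t - t0).
move=> h; split; last by lra.
have -> : p x z - t - (p x0 z - t0) = (p x z - p x0 z) - (t - t0) by ring.
by apply: le_trans (cnormB _ _) _; lra.
Qed.

Lemma close_T x0 t0 x t : close x0 t0 x t ->
  63 / 64 * a t0 <= a t /\ normc t <= normc t0 + a t0 / 64.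
Proof.
rewrite /close => hc; have n1 : 0 <= LP * nrm (x - x0) by apply: mulr_ge0 LP_ge0 _; exact: nrm_ge0.
have h1 := cnorm_sub t0 t; have h2 := cnorm_sub t t0; rewrite (cdistC t0) in h1.
split; last by lra.
have n3 := cnorm_ge0 t0.
have [d0 d1] := (del0, del1).
have : a t0 <= normc t0 by rewrite /a ler_piMl.
rewrite /a in hc *.
have n4 := cnorm_ge0 (t - t0).
have : del * (normc t0 - normc t) <= 1 * normc (t - t0).
  apply: le_trans (_ : del * normc (t - t0) <= _).
    by rewrite ler_pM2l //; lra.
  by rewrite ler_wpM2r.
lra.
Qed.

Section WithFunction.
Variables (S : C -> Prop) (g : V -> C).
Hypothesis hg : forall y, nrm y < r1 / 2 -> S (P y) -> differentiable g y.

Lemma diff_P y : nrm y < r1 / 2 -> differentiable P y.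
Proof. by move=> hy; have h := r10; have [] // := hP (w := y); rewrite subr0; lra. Qed.

Lemma cdiff_p x c : nrm x < r0 -> normc c < 4 -> cdiff (p x) c.
Proof. by move=> hx hc; apply: cdiff_line; apply: diff_P; exact: in_ball. Qed.

Lemma cdiff_kernel x t c : nrm x < r0 -> normc c < 4 -> c != 0 -> p x c != t ->
  S (p x c) -> cdiff (kernel g x t) c.
Proof.
move=> hx hc c0 pc Sc; have dp := cdiff_p hx hc.
apply: cdiffM; first apply: cdiffM.
- by apply: cdiff_line; apply: hg => //; exact: in_ball.
- exact: (cdiffB dp (cdiff_cst _ _)).
apply: cdiffV; last by rewrite mulf_neq0 // subr_eq0.
exact: (cdiffM (cdiff_id _) (cdiffB dp (cdiff_cst _ _))).
Qed.

Lemma quotient_le x z : nrm x < r0 -> normc z < 4 ->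
  normc (p x z - P x) <= Lv * normc z.
Proof.
move=> hx hz; have o4 : normc (0 : C) < 4 by rewrite cnorm0.
by have := line_lip hx hz o4; rewrite subr0 {2}/p scale0r add0r.
Qed.

Lemma kernel_le x t z (Qg lo : R) : nrm x < r0 -> normc z < 4 -> 0 <= Qg -> 0 < lo ->
  normc (g (z *: v + x)) <= Qg -> lo <= normc (p x z - t) ->
  normc (kernel g x t z) <= Qg * Lv / lo.
Proof.
move=> hx hz Q0 lo0 gQ hlo.
have L0 : 0 <= Lv by exact: (ltW Lv_gt0).
have B0 : 0 <= Qg * Lv / lo by apply: divr_ge0 (mulr_ge0 Q0 L0) (ltW lo0).
rewrite /kernel; have [->|z0] := eqVneq z 0.
  by rewrite mul0r invr0 mulr0 cnorm0.
rewrite !cnormM cnormV cnormM -mulrA -[leRHS]mulrA.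
apply: ler_pM; rewrite ?cnorm_ge0 //.
  by apply: mulr_ge0; rewrite ?invr_ge0 ?mulr_ge0 ?cnorm_ge0.
have nz : 0 < normc z by rewrite cnorm_gt0.
have nl : 0 < normc (p x z - t) by apply: lt_le_trans hlo.
rewrite ler_pdivrMr ?mulr_gt0 //.
apply: le_trans (quotient_le hx hz) _.
have -> : Lv / lo * (normc z * normc (p x z - t)) = Lv * normc z * (normc (p x z - t) / lo) by ring.
rewrite ler_peMr //; first by apply: mulr_ge0 L0 (cnorm_ge0 _).
by rewrite ler_pdivlMr // mul1r.
Qed.

Lemma kernel_bounded_near0 x t : nrm x < r0 -> p x 0 != t -> S (p x 0) ->
  bounded_near (kernel g x t) 0.
Proof.
move=> hx pt Sp.
have o4 : normc (0 : C) < 4 by rewrite cnorm0.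
have dg : cdiff (fun z => g (z *: v + x)) 0.
  by apply: cdiff_line; apply: hg => //; exact: in_ball.
have [d1 [d10 h1]] := cdiff_cont dg ltr01.
pose lo := normc (p x 0 - t) / 2.
have lo0 : 0 < lo by rewrite divr_gt0 // cnorm_gt0 subr_eq0.
have [d2 [d20 h2]] := cdiff_cont (cdiff_p hx o4) lo0.
pose Qg := normc (g (0 *: v + x)) + 1.
exists (Num.min 4 (Num.min d1 d2)), (Qg * Lv / lo); split.
  by rewrite !lt_min d10 d20; lra.
move=> z; rewrite subr0 !lt_min => /and3P[z4 z1 z2].
apply: kernel_le => //.
- by rewrite addr_ge0 ?cnorm_ge0.
- by have := h1 z; rewrite subr0 => /(_ z1) => h; have := cnorm_sub (g (z *: v + x)) (g (0 *: v + x)); rewrite /Qg; lra.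
have := h2 z; rewrite subr0 => /(_ z2) => h.
have := cdist_triangle (p x z) (p x 0) t; rewrite (cdistC (p x 0) (p x z)) /lo; rewrite /lo in h; lra.
Qed.

(** The integrand depends holomorphically on the parameters, the cutoff function
    does not; by Green's formula it may be frozen, since the two
    cutoff functions only differ where the integrand has no pole. *)
Lemma lift_frozen x0 t0 x t : nrm x0 < r0 -> nrm x < r0 -> tame S t0 -> normc t <= T -> close x0 t0 x t ->
  nul (fun N => gsum (kap t x) (kernel g x t) N - gsum (kap t0 x0) (kernel g x t) N).
Proof.
move=> hx0 hx [t00 t0T St0] tT hcl.
have at0 : 0 < a t0 by rewrite mulr_gt0.
have [at1 _] := close_T hcl.
have at2 : 0 < a t by apply: lt_le_trans at1; rewrite mulr_gt0 // divr_gt0.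
have tp : 0 < normc t by move: at2; rewrite /a pmulr_rgt0.
have at3 : a t <= 65 / 64 * a t0.
  have := cnorm_sub t t0; move: hcl; rewrite /close => hcl.
  have n1 : 0 <= LP * nrm (x - x0) by apply: mulr_ge0 LP_ge0 _; exact: nrm_ge0.
  have n3 := cnorm_ge0 t0; have [d0 d1] := (del0, del1).
  move=> h; have : del * (normc t - normc t0) <= del * (a t0 / 64) by rewrite ler_pM2l //; lra.
  have : del * (a t0 / 64) <= 1 * (a t0 / 64) by rewrite ler_wpM2r // divr_ge0 // ltW.
  rewrite /a; lra.
apply: (@gsum_eq_near _ _ _ _ _ _ 2 [:: 0] (kap_lip hx tp) (kap_lip hx0 t00)).
- exact: kap_supp.
- exact: kap_supp.
move=> c; have [hc|hc] := ltP (normc c) 4; last first.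
  have zz (y : V) (u : C) : nrm y < r0 -> 0 < normc u -> normc u <= T -> zero_near (kap u y) c.
    by move=> h1 h2 h3; apply: kap_eq0 => //; rewrite ltNge hc.
  have [d1 [d10 h1]] := zz _ _ hx tp tT; have [d2 [d20 h2]] := zz _ _ hx0 t00 t0T.
  constructor 2; exists (Num.min d1 d2); split; first by rewrite lt_min d10 d20.
  by move=> w; rewrite lt_min => /andP[/h1 -> /h2 ->]; rewrite subrr.
have [e1 e2] := close_est hx0 hx hc hcl.
have e3 := cnorm_dist (p x c - t) (p x0 c - t0).
have {e3}/andP[e3 e4] : - (a t0 / 64) <= normc (p x c - t) - normc (p x0 c - t0) <= a t0 / 64.
  by rewrite -ler_norml; exact: le_trans e3 e1.
have [h1|h1] := ltP (normc (p x0 c - t0)) (a t0 / 16).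
  have [|d1 [d10 k1]] := @kap_eq1 x t c hx tp tT hc; first by lra.
  have [|d2 [d20 k2]] := @kap_eq1 x0 t0 c hx0 t00 t0T hc; first by lra.
  constructor 2; exists (Num.min d1 d2); split; first by rewrite lt_min d10 d20.
  by move=> w; rewrite lt_min => /andP[/k1 -> /k2 ->]; rewrite subrr.
have [h2|h2] := ltP (3 / 8 * a t0) (normc (p x0 c - t0)).
  have [|d1 [d10 k1]] := @kap_eq0 x t c hx tp tT; first by lra.
  have [|d2 [d20 k2]] := @kap_eq0 x0 t0 c hx0 t00 t0T; first by lra.
  constructor 2; exists (Num.min d1 d2); split; first by rewrite lt_min d10 d20.
  by move=> w; rewrite lt_min => /andP[/k1 -> /k2 ->]; rewrite subrr.
have pt : p x c != t by rewrite -subr_eq0 -cnorm_gt0; lra.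
have Sc : S (p x c).
  apply: St0; rewrite -/(a t0); have := cdist_triangle (p x0 c) (p x c) t0; lra.
have [c0|c0] := eqVneq c 0; last by constructor 1; exact: cdiff_kernel.
constructor 3; rewrite c0 in pt Sc *; rewrite mem_head; split => //.
exact: kernel_bounded_near0.
Qed.

Definition lift_bound (Qg : R) (t : C) : R :=
  18 * (Lv * (8 / a t) + 1) * (Qg * Lv / (a t / 32)) * 2 ^+ 2.

(** Stated along arbitrary holomorphic families of parameters, so as to give
    holomorphy both in [x] and in [t]. *)
Lemma lift_hol (W : normedModType (CC R)) (X : W -> V) (tau : W -> C) (y0 : W) (r' Qg : R) :
  0 < r' -> 0 <= Qg -> tame S (tau y0) ->
  (forall y, nrm y < r1 / 2 -> normc (P y - tau y0) < a (tau y0) -> normc (g y) <= Qg) ->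
  (forall y : W, nrm (y - y0) < r' -> [/\ differentiable X y, differentiable tau y, nrm (X y) < r0,
     normc (tau y) <= T & close (X y0) (tau y0) (X y) (tau y)]) ->
  ball_hol (fun y : W => c0 R * lift g (X y) (tau y)) y0 r' (lift_bound Qg (tau y0)).
Proof.
move=> r'0 Q0 tm gQ hX.
have [t00 t0T St0] := tm; set t0 := tau y0 in tm gQ hX t00 t0T St0 *; set x0 := X y0 in hX *.
have at0 : 0 < a t0 by rewrite mulr_gt0.
have y00 : nrm (y0 - y0) < r' by rewrite subrr nrm0.
have [_ _ hx0 _ _] := hX y0 y00; rewrite -/x0 in hx0.
have [eta [eta0 zones]] := kap_zones hx0 t00 t0T.
pose F (y : W) := clim (gsum (kap t0 x0) (kernel g (X y) (tau y))).
have Q1 : 0 <= Qg * Lv / (a t0 / 32).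
  apply: divr_ge0; first exact: (mulr_ge0 Q0 (ltW Lv_gt0)).
  by rewrite ltW // divr_gt0.
have pert (y : W) z : nrm (y - y0) < r' -> normc z < 1 / 16 ->
    a t0 / 16 <= normc (p x0 z - t0) <= 3 / 8 * a t0 ->
    [/\ normc z < 4, normc (p (X y) z - t0) < a t0 & a t0 / 32 <= normc (p (X y) z - tau y)].
  move=> hy hz /andP[z1 z2]; have [_ _ hXy _ hcl] := hX y hy.
  have z4 : normc z < 4 by lra.
  have [e1 e2] := close_est hx0 hXy z4 hcl.
  split => //.
    have := cdist_triangle (p x0 z) (p (X y) z) t0; lra.
  have := cnorm_sub (p x0 z - t0) (p (X y) z - tau y); rewrite (cdistC (p x0 z - t0)); lra.
have FH : ball_hol F y0 r' (lift_bound Qg t0).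
  apply: (@gsum_hol _ _ _ _ 0 2 _ _ _ _ _ Q1 r'0 (kap_lip hx0 t00) (@kap_supp x0 t0)) => //.
  exists eta; split => // z; case: (zones z) => [[hz hzr]|h]; last by right.
  left => y hy; have [z4 pa lo] := pert y z hy hz hzr.
  have [dX dtau hXy _ _] := hX y hy.
  have inb := in_ball hXy z4.
  split; last first.
    apply: (kernel_le (lo := a t0 / 32) hXy z4 Q0 _ _ lo); first by rewrite divr_gt0.
    exact: gQ.
  have [->|zn0] := eqVneq z 0.
    have -> : (fun y : W => kernel g (X y) (tau y) 0) = cst 0.
      by apply/funext => u; rewrite /kernel mul0r invr0 mulr0.
    exact: differentiable_cst.
  have dl : differentiable (fun y : W => z *: v + X y) y.
    exact: (differentiableD (differentiable_cst _ _) dX).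
  have dp : differentiable (fun y : W => p (X y) z) y.
    exact: (differentiable_comp (f := fun y : W => z *: v + X y) dl (diff_P inb)).
  have dg : differentiable (fun y : W => g (z *: v + X y)) y.
    apply: (differentiable_comp (f := fun y : W => z *: v + X y) dl (hg inb _)).
    by apply: St0; rewrite -/(a t0).
  have hx2 : nrm (X y) < r1 / 2.
    have o4 : normc (0 : C) < 4 by rewrite cnorm0.
    by have := in_ball hXy o4; rewrite scale0r add0r.
  have dPX : differentiable (fun y : W => P (X y)) y.
    exact: (differentiable_comp (f := X) dX (diff_P hx2)).
  have nz : z * (p (X y) z - tau y) != 0.
    rewrite mulf_neq0 // -cnorm_gt0; apply: lt_le_trans lo.
    by rewrite divr_gt0.
  apply: differentiableM; first exact: (differentiableM dg (differentiableB dp dPX)).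
  apply: (@differentiableV _ _ (fun y : W => z * (p (X y) z - tau y))) => //.
  exact: (differentiableM (differentiable_cst _ _) (differentiableB dp dtau)).
have FE (y : W) : nrm (y - y0) < r' -> c0 R * lift g (X y) (tau y) = F y.
  move=> hy; have [_ _ hXy hT hcl] := hX y hy.
  rewrite /lift /cint (mulrC (c0 R)) (divfK (c0_neq0 R)) /F.
  apply: clim_eq; last exact: (lift_frozen hx0 hXy tm hT hcl).
  exists (lift_bound Qg t0).
  apply: (@gsum_ev _ _ _ _ 0 2) => //; [exact: kap_lip|exact: kap_supp|].
  exists eta; split => // z; case: (zones z) => [[hz hzr]|h]; last by right.
  left; have [z4 pa lo] := pert y z hy hz hzr.
  apply: (kernel_le (lo := a t0 / 32) hXy z4 Q0 _ _ lo); first by rewrite divr_gt0.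
  by apply: gQ => //; exact: in_ball.
move=> y hy; have [d1 d2] := FH y hy; split; last by rewrite FE.
have [] // := @diff_near _ _ F (fun y : W => c0 R * lift g (X y) (tau y)) y _ d1.
apply/nearP; exists (r' - nrm (y - y0)); split; first by rewrite subr_gt0.
move=> u hu; rewrite FE // -(subrKA y).
apply: le_lt_trans (nrmD _ _) _; lra.
Qed.

(** For [t = P x] the kernel is [g (z v + x) / z], whose only pole is 0. *)
Lemma lift_diag x : nrm x < r0 -> tame S (P x) -> lift g x (P x) = g x.
Proof.
move=> hx [t0 tT St]; set t := P x in t0 tT St *.
have at0 : 0 < a t by rewrite mulr_gt0.
have o4 : normc (0 : C) < 4 by rewrite cnorm0.
have p0 : p x 0 = t by rewrite /p scale0r add0r.
have [|d [d0 k1]] := @kap_eq1 x t 0 hx t0 tT o4.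
  by rewrite p0 subrr cnorm0 divr_gt0.
pose f z := g (z *: v + x).
have f0 : f 0 = g x by rewrite /f scale0r add0r.
have df c : normc c < 4 -> S (p x c) -> cdiff f c.
  by move=> hc Sc; apply: cdiff_line; apply: hg => //; exact: in_ball.
have [|b e] := @cint_nul _ (kap t x) (fun z => f z / (z - 0)) (f 0).
  apply: (@cauchy _ _ (Lv * (8 / a t) + 1) 2 f 0 d [::]) => //.
  - exact: kap_lip.
  - exact: kap_supp.
  - move=> c; have [h|h] := pselect (normc c < 4 /\ normc (p x c - t) <= a t / 4); last first.
      constructor 2; apply: kap_eq0 => // hc; rewrite ltNge; apply/negP => h2.
      by apply: h.
    by constructor 1; apply: df; [case: h|apply: St; rewrite -/(a t); case: h; lra].
  apply: df => //; apply: St; rewrite p0 subrr cnorm0; exact: at0.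
rewrite -f0 -e /lift; apply: cint_ev_eq => //.
apply: gsum_cong.
have [eta [eta0 zones]] := kap_zones hx t0 tT.
exists eta; split => // z; case: (zones z) => [[hz /andP[h _]]|h]; last by right.
left; rewrite /kernel -/(f z) -/t subr0.
have pz : p x z - t != 0 by rewrite -cnorm_gt0; apply: lt_le_trans h; rewrite divr_gt0.
have [->|z0] := eqVneq z 0; first by rewrite mul0r invr0 !mulr0.
by field; rewrite z0 pz.
Qed.

Lemma gsum_kernel_bdd x t Qg : nrm x < r0 -> tame S t -> 0 <= Qg ->
  (forall y, nrm y < r1 / 2 -> normc (P y - t) < a t -> normc (g y) <= Qg) ->
  bdd (gsum (kap t x) (kernel g x t)).
Proof.
move=> hx [t0 tT St] Q0 gQ; have at0 : 0 < a t by rewrite mulr_gt0.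
have [eta [eta0 zones]] := kap_zones hx t0 tT.
exists (18 * (Lv * (8 / a t) + 1) * (Qg * Lv / (a t / 16)) * 2 ^+ 2).
apply: (@gsum_ev _ _ _ _ 0 2) => //; [|exact: kap_lip|exact: kap_supp|].
  apply: divr_ge0; first exact: (mulr_ge0 Q0 (ltW Lv_gt0)).
  by rewrite ltW // divr_gt0.
exists eta; split => // z; case: (zones z) => [[hz /andP[h h']]|h]; last by right.
left; have z4 : normc z < 4 by lra.
apply: (kernel_le (lo := a t / 16) hx z4 Q0 _ _ h); first by rewrite divr_gt0.
by apply: gQ; [exact: in_ball|rewrite -/(p x z); lra].
Qed.

End WithFunction.

(** The reason why differences of lifts are as small as the differences of the
    functions. *)
Lemma lift_sub (g1 g2 : V -> C) S1 S2 Q1 Q2 x t : nrm x < r0 -> tame S1 t -> tame S2 t ->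
  0 <= Q1 -> 0 <= Q2 ->
  (forall y, nrm y < r1 / 2 -> normc (P y - t) < a t -> normc (g1 y) <= Q1) ->
  (forall y, nrm y < r1 / 2 -> normc (P y - t) < a t -> normc (g2 y) <= Q2) ->
  lift (fun y => g1 y - g2 y) x t = lift g1 x t - lift g2 x t.
Proof.
move=> hx tm1 tm2 Q10 Q20 h1 h2.
have b1 := gsum_kernel_bdd hx tm1 Q10 h1; have b2 := gsum_kernel_bdd hx tm2 Q20 h2.
rewrite /lift -[X in _ + X]mulN1r -cintZ // -cintD //; last first.
  have := bddZ (-1) b2; congr bdd; apply/funext => N; by rewrite gsumZr.
congr cint; apply/funext => z; rewrite /kernel; ring.
Qed.

End Lift.

(** * The Ramis-Sibuya theorem in one variable *)

Section RamisSibuya.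
Variables (R : realType) (I : finType).
Local Notation C := (CC R).
Variables (chi F : I -> C -> C) (O : I -> C -> Prop) (T0 del Cc B : R).
Hypotheses (T00 : 0 < T0) (T01 : T0 <= 1) (del0 : 0 < del) (del1 : del <= 1)
  (Cc0 : 0 <= Cc) (B0 : 0 <= B).
Hypothesis chi_sum : forall z, z != 0 -> \sum_k chi k z = 1.
Hypothesis chi_le1 : forall k z, normc (chi k z) <= 1.
Hypothesis chi_lip : forall k z w, z != 0 ->
  normc (chi k z - chi k w) <= Cc / normc z * normc (z - w).
Hypothesis chi_O : forall k z w, chi k z != 0 -> normc (w - z) < del * normc z -> O k w.
Hypothesis F_hol : forall k z, O k z -> 0 < normc z < T0 -> cdiff (F k) z.
Hypothesis F_le : forall k z, O k z -> 0 < normc z < T0 -> normc (F k z) <= B.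

(** The functions are glued by weights, not by solving a Cousin problem: the
    glued function is not holomorphic, but integrals against it can be computed
    sector by sector. *)
Definition glue z := \sum_k chi k z * F k z.
Local Notation nI := (#|I|%:R : R).

Definition apart (k : nat) W := forall i j z, O i z -> O j z -> 0 < normc z < T0 ->
  normc (F i z - F j z) <= W * normc z ^+ k.

Lemma chi_OO k z : chi k z != 0 -> 0 < normc z -> O k z.
Proof.
move=> h z0; apply: (chi_O h); rewrite subrr cnorm0; exact: mulr_gt0.
Qed.

Lemma sum_le (f : I -> C) (M : R) : (forall k, normc (f k) <= M) -> normc (\sum_k f k) <= nI * M.
Proof.
move=> h; apply: le_trans (cnorm_sum _ _ _) _.
apply: le_trans (ler_sum _ (fun i _ => h i)) _.
by rewrite sumr_const mulr_natl.
Qed.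

Lemma glue_le z : 0 < normc z < T0 -> normc (glue z) <= nI * B.
Proof.
move=> /andP[z0 zT]; apply: sum_le => k; have [->|h] := eqVneq (chi k z) 0.
  by rewrite mul0r cnorm0.
rewrite cnormM; have f := F_le (chi_OO h z0); rewrite z0 zT in f.
rewrite -[leRHS]mul1r; apply: ler_pM; rewrite ?cnorm_ge0 //; exact: f.
Qed.

Lemma glue_sub j z (om : R) : 0 < normc z -> O j z -> 0 <= om ->
  (forall i k, O i z -> O k z -> normc (F i z - F k z) <= om) ->
  normc (glue z - F j z) <= nI * om.
Proof.
move=> z0 Oj om0 h.
have zn : z != 0 by rewrite -cnorm_gt0.
have -> : glue z - F j z = \sum_k chi k z * (F k z - F j z).
  under eq_bigr do rewrite mulrBr.
  by rewrite sumrB -mulr_suml chi_sum // mul1r.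
apply: sum_le => k; have [->|ck] := eqVneq (chi k z) 0; first by rewrite mul0r cnorm0.
rewrite cnormM -[leRHS]mul1r; apply: ler_pM; rewrite ?cnorm_ge0 //.
by apply: h => //; exact: chi_OO.
Qed.

Lemma lip_chi Psi L e j : lip Psi L -> (forall z, normc (Psi z) <= 4) -> 0 < e ->
  (forall z, Psi z != 0 -> e <= normc z) -> lip (fun z => Psi z * chi j z) (L + 4 * (Cc / e)).
Proof.
move=> hL h4 e0 hs.
have base z w : Psi z != 0 ->
    normc (Psi z * chi j z - Psi w * chi j w) <= (L + 4 * (Cc / e)) * normc (z - w).
  move=> hz; have ez := hs z hz; have zp : 0 < normc z by exact: lt_le_trans ez.
  have -> : Psi z * chi j z - Psi w * chi j w =
    (Psi z - Psi w) * chi j w + Psi z * (chi j z - chi j w) by ring.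
  apply: le_trans (cnormD _ _) _; rewrite !cnormM mulrDl; apply: lerD.
    rewrite -[leRHS]mulr1; apply: ler_pM; rewrite ?cnorm_ge0 //; exact: hL.
  rewrite -mulrA; apply: ler_pM; rewrite ?cnorm_ge0 //.
  have zn : z != 0 by rewrite -cnorm_gt0.
  apply: le_trans (chi_lip j w zn) _; apply: ler_wpM2r; first exact: cnorm_ge0.
  by apply: ler_wpM2l Cc0 _ _ _; rewrite lef_pV2 ?posrE.
move=> z w; have [hz|] := eqVneq (Psi z) 0; last exact: base.
have [hw|hw] := eqVneq (Psi w) 0.
  by have := lip_ge0 hL; rewrite hz hw !mul0r subrr cnorm0 => L0; rewrite mulr_ge0 ?cnorm_ge0 // addr_ge0 // mulr_ge0 // divr_ge0 // ltW.
by rewrite cdistC (cdistC z); exact: base.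
Qed.

Lemma gsum_suml (k : I -> C -> C) q N :
  gsum (fun z => \sum_i k i z) q N = \sum_i gsum (k i) q N.
Proof.
have z0 : gsum (fun=> 0) q N = 0.
  rewrite (_ : (fun=> 0) = (fun z : C => 0 - 0 : C)); last by apply/funext => z; rewrite subrr.
  by rewrite gsumBl subrr.
elim: (index_enum I) => [|i s IH].
  rewrite big_nil -z0; congr (gsum _ q N); apply/funext => z; rewrite big_nil //.
rewrite big_cons -IH -gsumDl; congr (gsum _ q N); apply/funext => z; rewrite big_cons //.
Qed.

Lemma ev_le_sum (s : seq I) (u : I -> nat -> C) (M : R) : (forall i, ev_le (u i) M) ->
  ev_le (fun N => \sum_(i <- s) u i N) ((size s)%:R * M).
Proof.
move=> h; elim: s => [|i s IH].
  by exists 0%N => N _; rewrite big_nil cnorm0 mul0r.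
have := ev_leD (h i) IH; rewrite /= -{1}[M]mul1r -mulrDl -natr1 addrC.
by move=> [N0 hN]; exists N0 => N /hN; rewrite big_cons.
Qed.

Lemma nul_sum (s : seq I) (u : I -> nat -> C) : (forall i, nul (u i)) ->
  nul (fun N => \sum_(i <- s) u i N).
Proof.
move=> h; elim: s => [|i s IH].
  by move=> e e0; exists 0%N => N _; rewrite big_nil cnorm0 ltW.
by apply: nul_ext (nulD (h i) IH) => N; rewrite big_cons.
Qed.

(** Over a shell around 0 the sum sees only the differences of the [F k]: on
    the support of [chi j] the glued function is [F j] up to [nI * om], and
    the holomorphic [F j] contributes nothing. *)
Lemma shell Psi L e q (om Q : R) : 0 < e -> 5 * e <= T0 -> lip Psi L ->
  (forall z, normc (Psi z) <= 4) ->
  (forall z, Psi z != 0 -> e <= normc z <= 4 * e) -> 0 <= om -> 0 <= Q ->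
  (forall z, cdiff q z \/ zero_near Psi z) ->
  (exists eta, 0 < eta /\ forall z w, normc (w - z) < eta -> Psi w != 0 -> normc (q z) <= Q) ->
  (forall i j z, e / 2 < normc z < 5 * e -> O i z -> O j z -> normc (F i z - F j z) <= om) ->
  bdd (gsum Psi (fun z => glue z * q z)) /\
  normc (cint Psi (fun z => glue z * q z)) <=
    4 * K0 R * nI ^+ 2 * (L * e + 4 * Cc) * e * (om * Q).
Proof.
move=> e0 eT hL h4 hs om0 Q0 hq [eta [eta0 qQ]] hF.
have L0 := lip_ge0 hL.
have hs1 z : Psi z != 0 -> e <= normc z by move=> /hs/andP[].
pose k j z := Psi z * chi j z.
have kL j : lip (k j) (L + 4 * (Cc / e)) by exact: (lip_chi j hL h4 e0 hs1).
have ks j : supp_in (k j) 0 (4 * e).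
  by move=> z; rewrite /k mulf_eq0 negb_or subr0 => /andP[/hs/andP[]].
pose et := Num.min eta (del * e / 2).
have dele : del * e <= e by rewrite ler_piMl // ltW.
have et0 : 0 < et by rewrite lt_min eta0 divr_gt0 // mulr_gt0.
have near j z w : normc (w - z) < et -> k j w != 0 ->
    [/\ e / 2 < normc z < 5 * e, O j z & normc (q z) <= Q].
  rewrite lt_min /k mulf_eq0 negb_or => /andP[w1 w2] /andP[Pw cw].
  have /andP[ew e4] := hs w Pw.
  have d1 := cnorm_sub w z; have d2 := cnorm_sub z w; rewrite (cdistC z) in d2.
  split; [apply/andP; split; lra | | exact: qQ w1 Pw].
  apply: (chi_O cw); rewrite cdistC; apply: lt_le_trans w2 _.
  have d0 := del0; have : del * e <= del * normc w by rewrite ler_pM2l.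
  have : 0 < del * e by rewrite mulr_gt0.
  lra.
pose u j N := gsum (k j) (fun z => (glue z - F j z) * q z) N.
have hu j : ev_le (u j) (18 * (L + 4 * (Cc / e)) * (nI * om * Q) * (4 * e) ^+ 2).
  apply: (gsum_ev (c := 0)) (kL j) (ks j) _; first by rewrite mulr_gt0.
    by rewrite !mulr_ge0.
  exists et; split => // z.
  have [[w [w1 w2]]|nw] := pselect (exists w, normc (w - z) < et /\ k j w != 0); last first.
    right => w w1; have kz0 v : normc (v - z) < et -> k j v = 0.
      by move=> hv; apply/eqP/negPn/negP => hk; apply: nw; exists v.
    by rewrite !kz0 // subrr cnorm0.
  left; have [/andP[z1 z2] Oz qz] := near j z w w1 w2.
  rewrite cnormM; apply: ler_pM; rewrite ?cnorm_ge0 //.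
  apply: glue_sub => //; first by lra.
  by move=> i l; apply: hF; rewrite z1 z2.
have dec N : gsum Psi (fun z => glue z * q z) N - \sum_j u j N =
    \sum_j gsum (k j) (fun z => F j z * q z) N.
  have -> : Psi = fun z => \sum_j k j z.
    apply/funext => z; rewrite /k -mulr_sumr; have [->|zn] := eqVneq z 0.
      have [->|/hs1] := eqVneq (Psi 0) 0; first by rewrite mul0r.
      by rewrite cnorm0 => h; exfalso; lra.
    by rewrite chi_sum // mulr1.
  rewrite gsum_suml -sumrB; apply: eq_bigr => j _.
  by rewrite /u -gsumBr; congr gsum; apply/funext => z; ring.
have nz : nul (fun N => gsum Psi (fun z => glue z * q z) N - \sum_j u j N).
  rewrite (funext dec); apply: nul_sum => j; apply: green (kL j) (ks j) _ => z.
  have [[w [w1 w2]]|nw] := pselect (exists w, normc (w - z) < et /\ k j w != 0); last first.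
    right; exists et; split => // v hv.
    by apply/eqP/negPn/negP => hk; apply: nw; exists v.
  have [/andP[z1 z2] Oz qz] := near j z w w1 w2.
  have [dq|[d [d00 pz]]] := hq z; last first.
    by right; exists d; split => // v hv; rewrite /k pz // mul0r.
  left; apply: cdiffM dq; apply: F_hol => //; apply/andP; split; lra.
have hS := ev_le_sum (index_enum I) hu.
have bu : bdd (fun N => \sum_j u j N) by eexists; exact: hS.
split.
  have := bddD bu (nul_bdd nz); congr bdd; apply/funext => N; ring.
rewrite /cint (clim_eq bu nz) cnormM cnormV.
rewrite ler_pdivrMr ?cnorm_gt0 ?c0_neq0 //.
apply: clim_le; apply: ev_le_mono hS.
have -> : (size (index_enum I))%:R = nI by rewrite cardE enumT.
rewrite le_eqVlt; apply/orP; left; apply/eqP; rewrite /K0; field.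
by rewrite cnorm_eq0 c0_neq0 gt_eqF.
Qed.


Definition eps (m : nat) : R := T0 / 4 / 2 ^+ m.

Lemma eps_gt0 m : 0 < eps m.
Proof. by rewrite divr_gt0 ?exprn_gt0 // divr_gt0. Qed.

Lemma epsS m : eps m = 2 * eps m.+1.
Proof. by rewrite /eps exprS; field; rewrite expf_neq0. Qed.

Lemma eps_le m : eps m <= T0 / 4.
Proof.
rewrite /eps ler_pdivrMr ?exprn_gt0 // ler_peMr ?divr_ge0 ?(ltW T00) //.
by rewrite exprn_ege1 // ler1n.
Qed.

(** Integration over a small circle of radius about [eps m]. *)
Definition gcint m (q : C -> C) := cint (bump 0 (eps m)) (fun z => glue z * q z).

Lemma gcint_le m q Q : 0 <= Q -> (forall z, on_ring 0 (eps m) z -> normc (q z) <= Q) ->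
  bdd (gsum (bump 0 (eps m)) (fun z => glue z * q z)) /\
  normc (gcint m q) <= K0 R * eps m * (nI * B * Q).
Proof.
move=> Q0 hq; have Q1 : 0 <= nI * B * Q by rewrite !mulr_ge0.
have e0 := eps_gt0 m; have e4 := eps_le m; have T1 := T00.
have h z : on_ring 0 (eps m) z -> normc (glue z * q z) <= nI * B * Q.
  move=> hz; rewrite cnormM; apply: ler_pM; rewrite ?cnorm_ge0 //; last exact: hq.
  by apply: glue_le; move: hz => /andP[]; rewrite subr0 => h1 h2; apply/andP; split; lra.
split; last exact: cint_ring_le.
by eexists; exact: gsum_ring_ev Q1 h.
Qed.

Definition ringw m z := bump (0 : C) (eps m) z - bump 0 (eps m.+1) z.

Lemma ringw_supp m z : ringw m z != 0 -> eps m.+1 <= normc z <= 4 * eps m.+1.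
Proof.
move=> h; have e := epsS m; have e0 := eps_gt0 m.+1; have e1 := eps_gt0 m.
apply/andP; split; rewrite leNgt; apply/negP => hz; move/negP: h; apply; apply/eqP.
  rewrite /ringw !bump1 ?subrr ?subr0 //; lra.
rewrite /ringw !bump0 ?subrr ?subr0 //; lra.
Qed.

Lemma ringw_lip m : lip (ringw m) (3 / 2 / eps m.+1).
Proof.
have e := epsS m; have e0 := eps_gt0 m.+1; have e1 := eps_gt0 m.
have -> : 3 / 2 / eps m.+1 = (eps m)^-1 + (eps m.+1)^-1 by rewrite e; field; rewrite gt_eqF.
by apply: lipB; exact: bump_lip.
Qed.

Lemma ringw_le m z : normc (ringw m z) <= 2.
Proof.
apply: le_trans (cnormB _ _) _; have h1 := @bump_le1 _ 0 (eps m) z.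
have h2 := @bump_le1 _ 0 (eps m.+1) z; lra.
Qed.

Lemma ringw_zero m : zero_near (ringw m) 0.
Proof. by apply: bump_diff_near; rewrite ?subrr ?cnorm0 ?eps_gt0. Qed.

Lemma front_ge0 : 0 <= 4 * K0 R * nI ^+ 2.
Proof. by rewrite mulr_ge0 ?exprn_ge0 // mulr_ge0 // (ltW (K0_gt0 _)). Qed.

(** Consecutive circles bound a shell, to which [shell] applies. *)
Lemma gcint_step m q (om Q : R) : let e := eps m.+1 in 0 <= om -> 0 <= Q ->
  (forall z, z != 0 -> cdiff q z) ->
  (forall z, e / 2 <= normc z <= 5 * e -> normc (q z) <= Q) ->
  (forall i j z, e / 2 < normc z < 5 * e -> O i z -> O j z -> normc (F i z - F j z) <= om) ->
  normc (gcint m q - gcint m.+1 q) <= 4 * K0 R * nI ^+ 2 * (3 + 4 * Cc) * e * (om * Q).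
Proof.
move=> e om0 Q0 dq qQ hF; have ee := epsS m; rewrite -/e in ee.
have e0 : 0 < e := eps_gt0 m.+1; have e1 := eps_gt0 m; have e4 := eps_le m.
have T1 := T00.
have [|b1 _] := @gcint_le m q Q Q0.
  by move=> z /andP[]; rewrite subr0 => h1 h2; apply: qQ; apply/andP; split; lra.
have [|b2 _] := @gcint_le m.+1 q Q Q0.
  by rewrite -/e => z /andP[]; rewrite subr0 => h1 h2; apply: qQ; apply/andP; split; lra.
have eT : 5 * e <= T0 by lra.
have [|||b3 h] := @shell (ringw m) _ e q om Q e0 eT (ringw_lip m) _ (@ringw_supp m) om0 Q0 _ _ hF.
- by move=> z; have := ringw_le m z; lra.
- move=> z; have [->|zn] := eqVneq z 0; [right; exact: ringw_zero|left; exact: dq].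
- exists (e / 2); split; first by rewrite divr_gt0.
  move=> z w hw /ringw_supp; rewrite -/e => /andP[h1 h2]; apply: qQ.
  have := cnorm_sub w z; have := cnorm_sub z w; rewrite (cdistC z) => h3 h4.
  by apply/andP; split; lra.
have -> : gcint m q - gcint m.+1 q = cint (ringw m) (fun z => glue z * q z).
  rewrite /gcint /cint -mulrBl -[X in (_ + X) / _]mulN1r -climZ // -climD //; last exact: bddZ.
  congr (clim _ / _); apply/funext => N; rewrite /ringw gsumBl mulN1r //.
apply: le_trans h _; apply: ler_wpM2r; first by rewrite mulr_ge0.
apply: ler_wpM2r; first exact: ltW.
apply: ler_wpM2l; first exact: front_ge0.
rewrite -/e divfK ?gt_eqF //; have c0 := Cc0; lra.
Qed.

Definition mono (k : nat) (z : C) : C := (z ^+ k.+1)^-1.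

Lemma mono_le k z e : 0 < e -> e <= normc z -> normc (mono k z) <= e^-1 ^+ k.+1.
Proof.
move=> e0 ez; rewrite /mono cnormV cnormX -exprVn lerXn2r ?nnegrE ?invr_ge0 ?cnorm_ge0 ?(ltW e0) //.
by rewrite lef_pV2 ?posrE //; exact: lt_le_trans ez.
Qed.

Lemma cdiff_mono k z : z != 0 -> cdiff (mono k) z.
Proof. by move=> z0; apply: cdiffV; [exact: (cdiffX _ (cdiff_id _))|rewrite expf_neq0]. Qed.

Definition rate := 4 * K0 R * nI ^+ 2 * (3 + 4 * Cc).

Lemma rate_ge0 : 0 <= rate.
Proof.
by rewrite /rate mulr_ge0 ?front_ge0 // addr_ge0 // mulr_ge0.
Qed.

Lemma mono_step k W m : 0 <= W -> apart k.+1 W ->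
  normc (gcint m (mono k) - gcint m.+1 (mono k)) <= rate * (W * 10 ^+ k.+1) * eps m.+1.
Proof.
move=> W0 hW; have e0 := eps_gt0 m.+1; have T1 := T00.
have e4 := eps_le m; rewrite epsS in e4.
have h5 : 0 <= 5 * eps m.+1 by rewrite mulr_ge0 // ltW.
have he2 : 0 < eps m.+1 / 2 by rewrite divr_gt0.
apply: le_trans (@gcint_step m (mono k) (W * (5 * eps m.+1) ^+ k.+1) ((eps m.+1 / 2)^-1 ^+ k.+1) _ _ _ _ _) _.
- by rewrite mulr_ge0 ?exprn_ge0.
- by rewrite exprn_ge0 // invr_ge0 ltW.
- by move=> z; exact: cdiff_mono.
- by move=> z /andP[h _]; exact: mono_le.
- move=> i j z /andP[z1 z2] Oi Oj; apply: le_trans (hW i j z Oi Oj _) _.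
    by apply/andP; split; lra.
  by apply: ler_wpM2l => //; rewrite lerXn2r ?nnegrE ?cnorm_ge0 ?(ltW z2).
rewrite -/rate -(mulrA W) -exprMn.
have -> : 5 * eps m.+1 * (eps m.+1 / 2)^-1 = 10 by field; rewrite gt_eqF.
by rewrite mulrAC.
Qed.

Lemma tail_le (u : nat -> C) D m p : (forall m, normc (u m - u m.+1) <= D * eps m.+1) ->
  normc (u m - u (m + p)%N) <= D * (eps m - eps (m + p)).
Proof.
move=> h; elim: p => [|p IH]; first by rewrite addn0 !subrr cnorm0 mulr0.
rewrite addnS -(subrKA (u (m + p)%N)); apply: le_trans (cnormD _ _) _.
rewrite (epsS (m + p)) in IH; have := h (m + p)%N; lra.
Qed.

(** The [k]-th Taylor coefficient of the common expansion. The integrals over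
    the circles differ by little, so they stay close to their limit. *)
Definition coef k := clim (fun m => gcint m (mono k)).

Lemma gcint_mono_le k W m : 0 <= W -> apart k.+1 W ->
  normc (gcint m (mono k)) <= rate * (W * 10 ^+ k.+1) + K0 R * nI * B * (16 / T0) ^+ k.+1.
Proof.
move=> W0 hW; have T1 := T00; have T2 := T01.
pose D := rate * (W * 10 ^+ k.+1).
have D0 : 0 <= D by rewrite mulr_ge0 ?rate_ge0 // mulr_ge0 // exprn_ge0.
have h := @tail_le (fun m => gcint m (mono k)) D 0 m (fun m => mono_step m W0 hW).
rewrite add0n in h.
have e0 : eps 0 = T0 / 4 by rewrite /eps expr0 divr1.
have em := eps_gt0 m.
have h1 : normc (gcint m (mono k)) <= normc (gcint 0 (mono k)) + normc (gcint 0 (mono k) - gcint m (mono k)).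
  by rewrite -{1}[gcint m _](subKr (gcint 0 (mono k))); exact: cnormB.
apply: le_trans h1 _; rewrite addrC; apply: lerD.
  by apply: le_trans h _; rewrite -/D ler_piMr //; lra.
have q0 : 0 <= (16 / T0) ^+ k.+1 :> R by rewrite exprn_ge0 // divr_ge0 // ltW.
have [|_ h2] := @gcint_le 0 (mono k) ((16 / T0) ^+ k.+1) q0.
  move=> z /andP[]; rewrite subr0 e0 => z1 z2.
  have -> : 16 / T0 = (T0 / 16)^-1 by rewrite invf_div.
  by apply: mono_le; lra.
have KQ : 0 <= K0 R * nI * B * (16 / T0) ^+ k.+1.
  by apply: mulr_ge0 => //; apply: mulr_ge0 => //; apply: mulr_ge0 => //; exact: (ltW (K0_gt0 R)).
apply: le_trans h2 _.
have -> : K0 R * eps 0 * (nI * B * (16 / T0) ^+ k.+1) = eps 0 * (K0 R * nI * B * (16 / T0) ^+ k.+1) by ring.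
by rewrite ler_piMl // e0; lra.
Qed.

Lemma coef_le k W : 0 <= W -> apart k.+1 W ->
  normc (coef k) <= rate * (W * 10 ^+ k.+1) + K0 R * nI * B * (16 / T0) ^+ k.+1.
Proof. by move=> W0 hW; apply: clim_le; exists 0%N => m _; exact: gcint_mono_le. Qed.


Lemma cintDl (k1 k2 q : C -> C) : bdd (gsum k1 q) -> bdd (gsum k2 q) ->
  bdd (gsum (fun z => k1 z + k2 z) q) /\
  cint (fun z => k1 z + k2 z) q = cint k1 q + cint k2 q.
Proof.
move=> b1 b2; rewrite /cint (funext (gsumDl k1 k2 q)); split; first exact: bddD.
by rewrite climD // mulrDl.
Qed.

Section AtPoint.
Variables (t : C) (k0 : I) (n : nat) (W : R).
Hypotheses (t0 : 0 < normc t) (tT : normc t <= T0 / 8) (ct : chi k0 t != 0)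
  (W0 : 0 <= W) (hW : apart n.+4 W).
Local Notation r := (del * normc t / 8).
Local Notation nt := (normc t).

(** The remainder of the geometric series of Cauchy's kernel. *)
Definition geo N z := (t / z) ^+ N / (z - t).
Definition core z := bump t r z.

Lemma r_gt0 : 0 < r.
Proof. by rewrite divr_gt0 // mulr_gt0. Qed.

Lemma r_le : r <= nt / 8.
Proof. by rewrite ler_wpM2r ?invr_ge0 // ler_piMl // ltW. Qed.

Lemma geo_le N z (lo ga : R) : 0 < lo -> 0 < ga -> lo <= normc z -> ga <= normc (z - t) ->
  normc (geo N z) <= (nt / lo) ^+ N / ga.
Proof.
move=> lo0 ga0 hz hg; rewrite /geo cnormM cnormX cnormM !cnormV.
apply: ler_pM; rewrite ?exprn_ge0 ?invr_ge0 ?mulr_ge0 ?invr_ge0 ?cnorm_ge0 //.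
  rewrite lerXn2r ?nnegrE ?mulr_ge0 ?invr_ge0 ?cnorm_ge0 ?(ltW lo0) //.
  by rewrite ler_wpM2l ?cnorm_ge0 // lef_pV2 ?posrE //; exact: lt_le_trans hz.
by rewrite lef_pV2 ?posrE //; exact: lt_le_trans hg.
Qed.

Lemma cdiff_geo N z : z != 0 -> z != t -> cdiff (geo N) z.
Proof.
move=> z0 zt; apply: cdiffM; last exact: cdiff_invB.
apply: cdiffX; apply: (cdiffM (cdiff_cst _ _)); apply: cdiffV => //; exact: cdiff_id.
Qed.

Lemma core_supp z : core z != 0 -> 3 / 4 * nt <= normc z <= 5 / 4 * nt.
Proof.
move=> /(bump_supp r_gt0) h; have h2 := r_le.
have := cnorm_sub t z; have := cnorm_sub z t; rewrite (cdistC t) => h3 h4.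
by apply/andP; split; lra.
Qed.

Lemma core1_lip : lip (fun z => 1 - core z) r^-1.
Proof.
have -> : r^-1 = 0 + r^-1 by rewrite add0r.
apply: lipB; [exact: lip_cst|exact: bump_lip r_gt0].
Qed.

Definition shellw m z := ringw m z * (1 - core z).

Definition shell_const := 1600 * K0 R * nI ^+ 2 * (3 + 4 * Cc + 16 / del) / del.

Lemma shell_const_ge0 : 0 <= shell_const.
Proof.
rewrite /shell_const; apply: divr_ge0; last exact: ltW.
apply: mulr_ge0.
  apply: mulr_ge0; last exact: exprn_ge0.
  by apply: mulr_ge0 (ler0n _ _) _; exact: ltW (K0_gt0 R).
by rewrite addr_ge0 ?divr_ge0 ?(ltW del0) // addr_ge0 // mulr_ge0.
Qed.

(** Around [t] the kernel has a pole, which [core] cuts out; this costs two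
    powers of [t], hence the exponent [n.+2] of the kernel. *)
Lemma geo_shell m : let q z := glue z * geo n.+2 z in
  bdd (gsum (shellw m) q) /\
  normc (cint (shellw m) q) <= shell_const * 10 ^+ n.+2 * W * nt ^+ n * eps m.+1.
Proof.
move=> q; have e0 := eps_gt0 m.+1; have e4 := eps_le m; have T1 := T00; have T2 := T01.
rewrite epsS in e4; set e := eps m.+1 in e0 e4 *.
have r0 := r_gt0; have d0 := del0; have t0' := t0.
have hL : lip (shellw m) (3 / 2 / e * 2 + 2 * r^-1).
  apply: lipM (ringw_lip m) core1_lip (ringw_le m) _ => z.
  by apply: le_trans (cnormB _ _) _; rewrite cnorm1; have := @bump_le1 _ t r z; rewrite /core; lra.
have h4 z : normc (shellw m z) <= 4.
  rewrite cnormM (_ : 4 = 2 * 2); last by rewrite -natrM.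
  apply: ler_pM; rewrite ?cnorm_ge0 ?ringw_le //.
  by apply: le_trans (cnormB _ _) _; rewrite cnorm1; have := @bump_le1 _ t r z; rewrite /core; lra.
have hs z : shellw m z != 0 -> e <= normc z <= 4 * e.
  by rewrite mulf_eq0 negb_or => /andP[/ringw_supp].
have eT : 5 * e <= T0 by lra.
pose om := W * (5 * e) ^+ n.+4.
pose Q := (nt / (e / 2)) ^+ n.+2 / (r / 2).
have e5 : 0 <= 5 * e by rewrite mulr_ge0 // ltW.
have om0 : 0 <= om by rewrite mulr_ge0 // exprn_ge0.
have Q0 : 0 <= Q.
  rewrite /Q divr_ge0 ?(ltW (divr_gt0 r0 _)) // exprn_ge0 // divr_ge0 ?cnorm_ge0 //.
  by rewrite divr_ge0 // ltW.
have hnear z w : normc (w - z) < Num.min (e / 2) (r / 2) -> shellw m w != 0 ->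
    e / 2 <= normc z /\ r / 2 <= normc (z - t).
  rewrite lt_min => /andP[w1 w2] hw; have /andP[h1 h2] := hs w hw.
  split; first by have := cnorm_sub w z; lra.
  have : r <= normc (w - t).
    rewrite leNgt; apply/negP => hwt; move: hw; rewrite /shellw /core bump1 ?(ltW hwt) //.
    by rewrite subrr mulr0 eqxx.
  by have := cdist_triangle z w t; lra.
have r2 : 0 < r / 2 by exact: divr_gt0.
have et0 : 0 < Num.min (e / 2) (r / 2) by rewrite lt_min r2 divr_gt0.
have [|||b h] := @shell (shellw m) _ e (geo n.+2) om Q e0 eT hL h4 hs om0 Q0.
- move=> z; have [[w [w1 w2]]|nw] := pselect (exists w, normc (w - z) < Num.min (e / 2) (r / 2) /\ shellw m w != 0).
    have [z1 z2] := hnear z w w1 w2; left; apply: cdiff_geo.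
      by rewrite -cnorm_gt0; lra.
    by rewrite -subr_eq0 -cnorm_gt0; lra.
  right; exists (Num.min (e / 2) (r / 2)); split => // v hv.
  by apply/eqP/negPn/negP => hk; apply: nw; exists v.
- exists (Num.min (e / 2) (r / 2)); split => // z w h1 h2; have [z1 z2] := hnear z w h1 h2.
  by apply: geo_le => //; rewrite divr_gt0.
- move=> i j z /andP[z1 z2] Oi Oj; apply: le_trans (hW Oi Oj _) _.
    by apply/andP; split; lra.
  by apply: ler_wpM2l => //; rewrite lerXn2r ?nnegrE ?cnorm_ge0 // ltW.
split => //; apply: le_trans h _.
clearbody e.
have LE : (3 / 2 / e * 2 + 2 * r^-1) * e = 3 + 16 * e / (del * nt).
  by field; rewrite !gt_eqF.
have QE : om * Q = W * 10 ^+ n.+2 * (25 * e ^+ 2) * nt ^+ n * nt * (16 / del).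
  rewrite /om /Q (_ : n.+4 = n.+2 + 2)%N; last by rewrite addn2.
  have -> : nt / (e / 2) = nt * 2 / e by field; rewrite gt_eqF.
  rewrite exprD !exprMn !exprVn (_ : 10 = 5 * 2 :> R); last by rewrite -natrM.
  by rewrite exprMn (exprS nt n.+1) (exprS nt n); field; rewrite !gt_eqF ?exprn_gt0.
rewrite QE LE.
have k0' : 0 <= K0 R := ltW (K0_gt0 R).
have e1 : e <= 1 by lra.
have nt1 : nt <= 1 by have := tT; lra.
have Z : (3 + 16 * e / (del * nt) + 4 * Cc) * nt * e ^+ 2 <= 3 + 4 * Cc + 16 / del.
  have -> : (3 + 16 * e / (del * nt) + 4 * Cc) * nt * e ^+ 2 =
     (3 + 4 * Cc) * (nt * e ^+ 2) + (16 / del) * e ^+ 3 by field; rewrite !gt_eqF.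
  have c0 := Cc0.
  apply: lerD; apply: ler_piMr.
  - by rewrite addr_ge0 // mulr_ge0.
  - by apply: mulr_ile1 => //; [exact: cnorm_ge0|exact: exprn_ge0 (ltW e0)|exact: exprn_ile1 (ltW e0) e1].
  - exact: divr_ge0 (ler0n _ _) (ltW d0).
  - exact: exprn_ile1 (ltW e0) e1.
have -> : 4 * K0 R * nI ^+ 2 * (3 + 16 * e / (del * nt) + 4 * Cc) * e *
   (W * 10 ^+ n.+2 * (25 * e ^+ 2) * nt ^+ n * nt * (16 / del)) =
   (1600 * K0 R * nI ^+ 2 / del * 10 ^+ n.+2 * W * nt ^+ n * e) *
   ((3 + 16 * e / (del * nt) + 4 * Cc) * nt * e ^+ 2) by field; rewrite !gt_eqF.
have -> : shell_const * 10 ^+ n.+2 * W * nt ^+ n * e =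
  (1600 * K0 R * nI ^+ 2 / del * 10 ^+ n.+2 * W * nt ^+ n * e) * (3 + 4 * Cc + 16 / del).
  by rewrite /shell_const; field; rewrite gt_eqF.
apply: ler_wpM2l Z.
have X1 : 0 <= 1600 * K0 R * nI ^+ 2 / del.
  apply: divr_ge0 (ltW d0); apply: mulr_ge0; last exact: exprn_ge0.
  exact: mulr_ge0 (ler0n _ _) k0'.
have X2 : 0 <= (10 : R) ^+ n.+2 by exact: exprn_ge0.
have X3 : 0 <= nt ^+ n by rewrite exprn_ge0 // cnorm_ge0.
exact: mulr_ge0 (mulr_ge0 (mulr_ge0 (mulr_ge0 X1 X2) W0) X3) (ltW e0).
Qed.

(** Near [t] the glued function is [F k0] up to a flat term, and the residue of
    the kernel at [t] is 1. *)
Lemma core_cauchy : let q z := glue z * geo n.+2 z in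
  bdd (gsum core q) /\
  normc (cint core q - F k0 t) <= 3 * K0 R * nI * W * 10 ^+ n.+2 * nt ^+ n.
Proof.
move=> q; have T1 := T00; have T2 := T01; have r0 := r_gt0; have rl := r_le.
have tt := tT; have tp := t0; have d0 := del0.
have k0' : 0 <= K0 R := ltW (K0_gt0 R).
have tn : t != 0 by rewrite -cnorm_gt0.
pose g z := F k0 z * (t / z) ^+ n.+2.
have gt : g t = F k0 t by rewrite /g divff // expr1n mulr1.
have near z : normc (z - t) < 3 * r -> [/\ O k0 z, 0 < normc z < T0 & 5 / 8 * nt <= normc z <= 3 / 2 * nt].
  move=> hz; have := cnorm_sub t z; have := cnorm_sub z t; rewrite (cdistC t) => h3 h4.
  have O1 : O k0 z by apply: (chi_O ct); apply: lt_le_trans hz _; lra.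
  split => //; apply/andP; split; lra.
have gh z : normc (z - t) < 3 * r -> cdiff g z.
  move=> hz; have [Oz z0T /andP[z1 _]] := near z hz.
  apply: cdiffM; first exact: F_hol.
  apply: cdiffX; apply: (cdiffM (cdiff_cst _ _)); apply: cdiffV; first exact: cdiff_id.
  by rewrite -cnorm_gt0; lra.
have tt0 : normc (t - t) < r by rewrite subrr cnorm0.
have tt3 : normc (t - t) < 3 * r by rewrite subrr cnorm0 mulr_gt0.
have [b1 e1] := cauchy_bump r0 (hol_on_exc gh) (gh t tt3) tt0.
pose q2 z := (glue z - F k0 z) * geo n.+2 z.
pose om := W * (3 / 2 * nt) ^+ n.+4.
have h32 : 0 <= 3 / 2 * nt by lra.
pose Q := (3 / 2) ^+ n.+2 / (3 / 4 * r).
have om0 : 0 <= om by rewrite mulr_ge0 // exprn_ge0.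
have Q0 : 0 <= Q by rewrite divr_ge0 ?exprn_ge0 ?divr_ge0 ?mulr_ge0 // ?divr_ge0 // ltW.
have q2Q z : on_ring t r z -> normc (q2 z) <= nI * om * Q.
  move=> /andP[h1 h2]; have h3 : normc (z - t) < 3 * r by lra.
  have [Oz z0T /andP[z1 z2]] := near z h3.
  have zp : 0 < normc z by case/andP: z0T.
  rewrite cnormM; apply: ler_pM; rewrite ?cnorm_ge0 //.
    apply: glue_sub => // i j Oi Oj; apply: le_trans (hW Oi Oj z0T) _.
    by apply: ler_wpM2l => //; rewrite lerXn2r ?nnegrE ?cnorm_ge0.
  have z3 : 2 / 3 * nt <= normc z.
    by have := cnorm_sub t z; rewrite (cdistC t); lra.
  have -> : Q = (nt / (2 / 3 * nt)) ^+ n.+2 / (3 / 4 * r).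
    by rewrite /Q; congr (_ ^+ _ / _); field; rewrite gt_eqF.
  by apply: geo_le => //; rewrite mulr_gt0.
have nQ : 0 <= nI * om * Q by rewrite mulr_ge0 // mulr_ge0.
have b2 : bdd (gsum core q2) by eexists; exact: gsum_ring_ev r0 nQ q2Q.
have h2 := cint_ring_le r0 nQ q2Q.
have -> : q = fun z => g z / (z - t) + q2 z.
  by apply/funext => z; rewrite /q /g /q2 /geo; ring.
split.
  by have := bddD b1 b2; congr bdd; apply/funext => N; rewrite gsumDr.
rewrite cintD // e1 gt addrAC subrr add0r; apply: le_trans h2 _.
have omle : om <= W * ((3 / 2) ^+ n.+2 * (9 / 4) * nt ^+ n).
  apply: ler_wpM2l => //.
  rewrite exprMn (exprS (3 / 2) n.+3) (exprS (3 / 2) n.+2).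
  have -> : 3 / 2 * (3 / 2 * (3 / 2) ^+ n.+2) = (3 / 2) ^+ n.+2 * (9 / 4) :> R by field.
  apply: ler_wpM2l; first by rewrite mulr_ge0 ?exprn_ge0 ?divr_ge0.
  apply: ler_wiXn2l; [exact: cnorm_ge0|lra|by rewrite -(addn4 n) leq_addr].
have -> : K0 R * r * (nI * om * Q) = K0 R * nI * (4 / 3) * ((3 / 2) ^+ n.+2 * om).
  by rewrite /Q; field; rewrite !gt_eqF.
have X0 : 0 <= K0 R * nI * (4 / 3).
  by apply: mulr_ge0; [exact: mulr_ge0|exact: divr_ge0].
apply: le_trans (ler_wpM2l X0 (ler_wpM2l _ omle)) _; first by rewrite exprn_ge0 ?divr_ge0.
have -> : K0 R * nI * (4 / 3) * ((3 / 2) ^+ n.+2 * (W * ((3 / 2) ^+ n.+2 * (9 / 4) * nt ^+ n))) =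
  3 * K0 R * nI * W * ((3 / 2) * (3 / 2)) ^+ n.+2 * nt ^+ n.
  by rewrite (exprMn _ (3 / 2) (3 / 2)); field.
apply: ler_wpM2r; first by rewrite exprn_ge0 ?cnorm_ge0.
apply: ler_wpM2l.
  by apply: mulr_ge0 => //; apply: mulr_ge0 => //; exact: mulr_ge0.
by rewrite lerXn2r ?nnegrE //; lra.
Qed.

(** All the shells outside the circle of radius [eps m], without the disc
    around [t]. *)
Definition shells m z := (bump (0 : C) (eps 0) z - bump 0 (eps m) z) * (1 - core z).

Lemma shells_le m : let q z := glue z * geo n.+2 z in
  bdd (gsum (shells m) q) /\
  normc (cint (shells m) q) <= shell_const * 10 ^+ n.+2 * W * nt ^+ n * (eps 0 - eps m).
Proof.
move=> q; elim: m => [|m [b h]].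
  have z N : gsum (shells 0) q N = 0.
    rewrite (_ : shells 0 = fun z : C => 0 - 0 : C); first by rewrite gsumBl subrr.
    by apply/funext => z; rewrite /shells !subrr mul0r.
  rewrite /cint (funext z) clim_cst mul0r cnorm0 subrr mulr0; split => //.
  by exists 0, 0%N => N _; rewrite cnorm0.
have [b2 h2] := geo_shell m; have [b3 e3] := cintDl b b2.
have -> : shells m.+1 = fun z => shells m z + shellw m z.
  by apply/funext => z; rewrite /shells /shellw /ringw; ring.
split => //; rewrite e3; apply: le_trans (cnormD _ _) _.
rewrite (epsS m) in h; apply: le_trans (lerD h h2) _.
by rewrite -mulrDr le_eqVlt; apply/orP; left; apply/eqP; congr (_ * _); ring.
Qed.

Lemma core_eq m z : eps m <= nt / 8 ->
  bump 0 (eps 0) z = bump 0 (eps m) z + (shells m z + core z).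
Proof.
move=> em; have e0 : eps 0 = T0 / 4 by rewrite /eps expr0 divr1.
have T1 := T00; have tt := tT; have tp := t0; have e1 := eps_gt0 m.
have [c|/core_supp/andP[h1 h2]] := eqVneq (core z) 0.
  by rewrite /shells c; ring.
rewrite /shells (@bump0 _ _ (eps m)) ?subr0 //; last by lra.
by rewrite bump1 ?subr0 ?e0 ?divr_gt0 //; [ring|lra].
Qed.

Lemma gcint_geo0 : normc (gcint 0 (geo n.+2)) <=
  4 * K0 R * nI * B * (16 / T0) ^+ n.+2 * nt ^+ n /\
  bdd (gsum (bump 0 (eps 0)) (fun z => glue z * geo n.+2 z)).
Proof.
have e0 : eps 0 = T0 / 4 by rewrite /eps expr0 divr1.
have T1 := T00; have T2 := T01; have tt := tT; have tp := t0.
have k0' : 0 <= K0 R := ltW (K0_gt0 R).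
pose Q := (nt / (T0 / 16)) ^+ n.+2 / (T0 / 16).
have T16 : 0 < T0 / 16 by rewrite divr_gt0.
have Q0 : 0 <= Q.
  by apply: divr_ge0 (ltW T16); apply: exprn_ge0; exact: divr_ge0 (cnorm_ge0 _) (ltW T16).
have [|b h] := @gcint_le 0 (geo n.+2) Q Q0.
  move=> z /andP[]; rewrite subr0 e0 => z1 z2; have zt := cnorm_sub z t.
  by apply: (@geo_le _ z (T0 / 16) (T0 / 16)) => //; lra.
split => //; apply: le_trans h _.
have -> : K0 R * eps 0 * (nI * B * Q) = 4 * K0 R * nI * B * (16 / T0) ^+ n.+2 * nt ^+ n.+2.
  rewrite e0 /Q (_ : nt / (T0 / 16) = 16 / T0 * nt); last by field; rewrite gt_eqF.
  by rewrite exprMn; field; rewrite gt_eqF.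
apply: ler_wpM2l.
  apply: mulr_ge0; last by apply: exprn_ge0; exact: divr_ge0 (ler0n _ _) (ltW T1).
  by apply: mulr_ge0 => //; apply: mulr_ge0 => //; exact: mulr_ge0.
apply: ler_wiXn2l; [exact: cnorm_ge0|lra|by rewrite -(addn2 n) leq_addr].
Qed.

Lemma gcint_small m : eps m <= nt / 8 -> forall N, exists Q, 0 <= Q /\
  forall z, on_ring 0 (eps m) z -> normc (geo N z) <= Q.
Proof.
move=> em N; have e1 := eps_gt0 m; have tp := t0.
exists ((nt / (eps m / 2)) ^+ N / (nt / 2)); split.
  apply: divr_ge0; last by rewrite divr_ge0 // cnorm_ge0.
  apply: exprn_ge0; apply: divr_ge0; first exact: cnorm_ge0.
  by rewrite divr_ge0 // ltW.
move=> z /andP[]; rewrite subr0 => h1 h2; apply: geo_le; rewrite ?divr_gt0 //; first by lra.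
by rewrite cdistC; have := cnorm_sub t z; lra.
Qed.

(** One step of the geometric expansion of [1 / (z - t)] in powers of [t / z]. *)
Lemma gcint_geoS m N : eps m <= nt / 8 ->
  gcint m (geo N.+1) = gcint m (geo N) - t ^+ N * gcint m (mono N).
Proof.
move=> em; have e1 := eps_gt0 m; have tp := t0.
have [Q [Q0 hQ]] := gcint_small em N; have [b1 _] := gcint_le Q0 hQ.
have M0 : 0 <= (eps m / 2)^-1 ^+ N.+1 by rewrite exprn_ge0 // invr_ge0 divr_ge0 // ltW.
have [|b2 _] := @gcint_le m (mono N) _ M0.
  by move=> z /andP[]; rewrite subr0 => h1 h2; apply: mono_le; [rewrite divr_gt0|lra].
have b3 := bddZ (- t ^+ N) b2.
have b3' : bdd (gsum (bump 0 (eps m)) (fun z => - t ^+ N * (glue z * mono N z))).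
  by move: b3; congr bdd; apply/funext => K; rewrite gsumZr.
rewrite /gcint -mulNr -cintZ // -cintD //.
have b4 : bdd (gsum (bump 0 (eps m)) (fun z => glue z * geo N z + - t ^+ N * (glue z * mono N z))).
  by have := bddD b1 b3'; congr bdd; apply/funext => K; rewrite gsumDr.
have [//|_ ->//] := @cint_ring_eq _ 0 (eps m) _ (fun z => glue z * geo N.+1 z) e1 b4.
move=> z /andP[]; rewrite subr0 => h1 h2.
have zn : z != 0 by rewrite -cnorm_gt0; lra.
have zt : z - t != 0 by rewrite -cnorm_gt0 cdistC; have := cnorm_sub t z; lra.
rewrite /geo /mono !exprMn !exprS !exprVn; field.
by rewrite zn zt expf_neq0.
Qed.

Lemma gcint_geo_sum m N : eps m <= nt / 8 ->
  gcint m (geo N) = gcint m (geo 0) - \sum_(k < N) t ^+ k * gcint m (mono k).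
Proof.
move=> em; elim: N => [|N IH]; first by rewrite big_ord0 subr0.
by rewrite gcint_geoS // IH big_ord_recr /= opprD addrA.
Qed.

Lemma eps_small e : 0 < e -> exists m0, forall m, (m0 <= m)%N -> eps m <= e.
Proof.
move=> e0; have [m0 h] := mesh_small e0; exists m0 => m /h; apply: le_trans.
rewrite /eps ler_pdivrMr ?exprn_gt0 // /mesh mulVf ?expf_neq0 //.
by have := T01; lra.
Qed.

Lemma gcint_geo0_nul : nul (fun m => gcint m (geo 0)).
Proof.
move=> e e0; have tp := t0; have k0' : 0 <= K0 R := ltW (K0_gt0 R).
pose D := K0 R * (nI * B * (2 / nt)).
have D0 : 0 <= D.
  rewrite /D; apply: mulr_ge0 => //; apply: mulr_ge0 => //; apply: mulr_ge0 => //.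
  by rewrite invr_ge0 ltW.
have D1 : 0 < D + 1 by lra.
have me0 : 0 < Num.min (nt / 8) (e / (D + 1)) by rewrite lt_min !divr_gt0.
have [m0 h] := eps_small me0; exists m0 => m /h; rewrite le_min => /andP[h1 h2].
have Q0 : 0 <= 2 / nt by rewrite divr_ge0 // ltW.
have e1 := eps_gt0 m.
have [|_ h3] := @gcint_le m (geo 0) _ Q0.
  move=> z /andP[]; rewrite subr0 => z1 z2.
  have -> : 2 / nt = (nt / (eps m / 2)) ^+ 0 / (nt / 2) by rewrite expr0; field; rewrite gt_eqF.
  apply: geo_le; rewrite ?divr_gt0 //; first by lra.
  by rewrite cdistC; have := cnorm_sub t z; lra.
apply: le_trans h3 _.
have -> : K0 R * eps m * (nI * B * (2 / nt)) = eps m * D by rewrite /D; ring.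
move: h2; rewrite ler_pdivlMr //; lra.
Qed.

Lemma apart_le k : (k <= n.+4)%N -> apart k W.
Proof.
move=> kn i j z Oi Oj zT; apply: le_trans (hW Oi Oj zT) _; case/andP: zT => z0 z1.
by apply: ler_wpM2l => //; apply: ler_wiXn2l => //; rewrite ?ltW //; have := T01; lra.
Qed.

Lemma clim_coef_sum N : (N <= n.+3)%N ->
  let u m := F k0 t + gcint m (geo 0) - \sum_(k < N) t ^+ k * gcint m (mono k) in
  bdd u /\ clim u = F k0 t - \sum_(k < N) t ^+ k * coef k.
Proof.
elim: N => [_|N IH hN] /=.
  have n0 := gcint_geo0_nul.
  have bc : bdd (fun=> F k0 t) by exists (normc (F k0 t)), 0%N.
  have e : (fun m => F k0 t + gcint m (geo 0) - \sum_(k < 0) t ^+ k * gcint m (mono k)) =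
    (fun m => F k0 t + gcint m (geo 0)) by apply/funext => m; rewrite big_ord0 subr0.
  rewrite e; split; first exact: (bddD bc (nul_bdd n0)).
  by rewrite climD //; [rewrite clim_cst clim0 // big_ord0 subr0 addr0|exact: nul_bdd].
have [b h] := IH (ltnW hN).
have e : (fun m => F k0 t + gcint m (geo 0) - \sum_(k < N.+1) t ^+ k * gcint m (mono k)) =
  (fun m => (F k0 t + gcint m (geo 0) - \sum_(k < N) t ^+ k * gcint m (mono k)) +
     - t ^+ N * gcint m (mono N)).
  by apply/funext => m; rewrite big_ord_recr /= opprD addrA mulNr.
have bm : bdd (fun m => gcint m (mono N)).
  by eexists; exists 0%N => m _; exact: (gcint_mono_le m W0 (apart_le (leqW hN))).
rewrite e; split; first exact: (bddD b (bddZ _ bm)).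
by rewrite climD //; [rewrite h climZ // big_ord_recr /= opprD addrA mulNr|exact: bddZ].
Qed.

Definition expansion_const := 7 * K0 R * nI + shell_const + rate.

(** Cauchy's formula with the kernel [(t / z) ^+ n.+2 / (z - t)]: the residue
    at [t] is the value of [F k0], the disc around 0 gives the coefficients and
    the shells in between are small. *)
Theorem glue_expansion :
  normc (F k0 t - \sum_(k < n.+2) t ^+ k * coef k) <=
  expansion_const * (16 / T0) ^+ n.+2 * (B + W) * nt ^+ n.
Proof.
have T1 := T00; have T2 := T01; have tt := tT; have tp := t0.
have k0' : 0 <= K0 R := ltW (K0_gt0 R).
have [|_ <-] := @clim_coef_sum n.+2; first exact: leqnSn.
have [h1 b1] := gcint_geo0; have [b2 h2] := core_cauchy.
apply: clim_le.
have t8 : 0 < nt / 8 by rewrite divr_gt0.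
have [m0 hm0] := eps_small t8; exists m0 => m /hm0 em.
have [b3 h3] := shells_le m.
have [Q [Q0 hQ]] := gcint_small em n.+2; have [b4 _] := gcint_le Q0 hQ.
have [b5 e5] := cintDl b3 b2; have [_ e6] := cintDl b4 b5.
have e : gcint 0 (geo n.+2) = gcint m (geo n.+2) +
   (cint (shells m) (fun z => glue z * geo n.+2 z) + cint core (fun z => glue z * geo n.+2 z)).
  rewrite -e5 -[X in _ = X + _]/(cint (bump 0 (eps m)) (fun z => glue z * geo n.+2 z)) -e6.
  have we : bump (0 : C) (eps 0) = fun z => bump 0 (eps m) z + (shells m z + core z).
    by apply/funext => z; exact: core_eq.
  exact: (congr1 (fun k => cint k (fun z => glue z * geo n.+2 z)) we).
rewrite -addrA -(gcint_geo_sum n.+2 em).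
have -> : F k0 t + gcint m (geo n.+2) = gcint 0 (geo n.+2) -
  cint (shells m) (fun z => glue z * geo n.+2 z) -
  (cint core (fun z => glue z * geo n.+2 z) - F k0 t) by rewrite e; ring.
apply: le_trans (cnormB _ _) _.
have := cnormB (gcint 0 (geo n.+2)) (cint (shells m) (fun z => glue z * geo n.+2 z)) => h4.
have e1 := eps_gt0 m; have e0 := eps_le 0.
set X := nt ^+ n in h1 h2 h3 *; have X0 : 0 <= X by rewrite exprn_ge0 ?cnorm_ge0.
set A := (16 / T0) ^+ n.+2 in h1 *.
have A10 : 10 ^+ n.+2 <= A.
  rewrite lerXn2r ?nnegrE ?divr_ge0 ?(ltW T1) // ler_pdivlMr //; lra.
have p10 : 0 <= (10 : R) ^+ n.+2 by exact: exprn_ge0.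
set p := 10 ^+ n.+2 in h2 h3 A10 p10.
have s0 := shell_const_ge0; have rt0 := rate_ge0.
have A0 : 0 <= A by lra.
have K1 : 0 <= K0 R * nI by rewrite mulr_ge0.
have pWX : p * W * X <= A * W * X by rewrite !ler_wpM2r.
have AWX : 0 <= A * W * X := mulr_ge0 (mulr_ge0 A0 W0) X0.
have ABX : 0 <= A * B * X := mulr_ge0 (mulr_ge0 A0 B0) X0.
have pWX0 : 0 <= p * W * X := mulr_ge0 (mulr_ge0 p10 W0) X0.
have g1 : K0 R * nI * (p * W * X) <= K0 R * nI * (A * W * X) by rewrite ler_wpM2l.
have g2 : shell_const * (p * W * X) * (eps 0 - eps m) <= shell_const * (A * W * X) * 1.
  apply: le_trans (_ : shell_const * (p * W * X) * 1 <= _).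
    by apply: ler_wpM2l (mulr_ge0 s0 pWX0) _ _ _; lra.
  by rewrite !mulr1 ler_wpM2l.
have g3 : 0 <= K0 R * nI * (A * W * X) by rewrite mulr_ge0.
have g4 : 0 <= K0 R * nI * (A * B * X) by rewrite mulr_ge0.
have g5 : 0 <= shell_const * (A * B * X) by rewrite mulr_ge0.
have g6 : 0 <= rate * (A * B * X) by rewrite mulr_ge0.
have g7 : 0 <= rate * (A * W * X) by rewrite mulr_ge0.
have -> : expansion_const * A * (B + W) * X = 7 * (K0 R * nI * (A * B * X)) +
  7 * (K0 R * nI * (A * W * X)) + shell_const * (A * B * X) + shell_const * (A * W * X) +
  (rate * (A * B * X) + rate * (A * W * X)) by rewrite /expansion_const; ring.
have h1' : 4 * K0 R * nI * B * A * X = 4 * (K0 R * nI * (A * B * X)) by ring.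
have h2' : 3 * K0 R * nI * W * p * X = 3 * (K0 R * nI * (p * W * X)) by ring.
have h3' : shell_const * p * W * X * (eps 0 - eps m) =
  shell_const * (p * W * X) * (eps 0 - eps m) by ring.
rewrite h1' in h1; rewrite h2' in h2; rewrite h3' in h3.
clear e e5 e6; lra.
Qed.

End AtPoint.

Lemma coef_bound n W : 0 <= W -> apart n.+1 W ->
  normc (coef n) <= expansion_const * (16 / T0) ^+ n.+1 * (B + W).
Proof.
move=> W0 hW; apply: le_trans (coef_le W0 hW) _.
have T1 := T00; have T2 := T01.
have k0' : 0 <= K0 R := ltW (K0_gt0 R).
have A10 : 10 ^+ n.+1 <= (16 / T0) ^+ n.+1.
  rewrite lerXn2r ?nnegrE ?divr_ge0 ?(ltW T1) // ler_pdivlMr //; lra.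
set A := (16 / T0) ^+ n.+1 in A10 *.
have p10 : 0 <= (10 : R) ^+ n.+1 by exact: exprn_ge0.
set p := 10 ^+ n.+1 in A10 p10 *.
have s0 := shell_const_ge0; have rt0 := rate_ge0; have A0 : 0 <= A by lra.
have K1 : 0 <= K0 R * nI by rewrite mulr_ge0.
have g1 : rate * (W * p) <= rate * (W * A) by apply: ler_wpM2l => //; exact: ler_wpM2l.
have g2 : 0 <= K0 R * nI * (A * W) := mulr_ge0 K1 (mulr_ge0 A0 W0).
have g3 : 0 <= K0 R * nI * (A * B) := mulr_ge0 K1 (mulr_ge0 A0 B0).
have g4 : 0 <= shell_const * (A * B) := mulr_ge0 s0 (mulr_ge0 A0 B0).
have g5 : 0 <= shell_const * (A * W) := mulr_ge0 s0 (mulr_ge0 A0 W0).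
have g6 : 0 <= rate * (A * B) := mulr_ge0 rt0 (mulr_ge0 A0 B0).
have -> : expansion_const * A * (B + W) = 7 * (K0 R * nI * (A * B)) +
  7 * (K0 R * nI * (A * W)) + shell_const * (A * B) + shell_const * (A * W) +
  rate * (A * B) + rate * (W * A) by rewrite /expansion_const; ring.
have -> : K0 R * nI * B * A = K0 R * nI * (A * B) by ring.
lra.
Qed.

End RamisSibuya.

(** * Zeros on lines *)

Section Jensen.
Variable R : realType.
Local Notation C := (CC R).
Implicit Types (f g : C -> C) (c z w : C) (s Z : seq C).

(** The ultrafilter limit is a cluster point. *)
Lemma bolzano_weierstrass (u : nat -> C) : bdd u ->
  exists z, forall e, 0 < e -> forall N, exists2 n, (N <= n)%N & normc (u n - z) < e.
Proof.
move=> bu; exists (clim u) => e e0 N; have UU := ultra_ultra.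
have h (x : nat -> R) : rbounded x -> ultra [set n | `|x n - rlim x| < e / 2].
  move=> /rlim_cvg /cvgr_dist_lt/(_ (e / 2)) h; have e2 : 0 < e / 2 by rewrite divr_gt0.
  have hh : ultra [set n | `|rlim x - x n| < e / 2] := h e2.
  have -> // : [set n | `|x n - rlim x| < e / 2] = [set n | `|rlim x - x n| < e / 2].
  by apply/funext => n /=; rewrite distrC.
have h1 := h _ (bddRe bu); have h2 := h _ (bddIm bu).
have h3 : ultra [set n | (N <= n)%N] by apply: ultra_ev; exists N.
have [n [[/= n1 n2] n3]] := filter_ex (filterI (filterI h1 h2) h3).
exists n => //; apply: le_lt_trans (cnorm_le_ReIm _) _.
rewrite ReB ImB /clim /=; lra.
Qed.

Lemma bounded_near_cdiff f c : cdiff f c -> bounded_near f c.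
Proof.
move=> df; have [d [d0 h]] := cdiff_cont df ltr01.
exists d, (normc (f c) + 1); split => // z /h hz.
by have := cnorm_sub (f z) (f c); lra.
Qed.

Lemma bounded_nearM f g c : bounded_near f c -> bounded_near g c ->
  bounded_near (fun z => f z * g z) c.
Proof.
move=> [d1 [M1 [d10 h1]]] [d2 [M2 [d20 h2]]].
exists (Num.min d1 d2), (M1 * M2); split; first by rewrite lt_min d10 d20.
move=> z; rewrite lt_min => /andP[z1 z2]; rewrite cnormM.
by apply: ler_pM; rewrite ?cnorm_ge0 ?h1 ?h2.
Qed.

Lemma bounded_near_div g c : cdiff g c -> g c = 0 -> bounded_near (fun z => g z * (z - c)^-1) c.
Proof.
move=> dg g0; have [l hl] := cdiff_eps dg; have [d [d0 h]] := hl 1 ltr01.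
exists d, (1 + normc l); split => // z hz; have [->|zc] := eqVneq z c.
  by rewrite subrr invr0 mulr0 cnorm0 addr_ge0 ?cnorm_ge0.
rewrite cnormM cnormV ler_pdivrMr ?cnorm_gt0 ?subr_eq0 //.
have := h z hz; rewrite g0 subr0 => h'.
have := cnorm_sub (g z) (l * (z - c)); rewrite cnormM; lra.
Qed.

Lemma cnorm_prod_le s (F : C -> C) (b : R) : (forall w, w \in s -> normc (F w) <= b) ->
  normc (\prod_(w <- s) F w) <= b ^+ size s.
Proof.
elim: s => [|w s IH] h; first by rewrite big_nil cnorm1.
rewrite big_cons cnormM exprS; apply: ler_pM; rewrite ?cnorm_ge0 ?h ?mem_head //.
by apply: IH => v hv; apply: h; rewrite inE hv orbT.
Qed.

Lemma cnorm_prod_ge s (F : C -> C) (b : R) : 0 <= b -> (forall w, w \in s -> b <= normc (F w)) ->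
  b ^+ size s <= normc (\prod_(w <- s) F w).
Proof.
move=> b0; elim: s => [|w s IH] h; first by rewrite big_nil cnorm1.
rewrite big_cons cnormM exprS; apply: ler_pM; rewrite ?exprn_ge0 ?h ?mem_head //.
by apply: IH => v hv; apply: h; rewrite inE hv orbT.
Qed.

Lemma cdiff_invprod s z : z \notin s -> cdiff (fun z => \prod_(w <- s) (z - w)^-1) z.
Proof.
elim: s => [_|w s IH].
  by have -> : (fun z : C => \prod_(w <- [::]) (z - w)^-1) = fun=> 1;
    [apply/funext => u; rewrite big_nil|exact: cdiff_cst].
rewrite inE negb_or => /andP[zw zs].
have -> : (fun z : C => \prod_(v <- w :: s) (z - v)^-1) =
    fun z => (z - w)^-1 * \prod_(v <- s) (z - v)^-1.
  by apply/funext => u; rewrite big_cons.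
exact: (cdiffM (cdiff_invB zw) (IH zs)).
Qed.

(** Dividing by the zeros multiplies the value at the center by at least
    [(4 / r) ^+ k] and the values on the ring by at most [(2 / r) ^+ k]. *)
Lemma jensen_count g c (r M : R) s : 0 < r -> hol_on g c (3 * r) -> 
  (forall z, normc (z - c) < 3 * r -> normc (g z) <= M) -> g c != 0 -> uniq s ->
  (forall z, z \in s -> g z = 0 /\ normc (z - c) < r / 4) ->
  normc (g c) * 2 ^+ size s <= 2 * K0 R * M.
Proof.
move=> r0 hg gM gc us hs.
have M0 : 0 <= M.
  by apply: le_trans (gM c _); rewrite ?cnorm_ge0 // subrr cnorm0 mulr_gt0.
have K00 : 0 <= K0 R := ltW (K0_gt0 R).
pose h z := g z * \prod_(w <- s) (z - w)^-1.
have cs : c \notin s by apply/negP => /hs[e _]; rewrite e eqxx in gc.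
have hh : hol_exc h c (3 * r) s.
  move=> z hz; have [zs|zs] := boolP (z \in s); last first.
    by left; exact: (cdiffM (hg z hz) (cdiff_invprod zs)).
  right; split => //; have [gz _] := hs z zs.
  have -> : h = fun u => (g u * (u - z)^-1) * \prod_(w <- rem z s) (u - w)^-1.
    by apply/funext => u; rewrite /h (big_rem z zs) /= mulrA.
  apply: bounded_nearM; first exact: bounded_near_div (hg z hz) gz.
  apply: bounded_near_cdiff; apply: cdiff_invprod.
  by rewrite mem_rem_uniq // inE eqxx.
have dhc : cdiff h c.
  by apply: cdiffM (cdiff_invprod cs); apply: hg; rewrite subrr cnorm0 mulr_gt0.
have cc : normc (c - c) < r by rewrite subrr cnorm0.
have [_ e] := cauchy_bump r0 hh dhc cc.
have Q0 : 0 <= M * (2 / r) ^+ size s / (3 / 4 * r).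
  apply: divr_ge0; last by rewrite mulr_ge0 // ltW.
  by apply: mulr_ge0 => //; apply: exprn_ge0; rewrite divr_ge0 // ltW.
have h1 : normc (h c) <= K0 R * r * (M * (2 / r) ^+ size s / (3 / 4 * r)).
  rewrite -e; apply: cint_ring_le => // z /andP[z1 z2].
  rewrite cnormM cnormV; apply: ler_pM; rewrite ?cnorm_ge0 ?invr_ge0 ?cnorm_ge0 //.
    rewrite cnormM; apply: ler_pM; rewrite ?cnorm_ge0 //; first by apply: gM; lra.
    apply: cnorm_prod_le => w /hs[_ wc].
    have hw : r / 2 <= normc (z - w).
      by have := cdist_triangle w z c; lra.
    have r2 : 0 < r / 2 by rewrite divr_gt0.
    by rewrite cnormV -invf_div lef_pV2 ?posrE //; lra.
  rewrite lef_pV2 ?posrE //; first by lra.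
  by rewrite mulr_gt0.
have h2 : normc (g c) * (4 / r) ^+ size s <= normc (h c).
  rewrite cnormM ler_wpM2l ?cnorm_ge0 //.
  apply: cnorm_prod_ge; first by rewrite divr_ge0 // ltW.
  move=> w ws; have [_ wc] := hs w ws.
  have cw : 0 < normc (c - w).
    by rewrite cnorm_gt0 subr_eq0; apply: contraNneq cs => ->.
  rewrite cnormV -invf_div lef_pV2 ?posrE ?divr_gt0 //.
  by rewrite cdistC ltW.
have h3 := le_trans h2 h1.
have rk : 0 < (2 / r) ^+ size s by rewrite exprn_gt0 // divr_gt0.
rewrite -(ler_pM2r rk) -(mulrA (normc (g c))) -exprMn.
have -> : 2 * (2 / r) = 4 / r by field; rewrite gt_eqF.
apply: le_trans h3 _.
have -> : K0 R * r * (M * (2 / r) ^+ size s / (3 / 4 * r)) =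
  4 / 3 * (K0 R * M * (2 / r) ^+ size s) by field; rewrite gt_eqF.
have X : 0 <= K0 R * M * (2 / r) ^+ size s.
  by apply: mulr_ge0 (ltW rk); exact: mulr_ge0.
lra.
Qed.

(** Arbitrarily long lists of zeros would contradict [jensen_count]. *)
Lemma jensen g c (r M : R) : 0 < r -> hol_on g c (3 * r) -> 
  (forall z, normc (z - c) < 3 * r -> normc (g z) <= M) -> g c != 0 ->
  exists Z, forall z, normc (z - c) < r / 4 -> g z = 0 -> z \in Z.
Proof.
move=> r0 hg gM gc; apply: contrapT => nZ.
have next Z : exists z, [/\ normc (z - c) < r / 4, g z = 0 & z \notin Z].
  apply: contrapT => h; apply: nZ; exists Z => z hz gz; apply/negPn/negP => zZ.
  by apply: h; exists z.
have lists n : exists s, [/\ size s = n, uniq s &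
    forall z, z \in s -> g z = 0 /\ normc (z - c) < r / 4].
  elim: n => [|n [s [ss us hs]]]; first by exists [::].
  have [z [hz gz zs]] := next s; exists (z :: s); split => /=; rewrite ?ss ?zs //.
  by move=> w; rewrite inE => /orP[/eqP ->|/hs].
have gp : 0 < normc (g c) by rewrite cnorm_gt0.
have e0 : 0 < normc (g c) / (2 * K0 R * M + 1).
  have M0 : 0 <= M.
    by apply: le_trans (gM c _); rewrite ?cnorm_ge0 // subrr cnorm0 mulr_gt0.
  have K00 : 0 <= K0 R * M by rewrite mulr_ge0 // ltW // K0_gt0.
  by rewrite divr_gt0 //; lra.
have [N hN] := mesh_small e0; have := hN N (leqnn N).
have [s [ss us hs]] := lists N; have := jensen_count r0 hg gM gc us hs; rewrite ss.
have p2 : 0 < (2 : R) ^+ N by rewrite exprn_gt0.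
have D0 : 0 < 2 * K0 R * M + 1.
  have : 0 < normc (g c) / (2 * K0 R * M + 1) := e0.
  by rewrite pmulr_rgt0 // invr_gt0.
rewrite /mesh (ler_pdivlMr _ _ D0) (mulrC _^-1) (ler_pdivrMr _ _ p2); lra.
Qed.

End Jensen.

Section GoodLine.
Variables (R : realType) (V : normedModType (CC R)).
Local Notation C := (CC R).
Variables (P : V -> C) (rP M : R).
Hypotheses (rP0 : 0 < rP) (hP : ball_hol P 0 rP M).

Lemma small_list (Z : seq C) : exists rho : R, 0 < rho /\ forall w, w \in Z -> w != 0 -> rho <= normc w.
Proof.
elim: Z => [|w Z [rho [rho0 h]]]; first by exists 1.
have [->|w0] := eqVneq w 0.
  by exists rho; split => // v; rewrite inE => /orP[/eqP ->|/h //]; rewrite eqxx.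
exists (Num.min rho (normc w)); split; first by rewrite lt_min rho0 cnorm_gt0.
move=> v; rewrite inE ge_min => /orP[/eqP -> _|/h hv /hv -> //]; by rewrite lexx orbT.
Qed.

Lemma scale_lt (z : C) (x : V) (a b : R) : normc z <= a -> 0 < a -> nrm x < b / a -> nrm (z *: x) < b.
Proof.
move=> za a0; rewrite ltr_pdivlMr // nrmZ => h; apply: le_lt_trans h.
by rewrite mulrC ler_wpM2l // nrm_ge0.
Qed.

(** A line through 0 on which [P] does not vanish identically: near 0 its only
    zero on the line is 0, because the zeros of a holomorphic function of one
    variable are isolated. *)
Lemma good_line r1 : ~ (\forall x \near (0 : V), P x = 0) -> 0 < r1 -> r1 <= rP ->
  exists (v : V) (r0 T : R), [/\ 0 < r0, 0 < T, T <= 1,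
    (forall x (z : C), nrm x < r0 -> normc z < 4 -> nrm (z *: v + x) < r1 / 2) &
    (forall x (z : C), nrm x < r0 -> 1 / 16 <= normc z -> normc z < 4 ->
       4 * T <= normc (P (z *: v + x)))].
Proof.
move=> Pn0 r10 r1P.
have M0 := ball_hol_ge0 rP0 hP.
have [x1 [hx1 Px1]] : exists x1, nrm x1 < r1 / 4 / 64 /\ P x1 != 0.
  apply: contrapT => h; apply: Pn0; apply/nearP; exists (r1 / 4 / 64); split.
    by rewrite !divr_gt0.
  move=> y; rewrite subr0 => hy; apply/eqP/negPn/negP => Py; apply: h; by exists y.
have dPl (y : V) (z : C) : nrm (z *: y) < rP -> cdiff (fun z => P (z *: y)) z.
  move=> h; have -> : (fun z : C => P (z *: y)) = (fun z => P (z *: y + 0)).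
    by apply/funext => u; rewrite addr0.
  by apply: cdiff_line; have [] := hP (w := z *: y + 0) _; rewrite ?subr0 ?addr0.
have in1 (z : C) : normc (z - 1) < 3 * 16 -> nrm (z *: x1) < r1 / 4.
  move=> hz; apply: scale_lt _ _ hx1 => //.
  by have := cnorm_sub z 1; rewrite cnorm1; lra.
have [||||Z hZ] := @jensen _ (fun z => P (z *: x1)) 1 16 M.
- by [].
- by move=> z /in1 hz; apply: dPl; lra.
- move=> z /in1 hz; have [] // := hP (w := z *: x1) _; rewrite subr0; lra.
- by rewrite scale1r.
have [rho [rho0 hrho]] := small_list Z.
pose rh := Num.min rho 1.
have rh0 : 0 < rh by rewrite lt_min rho0 ltr01.
have rh1 : rh <= 1 by rewrite ge_min lexx orbT.
have nz (z : C) : 0 < normc z -> normc z < rh -> P (z *: x1) != 0.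
  move=> z0; rewrite lt_min => /andP[z1 z2]; apply/eqP => Pz.
  have zZ : z \in Z.
    by apply: hZ => //; apply: le_lt_trans (cnormB _ _) _; rewrite cnorm1; lra.
  have zn : z != 0 by rewrite -cnorm_gt0.
  have := hrho z zZ zn; lra.
pose v := (rh / 8)%:C *: x1.
have vE (z : C) : z *: v = (z * (rh / 8)%:C) *: x1 by rewrite scalerA.
have nzc (z : C) : normc (z * (rh / 8)%:C) = normc z * (rh / 8).
  by rewrite cnormM cnorm_real gtr0_norm // divr_gt0.
have small (z : C) : normc z <= 4 -> nrm (z *: v) < r1 / 4.
  move=> hz; rewrite vE; apply: scale_lt _ _ hx1 => //.
  rewrite nzc; have : normc z * (rh / 8) <= 4 * (rh / 8) by rewrite ler_wpM2r // divr_ge0 // ltW.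
  lra.
have [T [T0 hT]] : exists T, 0 < T /\ forall z : C, 1 / 16 <= normc z -> normc z <= 4 ->
    8 * T <= normc (P (z *: v)).
  apply: contrapT => nT.
  have ex n : exists z : C, [/\ 1 / 16 <= normc z, normc z <= 4 & normc (P (z *: v)) < 8 * mesh R n].
    apply: contrapT => h; apply: nT; exists (mesh R n); split; first exact: mesh_gt0.
    move=> z z1 z2; rewrite leNgt; apply/negP => z3; apply: h; by exists z.
  pose u n := projT1 (cid (ex n)).
  have hu n : [/\ 1 / 16 <= normc (u n), normc (u n) <= 4 & normc (P (u n *: v)) < 8 * mesh R n].
    by rewrite /u; case: cid.
  have [|z hz] := @bolzano_weierstrass _ u; first by exists 4, 0%N => n _; have [] := hu n.
  have z16 : 1 / 16 <= normc z.
    rewrite leNgt; apply/negP => h; have e0 : 0 < 1 / 16 - normc z by rewrite subr_gt0.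
    have [n _ hn] := hz _ e0 0%N; have [h1 _ _] := hu n.
    by have := cnorm_sub (u n) z; lra.
  have z4 : normc z <= 4.
    rewrite leNgt; apply/negP => h; have e0 : 0 < normc z - 4 by rewrite subr_gt0.
    have [n _ hn] := hz _ e0 0%N; have [_ h1 _] := hu n.
    by have := cnorm_sub z (u n); rewrite cdistC; lra.
  have Pz : P (z *: v) != 0.
    rewrite vE; apply: nz; rewrite nzc; first by rewrite mulr_gt0 ?divr_gt0 //; lra.
    have : normc z * (rh / 8) <= 4 * (rh / 8) by rewrite ler_wpM2r // divr_ge0 // ltW.
    lra.
  have Pp : 0 < normc (P (z *: v)) / 2 by rewrite divr_gt0 // cnorm_gt0.
  have zr : nrm (z *: v) < rP by have := small z z4; lra.
  have [d [d0 hd]] := cdiff_cont (dPl v z zr) Pp.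
  have P16 : 0 < normc (P (z *: v)) / 16 by rewrite divr_gt0 // cnorm_gt0.
  have [N hN] := mesh_small P16.
  have [n nN hn] := hz d d0 N.
  have [_ _ h1] := hu n; have h2 := hd (u n) hn; have h3 := hN n nN.
  by have := cnorm_sub (P (z *: v)) (P (u n *: v)); rewrite cdistC; lra.
pose LP := lip_const M rP.
have LP0 : 0 <= LP.
  rewrite /LP /lip_const divr_ge0 ?divr_ge0 ?(ltW rP0) //.
  by rewrite mulr_ge0 // addr_ge0 // mulr_ge0 // ltW // K0_gt0.
have LP1 : 0 < LP + 1 by lra.
pose T1 := Num.min T 1.
have T10 : 0 < T1 by rewrite lt_min T0 ltr01.
have T1T : T1 <= T by rewrite ge_min lexx.
have r00 : 0 < Num.min (r1 / 4) (4 * T1 / (LP + 1)).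
  by rewrite lt_min !divr_gt0 // mulr_gt0.
exists v, (Num.min (r1 / 4) (4 * T1 / (LP + 1))), T1; split => //.
- by rewrite ge_min lexx orbT.
- move=> x z; rewrite lt_min => /andP[hx _] hz; have := nrmD (z *: v) x.
  have := small z (ltW hz); lra.
move=> x z; rewrite lt_min (ltr_pdivlMr _ _ LP1) => /andP[hx hx2] z1 z2.
have h1 := hT z z1 (ltW z2); have s1 := small z (ltW z2).
have s2 : nrm (z *: v + x) < rP / 2 by have := nrmD (z *: v) x; lra.
have s3 : nrm (z *: v) < rP / 2 by lra.
have h2 := lip_ball_global rP0 hP s3 s2; rewrite -/LP in h2.
have e : nrm (z *: v - (z *: v + x)) = nrm x by rewrite opprD addrA subrr add0r nrmN.
rewrite e in h2.
have h3 := cnorm_sub (P (z *: v)) (P (z *: v + x)).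
have n0 := nrm_ge0 x; lra.
Qed.

Section OnTheLine.
Variables (v : V) (r1 r0 T : R).
Hypotheses (r10 : 0 < r1) (r1P : r1 <= rP) (T0 : 0 < T) (r00 : 0 < r0).
Hypothesis in_ball : forall x (z : C), nrm x < r0 -> normc z < 4 -> nrm (z *: v + x) < r1 / 2.
Hypothesis ring_low : forall x (z : C), nrm x < r0 -> 1 / 16 <= normc z -> normc z < 4 ->
  4 * T <= normc (P (z *: v + x)).

Lemma line_hol x : nrm x < r0 -> hol_on (fun z => P (z *: v + x)) 0 4.
Proof.
move=> hx z; rewrite subr0 => hz; apply: cdiff_line.
have h := in_ball hx hz; have h1 := r1P; have h2 := r10.
by have [] // := hP (w := z *: v + x) _; rewrite subr0; lra.
Qed.

(** The zeros near the base point are counted by Jensen's inequality, and the ring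
    contains none. *)
Lemma line_zeros x : nrm x < r0 -> P x != 0 ->
  exists Z : seq C, forall z : C, normc z < 4 -> P (z *: v + x) = 0 -> z \in Z.
Proof.
move=> hx Px; have h1 := r1P; have h2 := r10.
have hl z : normc (z - 0) < 3 * 1 -> normc z < 4 by rewrite subr0 => h; lra.
have [||||Z hZ] := @jensen _ (fun z => P (z *: v + x)) 0 1 M.
- by [].
- by move=> z /hl h; apply: (line_hol hx); rewrite subr0.
- move=> z /hl h; have := in_ball hx h => h3.
  by have [] // := hP (w := z *: v + x) _; rewrite subr0; lra.
- by rewrite scale0r add0r.
exists Z => z z4 Pz; apply: hZ => //; rewrite subr0 ltNge; apply/negP => z14.
have z16 : 1 / 16 <= normc z by lra.
have := ring_low hx z16 z4; rewrite Pz cnorm0; have := T0; lra.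
Qed.

(** The open mapping property at 0, through the maximum principle for
    [1 / (P - w)]. *)
Lemma small_values w : P 0 = 0 -> 0 < normc w -> normc w <= T / (K0 R + 1) ->
  exists y, nrm y < r1 / 2 /\ P y = w.
Proof.
move=> P0 w0 hw; have t0 := T0; have x0 : nrm (0 : V) < r0 by rewrite nrm0.
have K00 := K0_gt0 R; have K1 : 0 < K0 R + 1 by lra.
rewrite ler_pdivlMr // in hw.
apply: contrapT => h.
have ne z : normc z < 4 -> P (z *: v + 0) - w != 0.
  move=> hz; rewrite subr_eq0; apply/eqP => e; apply: h; exists (z *: v + 0); split => //.
  exact: in_ball.
pose g z := (P (z *: v + 0) - w)^-1.
have gh : hol_on g 0 (3 * 1).
  move=> z hz; have z4 : normc z < 4 by move: hz; rewrite subr0 => hz; lra.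
  have dz : cdiff (fun z => P (z *: v + 0)) z by apply: (line_hol x0); rewrite subr0.
  exact: (cdiffV (cdiffB dz (cdiff_cst w z)) (ne z z4)).
have o3 : normc (0 - 0 : C) < 3 * 1 by rewrite subrr cnorm0; lra.
have o1 : normc (0 - 0 : C) < 1 by rewrite subrr cnorm0.
have [_ e] := cauchy_bump ltr01 (hol_on_exc gh) (gh 0 o3) o1.
have Q0 : 0 <= (3 * T)^-1 * (4 / 3) by rewrite mulr_ge0 ?divr_ge0 ?invr_ge0 // mulr_ge0 // ltW.
have h1 : normc (g 0) <= K0 R * 1 * ((3 * T)^-1 * (4 / 3)).
  rewrite -e; apply: cint_ring_le => // z /andP[]; rewrite subr0 => z1 z2.
  have z16 : 1 / 16 <= normc z by lra.
  have z4 : normc z < 4 by lra.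
  have l := ring_low x0 z16 z4.
  rewrite cnormM !cnormV; apply: ler_pM; rewrite ?invr_ge0 ?cnorm_ge0 //.
    have T3 : 0 < 3 * T by lra.
    rewrite lef_pV2 ?posrE // ?cnorm_gt0 ?ne //.
    have := cnorm_sub (P (z *: v + 0)) w; have : 0 <= normc w * K0 R by rewrite mulr_ge0 ?ltW.
    lra.
  by rewrite -invf_div lef_pV2 ?posrE //; lra.
move: h1; rewrite /g scale0r add0r P0 sub0r cnormV cnormN.
have -> : K0 R * 1 * ((3 * T)^-1 * (4 / 3)) = K0 R * (4 / 9) / T by field; rewrite gt_eqF.
rewrite ler_pdivlMr // mulrC ler_pdivrMr //.
have : 0 <= normc w * K0 R by rewrite mulr_ge0 ?ltW.
lra.
Qed.

End OnTheLine.
End GoodLine.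

(** * Cones and cutoff functions *)

Section Partition.
Variables (R : realType) (I : finType).
Local Notation C := (CC R).
Variable S : I -> C -> Prop.
Hypothesis S0 : forall j, ~ S j 0.
Hypothesis S_scale : forall j (c : R) (w : C), 0 < c -> S j w -> S j (c%:C * w).
Hypothesis S_open : forall j w, S j w -> exists e, 0 < e /\ forall w', normc (w' - w) < e -> S j w'.
Hypothesis S_cover : forall w : C, w != 0 -> exists j, S j w.

(** A Lebesgue number of the cover on the unit circle; it serves all radii by
    homogeneity. *)
Lemma lebesgue_cone : exists de : R, [/\ 0 < de, de <= 1 & forall w : C, w != 0 ->
  exists j, forall w', normc (w' - w) < de * normc w -> S j w'].
Proof.
apply: contrapT => nde.
have ex n : exists w : C, normc w = 1 /\ forall j, exists w', normc (w' - w) < mesh R n /\ ~ S j w'.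
  apply: contrapT => h; apply: nde; exists (mesh R n); split; first exact: mesh_gt0.
    by rewrite /mesh invf_le1 ?exprn_gt0 // exprn_ege1 // ler1n.
  move=> w w0; apply: contrapT => h2; apply: h.
  have wp : 0 < normc w by rewrite cnorm_gt0.
  exists ((normc w)^-1%:C * w); split.
    by rewrite cnormM cnorm_real gtr0_norm ?invr_gt0 // mulVf ?gt_eqF.
  move=> j; apply: contrapT => h3; apply: h2; exists j => w' hw'.
  have e : w' = (normc w)%:C * ((normc w)^-1%:C * w').
    by rewrite mulrA -rcM mulfV ?gt_eqF // mul1r.
  rewrite e; apply: S_scale => //; apply: contrapT => nS; apply: h3.
  exists ((normc w)^-1%:C * w'); split => //.
  by rewrite -mulrBr cnormM cnorm_real gtr0_norm ?invr_gt0 // mulrC ltr_pdivrMr.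
pose u n := projT1 (cid (ex n)).
have hu n : normc (u n) = 1 /\ forall j, exists w', normc (w' - u n) < mesh R n /\ ~ S j w'.
  by rewrite /u; case: cid.
have [|z hz] := @bolzano_weierstrass _ u; first by exists 1, 0%N => n _; have [->] := hu n.
have z0 : z != 0.
  apply/eqP => z0; have [n _] := hz _ ltr01 0%N; rewrite z0 subr0.
  by have [-> _] := hu n; rewrite ltxx.
have [j Sz] := S_cover z0; have [e [e0 he]] := S_open Sz.
have e2 : 0 < e / 2 by rewrite divr_gt0.
have [N hN] := mesh_small e2; have [n nN hn] := hz _ e2 N.
have [_ /(_ j) [w' [h1 h2]]] := hu n; apply: h2; apply: he.
have h3 := hN n nN; have := cdist_triangle (u n) w' z; lra.
Qed.

(** The distance to the complement of the cone, as a weight that is Lipschitz and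
    positive exactly on the open cone. *)
Definition cdepth j (w : C) : R := inf [set normc (w - v) | v in [set v | ~ S j v]].

Lemma cdepth_le j w v : ~ S j v -> cdepth j w <= normc (w - v).
Proof.
move=> hv; apply: ge_inf; last by exists v.
by exists 0 => _ [u _ <-]; exact: cnorm_ge0.
Qed.

Lemma cdepth_ge j w c : (forall v, ~ S j v -> c <= normc (w - v)) -> c <= cdepth j w.
Proof.
move=> h; apply: lb_le_inf; first by exists (normc (w - 0)), 0 => //; exact: S0.
by move=> _ [v hv <-]; exact: h.
Qed.

Lemma cdepth_le_norm j w : cdepth j w <= normc w.
Proof. by rewrite -{2}[w]subr0; apply: cdepth_le; exact: S0. Qed.

Lemma cdepth_lip j w w' : cdepth j w - cdepth j w' <= normc (w - w').
Proof.
rewrite lerBlDr -lerBlDl; apply: cdepth_ge => v hv; have := cdepth_le w hv.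
have := cdist_triangle w' w v; lra.
Qed.

Lemma cdepth_S j w w' : normc (w' - w) < cdepth j w -> S j w'.
Proof.
move=> h; apply: contrapT => nS; have := cdepth_le w nS.
by rewrite cdistC leNgt h.
Qed.

Variable de : R.
Hypotheses (de0 : 0 < de) (de1 : de <= 1).
Hypothesis leb : forall w : C, w != 0 ->
  exists j, forall w', normc (w' - w) < de * normc w -> S j w'.

(** Lowering the distance by [de / 2 * |w|] shrinks the support so that it keeps
    a distance to the boundary proportional to [|w|]. *)
Definition tent j (w : C) : R := Num.max 0 (cdepth j w - de / 2 * normc w).

Lemma tent_ge0 j w : 0 <= tent j w.
Proof. by rewrite le_max lexx. Qed.

Lemma tent_lip j w w' : `|tent j w - tent j w'| <= 2 * normc (w - w').
Proof.
have h1 := cdepth_lip j w w'; have h2 := cdepth_lip j w' w; rewrite (cdistC w') in h2.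
have n1 := cnorm_sub w w'; have n2 := cnorm_sub w' w; rewrite (cdistC w') in n2.
have [d0 d1] := (de0, de1).
have : de / 2 * (normc w - normc w') <= de / 2 * normc (w - w') by rewrite ler_wpM2l // divr_ge0 // ltW.
have : de / 2 * (normc w' - normc w) <= de / 2 * normc (w - w') by rewrite ler_wpM2l // divr_ge0 // ltW.
have : de / 2 * normc (w - w') <= 1 * normc (w - w') by rewrite ler_wpM2r ?cnorm_ge0 //; lra.
have n0 := cnorm_ge0 (w - w').
move=> k1 k2 k3; rewrite ler_norml /tent.
case: (leP 0 (cdepth j w - de / 2 * normc w)); case: (leP 0 (cdepth j w' - de / 2 * normc w')) => p q;
  apply/andP; split; lra.
Qed.

Lemma tent_S j w : 0 < tent j w -> de / 2 * normc w < cdepth j w.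
Proof. by rewrite lt_max ltxx /= subr_gt0. Qed.

Definition tents w := \sum_j tent j w.

Lemma tents_ge w : de / 2 * normc w <= tents w.
Proof.
have [->|w0] := eqVneq w 0; first by rewrite cnorm0 mulr0; apply: sumr_ge0 => j _; exact: tent_ge0.
have [j hj] := leb w0.
apply: le_trans (_ : tent j w <= _); last first.
  by rewrite /tents (bigD1 j) //= lerDl; apply: sumr_ge0 => i _; exact: tent_ge0.
have h : de * normc w <= cdepth j w.
  by apply: cdepth_ge => v hv; rewrite leNgt; apply/negP => k; apply: hv; apply: hj; rewrite cdistC.
rewrite le_max; apply/orP; right; lra.
Qed.

Lemma tent_le j w : tent j w <= tents w.
Proof. by rewrite /tents (bigD1 j) //= lerDl; apply: sumr_ge0 => i _; exact: tent_ge0. Qed.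

Lemma tents_lip w w' : `|tents w - tents w'| <= #|I|%:R * (2 * normc (w - w')).
Proof.
rewrite /tents -sumrB; apply: le_trans (ler_norm_sum _ _ _) _.
apply: le_trans (ler_sum _ (fun j _ => tent_lip j w w')) _.
by rewrite sumr_const -[leLHS]mulr_natl.
Qed.

Definition cutoff j (w : C) : C := (tent j w / tents w)%:C.
Definition cutoff_lip := (2 + #|I|%:R * 2) * (2 / de).

Lemma tents_gt0 w : w != 0 -> 0 < tents w.
Proof.
move=> w0; apply: lt_le_trans (tents_ge w); rewrite mulr_gt0 ?divr_gt0 //.
by rewrite cnorm_gt0.
Qed.

Lemma cutoff_sum w : w != 0 -> \sum_j cutoff j w = 1.
Proof.
move=> w0; rewrite /cutoff.
have h (s : seq I) : \sum_(j <- s) ((tent j w / tents w)%:C : C) = (\sum_(j <- s) tent j w / tents w)%:C.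
  elim: s => [|j s IH]; first by rewrite !big_nil.
  by rewrite !big_cons IH rcD.
by rewrite h -mulr_suml -/(tents w) mulfV // gt_eqF // tents_gt0.
Qed.

Lemma cutoff_ratio j w : 0 <= tent j w / tents w <= 1.
Proof.
have t0 : 0 <= tents w by apply: le_trans (tents_ge w); rewrite mulr_ge0 ?cnorm_ge0 ?divr_ge0 ?ltW.
rewrite divr_ge0 ?tent_ge0 //=; have [->|n0] := eqVneq (tents w) 0; first by rewrite invr0 mulr0.
have tp : 0 < tents w by rewrite lt_neqAle eq_sym n0.
by rewrite ler_pdivrMr // mul1r tent_le.
Qed.

Lemma cutoff_le1 j w : normc (cutoff j w) <= 1.
Proof. by have /andP[h1 h2] := cutoff_ratio j w; rewrite cnorm_real ger0_norm. Qed.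

Lemma cutoff_lipschitz j w w' : w != 0 ->
  normc (cutoff j w - cutoff j w') <= cutoff_lip / normc w * normc (w - w').
Proof.
move=> w0; have wp : 0 < normc w by rewrite cnorm_gt0.
have tp := tents_gt0 w0; have tg := tents_ge w.
have /andP[q0 q1] := cutoff_ratio j w'.
have te : tent j w' = tent j w' / tents w' * tents w'.
  have [t0|t0] := eqVneq (tents w') 0; last by rewrite divfK.
  by have := tent_le j w'; have := tent_ge0 j w'; rewrite t0 mulr0 => h1 h2; apply/eqP; rewrite eq_le h1 h2.
set q := tent j w' / tents w' in q0 q1 te.
have e : tent j w / tents w - q =
    ((tent j w - tent j w') - q * (tents w - tents w')) / tents w.
  by rewrite te; field; rewrite gt_eqF.
rewrite /cutoff -rcB cnorm_real -/q e normrM [`|(tents w)^-1|]gtr0_norm ?invr_gt0 //.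
set n := normc (w - w'); have n0 : 0 <= n := cnorm_ge0 _.
have h1 : `|tent j w - tent j w' - q * (tents w - tents w')| <= (2 + #|I|%:R * 2) * n.
  apply: le_trans (ler_normB _ _) _; rewrite mulrDl; apply: lerD; first exact: tent_lip.
  rewrite normrM (ger0_norm q0); apply: le_trans (_ : 1 * (#|I|%:R * (2 * n)) <= _).
    by apply: ler_pM => //; exact: tents_lip.
  by rewrite mul1r mulrA.
have X0 : 0 <= (2 + #|I|%:R * 2) * n.
  by apply: mulr_ge0 => //; apply: addr_ge0 => //; exact: mulr_ge0.
have d2 : 0 < de / 2 * normc w by rewrite mulr_gt0 // divr_gt0.
apply: le_trans (_ : (2 + #|I|%:R * 2) * n * (de / 2 * normc w)^-1 <= _).
  by apply: ler_pM => //; rewrite ?invr_ge0 ?(ltW tp) // lef_pV2 ?posrE.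
rewrite le_eqVlt; apply/orP; left; apply/eqP; rewrite /cutoff_lip; field.
by rewrite !gt_eqF.
Qed.

(** The open sets on which the functions are glued, shrunk so that a whole disc
    around each of their points stays in the cone. *)
Definition deep j t := 0 < normc t /\ forall w, normc (w - t) < de / 4 * normc t -> S j w.

Lemma cutoff_deep j t t' : cutoff j t != 0 -> normc (t' - t) < de / 8 * normc t -> deep j t'.
Proof.
move=> c0 h; have [d0 d1] := (de0, de1).
have tp : 0 < tent j t.
  rewrite lt_neqAle tent_ge0 andbT eq_sym; apply: contraNneq c0 => e.
  by rewrite /cutoff e mul0r.
have dt := tent_S tp; have n0 := cnorm_ge0 t.
have n1 := cnorm_sub t t'; have n2 := cnorm_sub t' t; rewrite (cdistC t) in n1.
have d8 : de * normc t <= 1 * normc t by rewrite ler_wpM2r.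
have np : 0 < normc t.
  rewrite lt_neqAle n0 andbT eq_sym; apply: contraTneq h => ->.
  by rewrite mulr0 -leNgt cnorm_ge0.
split; first by lra.
move=> w hw; apply: (@cdepth_S j t); apply: le_lt_trans dt.
have := cdist_triangle t' w t.
have : de / 4 * normc t' <= de / 4 * (9 / 8 * normc t).
  by rewrite ler_pM2l ?divr_gt0 //; lra.
have : 0 < de * normc t by rewrite mulr_gt0.
lra.
Qed.

Lemma deepS j t : deep j t -> S j t.
Proof. by move=> [t0 h]; apply: h; rewrite subrr cnorm0 mulr_gt0 // divr_gt0. Qed.

End Partition.

Section Cones.
Variable R : realType.
Local Notation C := (CC R).

Definition cone (a b : R) (w : C) := w <> 0 /\ exists theta, a < theta < b /\ is_arg w theta.

Lemma cone0 a b : ~ cone a b 0. Proof. by case. Qed.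

Lemma cone_scale a b (c : R) (w : C) : 0 < c -> cone a b w -> cone a b (c%:C * w).
Proof.
move=> c0 [w0 [th [hth e]]]; split.
  by move/eqP; rewrite mulf_eq0 rc_eq0 gt_eqF //= => /eqP.
exists th; split => //; rewrite /is_arg cnormM cnorm_real gtr0_norm // {1}e.
by rewrite -mulrA -mulrA; congr Complex; ring.
Qed.

Lemma atan_small (e : R) : 0 < e -> exists d, 0 < d /\ forall x : R, `|x| < d -> `|atan x| < e.
Proof.
move=> e0; have /cvgr_dist_lt/(_ e e0) /nbhs_ballP [d /= d0 h] := @continuous_atan R 0.
exists d; split => // x hx; have := h x; rewrite /ball /= sub0r normrN => /(_ hx).
by rewrite atan0 sub0r normrN.
Qed.

Lemma right_half_arg (u : C) : 0 < complex.Re u -> is_arg u (atan (complex.Im u / complex.Re u)).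
Proof.
case: u => x y /= x0; rewrite /is_arg.
have s0 : 0 < 1 + (y / x) ^+ 2 by rewrite ltr_pwDl // sqr_ge0.
have -> : normc (x +i* y : C) = x * Num.sqrt (1 + (y / x) ^+ 2).
  rewrite /= (_ : x ^+ 2 + y ^+ 2 = x ^+ 2 * (1 + (y / x) ^+ 2)).
    by rewrite sqrtrM ?sqr_ge0 // sqrtr_sqr gtr0_norm.
  by field; rewrite gt_eqF.
have q0 : 0 < Num.sqrt (1 + (y / x) ^+ 2) by rewrite sqrtr_gt0.
have cE := cos_atan (y / x).
have -> : sin (atan (y / x)) = y / x * cos (atan (y / x)).
  by rewrite -{2}[y / x]atanK /tan divfK // cE invr_eq0 gt_eqF.
rewrite cE.
by congr Complex; field; rewrite !gt_eqF.
Qed.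

(** The quotient of two nearby points has positive real part, and its argument
    is a small arctangent. *)
Lemma cone_open a b (w : C) : cone a b w ->
  exists e, 0 < e /\ forall w', normc (w' - w) < e -> cone a b w'.
Proof.
move=> [w0 [th [/andP[h1 h2] e]]].
have wn : w != 0 by exact/eqP.
have wp : 0 < normc w by rewrite cnorm_gt0.
have m0 : 0 < Num.min (th - a) (b - th) by rewrite lt_min !subr_gt0 h1 h2.
have [d [d0 hd]] := atan_small m0.
pose eta := Num.min (1 / 2) (d / 2).
have eta0 : 0 < eta by rewrite lt_min !divr_gt0.
exists (eta * normc w); split; first by rewrite mulr_gt0.
move=> w' hw'; pose u := w' / w.
have wE : w' = u * w by rewrite /u divfK.
have : normc (u - 1) < eta.
  rewrite -(ltr_pM2r wp) -cnormM mulrBl mul1r -wE //.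
rewrite lt_min => /andP[u1 u2].
have hRe : `|complex.Re u - 1| < 1 / 2.
  by apply: le_lt_trans u1; rewrite -[X in _ - X]/(complex.Re (1 : C)) -ReB Re_le_cnorm.
have hIm : `|complex.Im u| < d / 2.
  apply: le_lt_trans u2; have := Im_le_cnorm (u - 1).
  by rewrite ImB [complex.Im 1]/= subr0.
have Re1 : 1 / 2 < complex.Re u by move: hRe; rewrite ltr_norml => /andP[]; lra.
have Re0 : 0 < complex.Re u by lra.
have hu := right_half_arg Re0.
have hq : `|complex.Im u / complex.Re u| < d.
  rewrite normrM normfV (gtr0_norm Re0) ltr_pdivrMr //; nra.
have := hd _ hq; rewrite lt_min ltr_norml !ltr_norml => /andP[/andP[k1 k2] /andP[k3 k4]].
set phi := atan _ in hu k1 k2 k3 k4.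
split.
  move/eqP; rewrite wE mulf_eq0 (negPf wn) orbF => /eqP u0.
  by move: Re0; rewrite u0 ltxx.
exists (phi + th); split; first by apply/andP; split; lra.
rewrite /is_arg cosD sinD wE cnormM {1}hu {1}e.
rewrite -[LHS]/((normc u * cos phi * (normc w * cos th) - normc u * sin phi * (normc w * sin th))
  +i* (normc u * cos phi * (normc w * sin th) + normc u * sin phi * (normc w * cos th))).
by congr Complex; ring.
Qed.

End Cones.

(** * The common expansion *)

Lemma diff_sum (R : realType) (V : normedModType (CC R)) (I : Type) (r : seq I)
    (F : I -> V -> CC R) x :
  (forall i, differentiable (F i) x) -> differentiable (fun y => \sum_(i <- r) F i y) x.
Proof.
move=> hF; elim: r => [|i r IH].
  have -> : (fun y => \sum_(i <- [::]) F i y) = fun=> 0 by apply/funext => y; rewrite big_nil.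
  exact: differentiable_cst.
have -> : (fun y => \sum_(j <- i :: r) F j y) = (fun y => F i y + \sum_(j <- r) F j y).
  by apply/funext => y; rewrite big_cons.
exact: (differentiableD (hF i) IH).
Qed.

Section Assembly.
Variables (R : realType) (V : normedModType (CC R)) (I : finType).
Local Notation C := (CC R).
Implicit Types (x y : V) (t z w : C) (j : I).
Variables (P : V -> C) (rP MP : R) (S : I -> C -> Prop) (f : I -> V -> C) (Bf Md gam s de : R).
Hypotheses (rP0 : 0 < rP) (hP : ball_hol P 0 rP MP) (P00 : P 0 = 0)
  (Pn0 : ~ (\forall x \near (0 : V), P x = 0)).
Hypotheses (Bf0 : 0 <= Bf) (Md0 : 0 <= Md) (gam0 : 0 < gam) (s0 : 0 < s)
  (de0 : 0 < de) (de1 : de <= 1).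
Hypothesis S0 : forall j, ~ S j 0.
Hypothesis leb : forall w : C, w != 0 ->
  exists j, forall w', normc (w' - w) < de * normc w -> S j w'.
Hypothesis hf : forall j y, nrm y < rP -> S j (P y) -> differentiable (f j) y /\ normc (f j y) <= Bf.
Hypothesis hd : forall i j y, nrm y < rP -> S i (P y) -> S j (P y) ->
  normc (f i y - f j y) <= Md * expR (- (gam / normc (P y) `^ s^-1)).

Local Notation chi := (cutoff S de).
Local Notation dl := (de / 4).
Local Notation G n := (Gamma (s * n%:R + 1)).

Lemma chi_supp w : w != 0 -> exists j, chi j w != 0.
Proof.
move=> w0; apply: contrapT => h; have := cutoff_sum S0 de0 leb w0.
rewrite big1 => [/esym/eqP|j _]; first by rewrite oner_eq0.
by apply/eqP/negPn/negP => c; apply: h; exists j.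
Qed.

Lemma P_lip x : nrm x < rP / 2 -> normc (P x) <= lip_const MP rP * nrm x.
Proof.
move=> hx; have h0 : nrm (0 : V) < rP / 2 by rewrite nrm0 divr_gt0.
by have := lip_ball_global rP0 hP hx h0; rewrite P00 !subr0.
Qed.

Lemma lip_const_ge0 : 0 <= lip_const MP rP.
Proof.
have M0 := ball_hol_ge0 rP0 hP.
rewrite /lip_const divr_ge0 ?divr_ge0 ?(ltW rP0) //.
by rewrite mulr_ge0 // addr_ge0 // mulr_ge0 // ltW // K0_gt0.
Qed.

Section FirstLine.
Variables (v : V) (r0 T : R).
Hypotheses (r00 : 0 < r0) (T0 : 0 < T) (T1 : T <= 1).
Hypothesis in_ball : forall x z, nrm x < r0 -> normc z < 4 -> nrm (z *: v + x) < rP / 2.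
Hypothesis ring_low : forall x z, nrm x < r0 -> 1 / 16 <= normc z -> normc z < 4 ->
  4 * T <= normc (P (z *: v + x)).

Lemma dl0 : 0 < dl. Proof. by rewrite divr_gt0. Qed.
Lemma dl1 : dl <= 1. Proof. have := de1; lra. Qed.

Local Notation Lv := (line_slope v rP MP).
Lemma Lv0 : 0 < Lv. Proof. exact: (Lv_gt0 v rP0 hP). Qed.

Definition bound_const := 18 * (8 * Lv / dl + 1) * (32 * Lv / dl) * 4 / normc (c0 R).

Lemma bound_const_ge0 : 0 <= bound_const.
Proof.
have l0 := ltW Lv0; have d0 := ltW dl0.
have h1 : 0 <= 8 * Lv / dl by apply: divr_ge0 d0; exact: mulr_ge0.
have h2 : 0 <= 32 * Lv / dl by apply: divr_ge0 d0; exact: mulr_ge0.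
apply: divr_ge0 (cnorm_ge0 _); apply: mulr_ge0 => //; apply: mulr_ge0 h2.
by apply: mulr_ge0 => //; exact: addr_ge0.
Qed.

Lemma lift_boundE Qg t : 0 <= Qg -> 0 < normc t -> normc t <= 1 ->
  normc t ^+ 2 * lift_bound v rP MP dl Qg t <= bound_const * normc (c0 R) * Qg.
Proof.
move=> Q0 t0 t1; have l0 := Lv0; have d0 := dl0.
have c0' : 0 < normc (c0 R) by rewrite cnorm_gt0 c0_neq0.
have -> : normc t ^+ 2 * lift_bound v rP MP dl Qg t =
   (8 * Lv / dl + normc t) * (18 * (32 * Lv / dl) * 4 * Qg).
  by rewrite /lift_bound /opening; field; rewrite !gt_eqF.
have -> : bound_const * normc (c0 R) * Qg = (8 * Lv / dl + 1) * (18 * (32 * Lv / dl) * 4 * Qg).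
  by rewrite /bound_const divfK ?gt_eqF //; ring.
apply: ler_wpM2r; last by rewrite lerD2l.
have h2 : 0 <= 32 * Lv / dl by apply: divr_ge0 (ltW d0); exact: mulr_ge0 (ler0n _ _) (ltW l0).
by apply: mulr_ge0 => //; apply: mulr_ge0 => //; exact: mulr_ge0.
Qed.

Lemma lift_in_t (S' : C -> Prop) (g : V -> C) Qg x t :
  (forall y, nrm y < rP / 2 -> S' (P y) -> differentiable g y) -> 0 <= Qg ->
  (forall y, nrm y < rP / 2 -> normc (P y - t) < dl * normc t -> normc (g y) <= Qg) ->
  nrm x < r0 -> tame T dl S' t -> normc t < T ->
  cdiff (lift P v dl g x) t /\ normc (t ^+ 2 * lift P v dl g x t) <= bound_const * Qg.
Proof.
move=> hg Q0 gQ hx tm tT; have [t0 _ _] := tm; have d0 := dl0.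
have at0 : 0 < dl * normc t / 64 by rewrite divr_gt0 // mulr_gt0.
have r'0 : 0 < Num.min (dl * normc t / 64) (T - normc t) by rewrite lt_min at0 subr_gt0.
have c0' : 0 < normc (c0 R) by rewrite cnorm_gt0 c0_neq0.
have H := @lift_hol R V P v rP MP r0 T dl rP0 T0 dl0 dl1 hP in_ball ring_low S' g hg
  (CC R) (fun=> x) (fun u => u) t _ Qg r'0 Q0 tm gQ _.
have {}H : ball_hol (fun u => c0 R * lift P v dl g x u) t
    (Num.min (dl * normc t / 64) (T - normc t)) (lift_bound v rP MP dl Qg t).
  apply: H => u; rewrite nrmC lt_min => /andP[u1 u2]; split => //.
  - by have := cnorm_sub u t; lra.
  - by rewrite /close subrr nrm0 mulr0 add0r; exact: ltW.
have tt : nrm (t - t) < Num.min (dl * normc t / 64) (T - normc t) by rewrite subrr nrm0.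
have [h1 h2] := H t tt.
split.
  have -> : lift P v dl g x = fun u => (c0 R)^-1 * (c0 R * lift P v dl g x u).
    by apply/funext => u; rewrite mulKf ?c0_neq0.
  exact: (cdiffM (cdiff_cst _ _) h1).
have t1 : normc t <= 1 by have := T1; lra.
rewrite -(ler_pM2l c0') cnormM cnormX mulrCA -cnormM.
apply: le_trans (ler_wpM2l _ h2) _; first by rewrite exprn_ge0 // cnorm_ge0.
by apply: le_trans (lift_boundE Q0 t0 t1) _; rewrite le_eqVlt; apply/orP; left; apply/eqP; ring.
Qed.

(** [t ^+ 2] compensates the growth of the lift at [t = 0]. *)
Definition lifted x j t := t ^+ 2 * lift P v dl (f j) x t.
Local Notation O := (deep S de).

Lemma deep_tame j t : O j t -> normc t <= T -> tame T dl (S j) t.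
Proof. by move=> [h1 h2] h3; split. Qed.

Lemma near_rP y : nrm y < rP / 2 -> nrm y < rP.
Proof. have := rP0; lra. Qed.

Definition lifted_bound := bound_const * Bf.
Lemma lifted_bound_ge0 : 0 <= lifted_bound. Proof. exact: mulr_ge0 bound_const_ge0 Bf0. Qed.

Lemma lifted_spec x j t : nrm x < r0 -> O j t -> 0 < normc t < T ->
  cdiff (lifted x j) t /\ normc (lifted x j t) <= lifted_bound.
Proof.
move=> hx Ot /andP[t0 tT].
have [||h1 h2] := @lift_in_t (S j) (f j) Bf x t _ Bf0 _ hx (deep_tame Ot (ltW tT)) tT.
- by move=> y /near_rP hy Sy; have [] := hf hy Sy.
- by move=> y /near_rP hy hyt; have [] // := hf (j := j) hy _; case: Ot => _; apply.
split => //; exact: (cdiffM (cdiffX 2 (cdiff_id t)) h1).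
Qed.

Variables (Kg Ag : R).
Hypotheses (Kg0 : 0 < Kg) (Ag0 : 0 < Ag).
Hypothesis flat : forall n e, 0 < e ->
  expR (- (gam / e `^ s^-1)) <= Kg * Ag ^+ n * G n * e ^+ (n + 6).

Definition gap n := bound_const * Md * Kg * 2 ^+ 6 * (2 * Ag) ^+ n * G n.

Lemma G_gt0 n : 0 < G n.
Proof. by apply: lt_le_trans (Gamma_lower_cst n s0); exact: expR_gt0. Qed.

Lemma gap_ge0 n : 0 <= gap n.
Proof.
have h1 := bound_const_ge0; have h2 := ltW (G_gt0 n).
apply: mulr_ge0 => //; apply: mulr_ge0; last by rewrite exprn_ge0 // mulr_ge0 // ltW.
by apply: mulr_ge0 (exprn_ge0 _ (ler0n _ _)); apply: mulr_ge0 (ltW Kg0); exact: mulr_ge0.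
Qed.

Lemma expR_powR_mono (a b : R) : 0 < a -> a <= b ->
  expR (- (gam / a `^ s^-1)) <= expR (- (gam / b `^ s^-1)).
Proof.
move=> a0 ab; have b0 : 0 < b by apply: lt_le_trans ab.
rewrite ler_expR lerN2 ler_pM2l // lef_pV2 ?posrE ?powR_gt0 //.
by apply: ge0_ler_powR => //; rewrite ?nnegrE ?invr_ge0; exact: ltW.
Qed.

Lemma lifted_apart x n : nrm x < r0 -> apart (lifted x) O T n.+4.+2 (gap n).
Proof.
move=> hx i j t Oi Oj /andP[t0 tT]; have d0 := dl0; have d1 := dl1.
pose Q := Md * expR (- (gam / (2 * normc t) `^ s^-1)).
have Q0 : 0 <= Q by rewrite mulr_ge0 // expR_ge0.
have ti := deep_tame Oi (ltW tT); have tj := deep_tame Oj (ltW tT).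
have SP k y : O k t -> normc (P y - t) < dl * normc t -> S k (P y).
  by move=> [_ h] hy; exact: h.
have bd k y : O k t -> nrm y < rP / 2 -> normc (P y - t) < dl * normc t -> normc (f k y) <= Bf.
  by move=> Ok /near_rP hy hyt; have [] // := hf (j := k) hy _; exact: SP.
have tm : tame T dl (fun w => S i w /\ S j w) t.
  by case: ti => h1 h2 h3; case: tj => _ _ h4; split => // w hw; split; [exact: h3|exact: h4].
have [||_ h] := @lift_in_t _ (fun y => f i y - f j y) Q x t _ Q0 _ hx tm tT.
- move=> y /near_rP hy [Si Sj]; have [h1 _] := hf hy Si; have [h2 _] := hf hy Sj.
  exact: (differentiableB h1 h2).
- move=> y /near_rP hy hyt; have Si := SP i y Oi hyt; have Sj := SP j y Oj hyt.
  apply: le_trans (hd hy Si Sj) _; apply: ler_wpM2l => //; apply: expR_powR_mono.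
    rewrite cnorm_gt0; apply/eqP => Py; apply: (@S0 i); by rewrite -Py.
  have := cnorm_sub (P y) t; have : dl * normc t <= 1 * normc t by rewrite ler_wpM2r // ltW.
  lra.
rewrite /lifted -mulrBr -(lift_sub rP0 T0 d0 d1 hP in_ball ring_low hx ti tj Bf0 Bf0); last 2 first.
- by move=> y; exact: bd.
- by move=> y; exact: bd.
apply: le_trans h _; have t2 : 0 < 2 * normc t by rewrite mulr_gt0.
apply: le_trans (ler_wpM2l bound_const_ge0 (ler_wpM2l Md0 (flat n t2))) _.
rewrite le_eqVlt; apply/orP; left; apply/eqP; rewrite /gap.
have -> : n.+4.+2 = (n + 6)%N by rewrite addnC.
by rewrite !exprD !exprMn; ring.
Qed.

Local Notation Cc := (cutoff_lip I de).
Local Notation dr := (de / 8).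

Lemma Cc0 : 0 <= Cc.
Proof.
rewrite /cutoff_lip; apply: mulr_ge0; last by rewrite divr_ge0 // ltW.
by apply: addr_ge0 => //; exact: mulr_ge0.
Qed.
Lemma dr0 : 0 < dr. Proof. by rewrite divr_gt0. Qed.
Lemma dr1 : dr <= 1. Proof. have := de1; lra. Qed.

Let F_hol x (hx : nrm x < r0) k z : O k z -> 0 < normc z < T -> cdiff (lifted x k) z.
Proof. by move=> h1 h2; have [] := lifted_spec hx h1 h2. Qed.
Let F_le x (hx : nrm x < r0) k z : O k z -> 0 < normc z < T -> normc (lifted x k z) <= lifted_bound.
Proof. by move=> h1 h2; have [] := lifted_spec hx h1 h2. Qed.
Let chi_lip k z w : z != 0 -> normc (chi k z - chi k w) <= Cc / normc z * normc (z - w).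
Proof. exact: (cutoff_lipschitz S0 de0 de1 leb). Qed.
Let chi_O k z w : chi k z != 0 -> normc (w - z) < dr * normc z -> O k w.
Proof. exact: (cutoff_deep de0 de1). Qed.
Let chi_sum z : z != 0 -> \sum_k chi k z = 1.
Proof. exact: (cutoff_sum S0 de0 leb). Qed.
Let chi_le1 k z : normc (chi k z) <= 1.
Proof. exact: (cutoff_le1 S0 de0 leb). Qed.

Definition acoef k x := coef chi (lifted x) T k.
Definition coef_const n := expansion_const I dr Cc * (16 / T) ^+ n.+4.+2 * (lifted_bound + gap n).

Lemma T16 : 1 <= 16 / T.
Proof. rewrite ler_pdivlMr // mul1r; have := T1; lra. Qed.

Lemma expansion_const_ge0 : 0 <= expansion_const I dr Cc.
Proof.
rewrite /expansion_const; apply: addr_ge0; last exact: (rate_ge0 I Cc0).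
apply: addr_ge0; last exact: (shell_const_ge0 I dr0 Cc0).
by apply: mulr_ge0 => //; apply: mulr_ge0 => //; exact: ltW (K0_gt0 R).
Qed.

Lemma coef_const_ge n k : (k <= n.+4.+2)%N ->
  expansion_const I dr Cc * (16 / T) ^+ k * (lifted_bound + gap n) <= coef_const n.
Proof.
move=> kn; apply: ler_wpM2r; first exact: addr_ge0 lifted_bound_ge0 (gap_ge0 n).
by apply: ler_wpM2l expansion_const_ge0 _ _ _; apply: ler_weXn2l => //; exact: T16.
Qed.

Lemma coef_const_ge0 n : 0 <= coef_const n.
Proof.
apply: mulr_ge0; last exact: addr_ge0 lifted_bound_ge0 (gap_ge0 n).
apply: mulr_ge0 expansion_const_ge0 _; apply: exprn_ge0; have := T16; lra.
Qed.

Lemma lifted_apart_le x n k : nrm x < r0 -> (k <= n.+4.+2)%N -> apart (lifted x) O T k (gap n).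
Proof.
move=> hx kn i j z Oi Oj zT; apply: le_trans (lifted_apart n hx Oi Oj zT) _; case/andP: zT => z0 z1.
by apply: ler_wpM2l (gap_ge0 n) _ _ _; apply: ler_wiXn2l => //; rewrite ?ltW //; have := T1; lra.
Qed.

Lemma acoef_le n k x : nrm x < r0 -> (k < n.+4.+2)%N -> normc (acoef k x) <= coef_const n.
Proof.
move=> hx kn; apply: le_trans (coef_const_ge kn).
exact: (coef_bound T0 T1 dr0 dr1 Cc0 lifted_bound_ge0 chi_sum chi_le1 chi_lip chi_O (F_hol hx) (F_le hx)
  (gap_ge0 n) (lifted_apart_le hx kn)).
Qed.

(** The expansion in [t], taken at [t = P x], where the lift is [f j x]. *)
Lemma f_expansion n j x : nrm x < r0 -> P x != 0 -> normc (P x) <= T / 8 -> chi j (P x) != 0 ->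
  normc (P x ^+ 2 * f j x - \sum_(k < n.+4) P x ^+ k * acoef k x) <= coef_const n * normc (P x) ^+ n.+2.
Proof.
move=> hx Px PT cj; have tp : 0 < normc (P x) by rewrite cnorm_gt0.
have dj : O j (P x).
  by apply: (chi_O cj); rewrite subrr cnorm0 mulr_gt0 // divr_gt0.
have PT' : normc (P x) <= T by have := T0; lra.
have e := glue_expansion T0 T1 dr0 dr1 Cc0 lifted_bound_ge0 chi_sum chi_le1 chi_lip chi_O (F_hol hx) (F_le hx)
  tp PT cj (gap_ge0 n) (lifted_apart n hx).
have hg y : nrm y < rP / 2 -> S j (P y) -> differentiable (f j) y.
  by move=> /near_rP hy Sy; have [] := hf hy Sy.
rewrite /lifted (lift_diag rP0 T0 dl0 dl1 hP in_ball ring_low hg hx (deep_tame dj PT')) in e.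
apply: le_trans e _; apply: ler_wpM2r; first by rewrite exprn_ge0 // cnorm_ge0.
by apply: coef_const_ge; exact: (leq_trans (leqnSn _) (leqnSn _)).
Qed.

Lemma lt_index2 n : (n.+2 < n.+4.+2)%N.
Proof. by rewrite !ltnS -addn3 leq_addr. Qed.
Lemma lt_index3 n : (n.+3 < n.+4.+2)%N.
Proof. by rewrite !ltnS -addn2 leq_addr. Qed.

(** The coefficients are limits of integrals of functions that are holomorphic in
    [x]. *)
Lemma acoef_hol k : ball_hol (acoef k) 0 r0 (coef_const k).
Proof.
have rt := @gcint_mono_le R I chi.
pose Bd := rate I Cc * (gap k * 10 ^+ k.+1) + K0 R * #|I|%:R * lifted_bound * (16 / T) ^+ k.+1.
suff H : ball_hol (acoef k) 0 r0 Bd.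
  move=> x hx; have [h _] := H x hx; split => //.
  by apply: acoef_le; [rewrite -[x]subr0|rewrite -(addn4 k) !ltnS -addnS leq_addr].
apply: (@clim_hol R V (fun m x => gcint chi (lifted x) T m (mono k)) 0 r0 Bd r00).
exists 0%N => m _ x; rewrite subr0 => hx; split; last first.
  apply: (gcint_mono_le T0 T1 dr0 dr1 Cc0 lifted_bound_ge0 chi_sum chi_le1 chi_lip chi_O (F_hol hx) (F_le hx)
    m (gap_ge0 k)).
  by apply: lifted_apart_le => //; rewrite -(addn4 k) -addn2 -addnA -addn1 leq_add2l.
have e0 := eps_gt0 T0 m; have e4 := eps_le T0 m; have t1 := T0.
set ep := eps T m in e0 e4 *.
pose Q := #|I|%:R * lifted_bound * (3 / 4 * ep)^-1 ^+ k.+1.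
have ep3 : 0 < 3 / 4 * ep by rewrite mulr_gt0.
have Q0 : 0 <= Q.
  apply: mulr_ge0; last by rewrite exprn_ge0 // invr_ge0 ltW.
  exact: mulr_ge0 (ler0n _ _) lifted_bound_ge0.
have GH : ball_hol (fun y => clim (gsum (bump 0 ep) (fun z => glue chi (lifted y) z * mono k z))) 0 r0
    (18 * ep^-1 * Q * (2 * ep) ^+ 2).
  apply: (@gsum_hol R V (bump 0 ep) ep^-1 0 (2 * ep) (fun y z => glue chi (lifted y) z * mono k z)) => //.
  - by rewrite mulr_gt0.
  - exact: bump_lip.
  - exact: bump_supp.
  exists (ep / 4); split; first by rewrite divr_gt0.
  move=> z; have [hz|hz] := pselect (on_ring 0 ep z); last first.
    by right; exact: bump_off_ring hz.
  left => y; rewrite subr0 => hy; move: hz => /andP[]; rewrite subr0 => z1 z2.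
  have zp : 0 < normc z by lra.
  have zT : 0 < normc z < T by apply/andP; split; lra.
  split; last first.
    rewrite cnormM; apply: ler_pM; rewrite ?cnorm_ge0 //; last exact: mono_le.
    exact: (glue_le dr0 lifted_bound_ge0 chi_le1 chi_O (F_le hy) zT).
  apply: (@differentiableM _ _ (fun y => glue chi (lifted y) z) (fun=> mono k z)); last exact: differentiable_cst.
  apply: (@diff_sum R V I _ (fun i y => chi i z * lifted y i z)) => j.
  have [c0'|cj] := eqVneq (chi j z) 0.
    have -> : (fun y => chi j z * lifted y j z) = fun=> 0 by apply/funext => u; rewrite c0' mul0r.
    exact: differentiable_cst.
  have dj : O j z by apply: (chi_O cj); rewrite subrr cnorm0 mulr_gt0 // divr_gt0.
  have at0 : 0 < dl * normc z / 64 by rewrite divr_gt0 // mulr_gt0 // divr_gt0.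
  have LP0 := lip_const_ge0; have LP1 : 0 < lip_const MP rP + 1 by lra.
  have r'0 : 0 < Num.min (r0 - nrm y) (dl * normc z / 64 / (lip_const MP rP + 1)).
    by rewrite lt_min subr_gt0 hy divr_gt0.
  have hg u : nrm u < rP / 2 -> S j (P u) -> differentiable (f j) u.
    by move=> /near_rP hu Su; have [] := hf hu Su.
  have gQ u : nrm u < rP / 2 -> normc (P u - z) < opening dl z -> normc (f j u) <= Bf.
    by move=> /near_rP hu huz; have [] // := hf (j := j) hu _; case: dj => _; apply.
  have zT' : normc z <= T by lra.
  have H := @lift_hol R V P v rP MP r0 T dl rP0 T0 dl0 dl1 hP in_ball ring_low (S j) (f j) hg
    V (fun u => u) (fun=> z) y _ Bf r'0 Bf0 (deep_tame dj zT') gQ _.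
  have {}H : ball_hol (fun u => c0 R * lift P v dl (f j) u z) y
      (Num.min (r0 - nrm y) (dl * normc z / 64 / (lip_const MP rP + 1)))
      (lift_bound v rP MP dl Bf z).
    apply: H => u; rewrite lt_min (ltr_pdivlMr _ _ LP1) => /andP[u1 u2]; split => //.
    - by have := nrmD (u - y) y; rewrite subrK; lra.
    - rewrite /close subrr cnorm0 addr0 /param_slope /opening.
      have := nrm_ge0 (u - y); lra.
  have yy : nrm (y - y) < Num.min (r0 - nrm y) (dl * normc z / 64 / (lip_const MP rP + 1)).
    by rewrite subrr nrm0.
  have [dH _] := H y yy.
  have -> : (fun u => chi j z * lifted u j z) =
      (fun u => (chi j z * z ^+ 2 / c0 R) * (c0 R * lift P v dl (f j) u z)).
    by apply/funext => u; rewrite /lifted [RHS]mulrA divfK ?c0_neq0 // mulrA.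
  exact: (differentiableM (differentiable_cst _ _) dH).
have hx0 : nrm (x - 0) < r0 by rewrite subr0.
have [dG _] := GH x hx0.
have -> : (fun x => gcint chi (lifted x) T m (mono k)) =
    (fun y => clim (gsum (bump 0 ep) (fun z => glue chi (lifted y) z * mono k z)) * (c0 R)^-1) by [].
exact: (differentiableM dG (differentiable_cst _ _)).
Qed.


Section SecondLine.
Variables (v' : V) (r1 r0' T' : R).
Hypotheses (r10 : 0 < r1) (r1P : r1 <= rP) (r1r : r1 / 2 <= r0) (r00' : 0 < r0') (T0' : 0 < T').
Hypothesis in_ball' : forall x z, nrm x < r0' -> normc z < 4 -> nrm (z *: v' + x) < r1 / 2.
Hypothesis ring_low' : forall x z, nrm x < r0' -> 1 / 16 <= normc z -> normc z < 4 ->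
  4 * T' <= normc (P (z *: v' + x)).
Hypothesis P_small : forall y, nrm y < r1 / 2 -> normc (P y) <= T / 8.

Lemma near_r0 y : nrm y < r1 / 2 -> nrm y < r0. Proof. have := r1r; lra. Qed.

Lemma r0'_r1 x : nrm x < r0' -> nrm x < r1 / 2.
Proof.
move=> hx; have z4 : normc (0 : C) < 4 by rewrite cnorm0.
by have := in_ball' hx z4; rewrite scale0r add0r.
Qed.

(** The part of the expansion with negative powers of [P]: it is bounded off the zeros of
    [P] since the other terms of [f j] are. *)
Definition principal y := (P y ^+ 2)^-1 * (acoef 0 y + P y * acoef 1 y).
Definition principal_const := Bf + 3 * coef_const 0.

Lemma split_terms (p F pr u S' A B : C) : p ^+ 2 * pr = u ->
  p ^+ 2 * (F - pr - S') = (p ^+ 2 * F - (u + p ^+ 2 * S' + A + B)) + (A + B).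
Proof. by move=> <-; ring. Qed.

Lemma f_diff_principal n j x : nrm x < r1 / 2 -> P x != 0 -> chi j (P x) != 0 ->
  normc (f j x - principal x - \sum_(k < n) P x ^+ k * acoef k.+2 x) <=
  3 * coef_const n * normc (P x) ^+ n.
Proof.
move=> hx Px cj; have hx0 := near_r0 hx; have pp : 0 < normc (P x) by rewrite cnorm_gt0.
have e := f_expansion n hx0 Px (P_small hx) cj.
have p1 : normc (P x) <= 1 by have := P_small hx; have := T1; lra.
have p2 : 0 < normc (P x) ^+ 2 by rewrite exprn_gt0.
have a2 : normc (acoef n.+2 x) <= coef_const n by exact: acoef_le hx0 (lt_index2 n).
have a3 : normc (acoef n.+3 x) <= coef_const n by exact: acoef_le hx0 (lt_index3 n).
have X0 := coef_const_ge0 n.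
rewrite -(ler_pM2l p2) -{1}cnormX -cnormM.
set Z := \sum_(k < n.+4) _ in e.
have ZE : Z = acoef 0 x + P x * acoef 1 x + P x ^+ 2 * (\sum_(k < n) P x ^+ k * acoef k.+2 x) +
    P x ^+ n.+2 * acoef n.+2 x + P x ^+ n.+3 * acoef n.+3 x.
  rewrite /Z 2!big_ord_recr /= 2!big_ord_recl /= expr0 mul1r expr1 addrA; congr (_ + _ + _ + _).
  by rewrite mulr_sumr; apply: eq_bigr => k _; rewrite mulrA -exprD.
have -> : P x ^+ 2 * (f j x - principal x - \sum_(k < n) P x ^+ k * acoef k.+2 x) =
    (P x ^+ 2 * f j x - Z) + (P x ^+ n.+2 * acoef n.+2 x + P x ^+ n.+3 * acoef n.+3 x).
  rewrite ZE; apply: split_terms.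
  by rewrite /principal; apply: mulVKf; exact: expf_neq0.
apply: le_trans (cnormD _ _) _.
have nn : normc (P x) ^+ 2 * (3 * coef_const n * normc (P x) ^+ n) = 3 * (coef_const n * normc (P x) ^+ n.+2).
  by rewrite (exprS (normc (P x)) n.+1) (exprS (normc (P x)) n); ring.
have pn : 0 <= normc (P x) ^+ n.+2 by rewrite exprn_ge0 ?cnorm_ge0.
have h2 : normc (P x ^+ n.+2 * acoef n.+2 x) <= normc (P x) ^+ n.+2 * coef_const n.
  rewrite cnormM cnormX; exact: (ler_wpM2l pn a2).
have h3 : normc (P x ^+ n.+3 * acoef n.+3 x) <= normc (P x) ^+ n.+2 * coef_const n.
  rewrite cnormM cnormX.
  have p3 : normc (P x) ^+ n.+3 <= normc (P x) ^+ n.+2.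
    exact: (ler_wiXn2l (cnorm_ge0 _) p1 (leqnSn _)).
  exact: (ler_pM (exprn_ge0 _ (cnorm_ge0 _)) (cnorm_ge0 _) p3 a3).
have h4 := cnormD (P x ^+ n.+2 * acoef n.+2 x) (P x ^+ n.+3 * acoef n.+3 x).
rewrite nn; apply: le_trans (lerD e (le_trans h4 (lerD h2 h3))) _.
move: (coef_const n) (normc (P x) ^+ n.+2) => X p.
by rewrite le_eqVlt; apply/orP; left; apply/eqP; ring.
Qed.

Lemma chi_cone j y : chi j (P y) != 0 -> S j (P y).
Proof.
move=> cj; have [Py|Py] := eqVneq (P y) 0.
  by move: cj; rewrite Py /cutoff; rewrite (_ : tent S de j 0 = 0) ?mul0r ?eqxx //;
    apply/eqP; rewrite eq_le tent_ge0 andbT /tent ge_max lexx cnorm0 mulr0 subr0;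
    have := cdepth_le_norm S0 j 0; rewrite cnorm0.
apply: (deepS de0); apply: (chi_O cj).
by rewrite subrr cnorm0 mulr_gt0 ?dr0 // cnorm_gt0.
Qed.

Lemma principal_le y : nrm y < r1 / 2 -> normc (principal y) <= principal_const.
Proof.
move=> hy; have X0 := coef_const_ge0 0; have [Py|Py] := eqVneq (P y) 0.
  rewrite /principal Py expr2 mulr0 invr0 mul0r cnorm0 /principal_const.
  by have := Bf0; lra.
have [j cj] := chi_supp Py; have := f_diff_principal 0 hy Py cj.
rewrite big_ord0 subr0 expr0 mulr1 => h.
have hy' : nrm y < rP by have := r1P; have := r10; lra.
have [_ h2] := hf hy' (chi_cone cj).
have := cnorm_sub (principal y) (f j y); rewrite cdistC /principal_const; lra.
Qed.

(** The holomorphic function that continues the principal part. *)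
Definition regular x := cint (bump 0 1) (fun z => principal (z *: v' + x) / z).

Lemma diff_principal y : nrm y < r1 / 2 -> P y != 0 -> differentiable principal y.
Proof.
move=> hy Py; have yr : nrm (y - 0) < r0 by rewrite subr0; exact: near_r0.
have [d0' _] := acoef_hol 0 yr; have [d1' _] := acoef_hol 1 yr.
have yP : nrm (y - 0) < rP by rewrite subr0; have := r1P; have := r10; lra.
have [dP _] := hP yP.
apply: (@differentiableM _ _ (fun y => (P y ^+ 2)^-1) (fun y => acoef 0 y + P y * acoef 1 y)).
  apply: (@differentiableV _ _ (fun y => P y ^+ 2)); last by rewrite expf_neq0.
  exact: (differentiableM dP dP).
exact: (differentiableD d0' (differentiableM dP d1')).
Qed.

(** On the line through [x] the zeros of [P] are finitely many, and the principal
    part is bounded around them. *)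
Lemma regular_eq x : nrm x < r0' -> P x != 0 -> regular x = principal x.
Proof.
move=> hx Px; have [Z hZ] := line_zeros hP r10 r1P T0' in_ball' ring_low' hx Px.
have hl (z : C) : normc z < 3 * 1 -> normc z < 4 by lra.
have hh : hol_exc (fun z => principal (z *: v' + x)) 0 (3 * 1) Z.
  move=> z; rewrite subr0 => /hl hz; have hb := in_ball' hx hz.
  have [Pz|Pz] := eqVneq (P (z *: v' + x)) 0.
    right; split; first exact: hZ.
    exists (4 - normc z), principal_const; split; first by rewrite subr_gt0.
    move=> w hw; apply: principal_le; apply: in_ball' => //.
    by have := cnorm_sub w z; lra.
  by left; apply: cdiff_line; exact: diff_principal.
have d0' : cdiff (fun z => principal (z *: v' + x)) 0.
  by apply: cdiff_line; rewrite scale0r add0r; apply: diff_principal => //; exact: r0'_r1.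
have o1 : normc (0 - 0 : C) < 1 by rewrite subrr cnorm0.
have [_] := cauchy_bump ltr01 hh d0' o1; rewrite scale0r add0r => <-.
by rewrite /regular; congr (cint _ _); apply/funext => z; rewrite subr0.
Qed.

Definition regular_const := 18 * 1^-1 * (principal_const * (4 / 3)) * 2 ^+ 2 / normc (c0 R).

(** The integrand is only evaluated on the ring, where [P] does not vanish. *)
Lemma regular_hol : ball_hol regular 0 r0' regular_const.
Proof.
have X0 := coef_const_ge0 0; have B0 := Bf0.
have pc0 : 0 <= principal_const by rewrite /principal_const; lra.
have Q0 : 0 <= principal_const * (4 / 3) by rewrite mulr_ge0 // divr_ge0.
have H : ball_hol (fun x => clim (gsum (bump 0 1) (fun z => principal (z *: v' + x) / z))) 0 r0'
    (18 * 1^-1 * (principal_const * (4 / 3)) * 2 ^+ 2).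
  apply: (@gsum_hol R V (bump 0 1) 1^-1 0 2 (fun x z => principal (z *: v' + x) / z)) => //.
  - exact: bump_lip.
  - by have := @bump_supp _ (0 : C) 1 ltr01; rewrite mulr1.
  exists (1 / 4); split; first by rewrite divr_gt0.
  move=> z; have [hz|hz] := pselect (on_ring 0 1 z); last by right; exact: bump_off_ring hz.
  left => x; rewrite subr0 => hx; move: hz => /andP[]; rewrite subr0 => z1 z2.
  have z4 : normc z < 4 by lra.
  have z16 : 1 / 16 <= normc z by lra.
  have hb := in_ball' hx z4.
  split.
    have did : differentiable (fun y : V => y) x by [].
    have dl : differentiable (fun y => z *: v' + y) x.
      exact: (differentiableD (differentiable_cst _ _) did).
    have Pz : P (z *: v' + x) != 0.
      by rewrite -cnorm_gt0; have := ring_low' hx z16 z4; have := T0'; lra.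
    have dp := differentiable_comp (f := fun y => z *: v' + y) dl (diff_principal hb Pz).
    exact: (differentiableM dp (differentiable_cst _ _)).
  rewrite cnormM cnormV; apply: ler_pM; rewrite ?invr_ge0 ?cnorm_ge0 //.
    exact: principal_le.
  by rewrite -invf_div lef_pV2 ?posrE //; lra.
move=> x hx; have [h1 h2] := H x hx; split.
  exact: (differentiableM h1 (differentiable_cst _ _)).
rewrite /regular /cint cnormM cnormV /regular_const ler_wpM2r ?invr_ge0 ?cnorm_ge0 //.
Qed.

Definition approx n x := regular x + \sum_(k < n) P x ^+ k * acoef k.+2 x.
Definition error_const n := 3 * coef_const n + Md * Kg * Ag ^+ n * G n.

Lemma error_const_ge0 n : 0 <= error_const n.
Proof.
apply: addr_ge0; first exact: mulr_ge0 (ler0n _ _) (coef_const_ge0 n).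
apply: mulr_ge0 (ltW (G_gt0 n)); apply: mulr_ge0; last by rewrite exprn_ge0 // ltW.
exact: mulr_ge0 Md0 (ltW Kg0).
Qed.

Lemma approx_error n j x : nrm x < r0' -> S j (P x) ->
  normc (f j x - approx n x) <= error_const n * normc (P x) ^+ n.
Proof.
move=> hx Sj; have Px : P x != 0 by apply/eqP => Px; apply: (@S0 j); rewrite -Px.
have pp : 0 < normc (P x) by rewrite cnorm_gt0.
have hx1 := r0'_r1 hx.
have hxP : nrm x < rP by have := r1P; have := r10; lra.
have p1 : normc (P x) <= 1 by have := P_small hx1; have := T1; lra.
have [i ci] := chi_supp Px.
have h1 := f_diff_principal n hx1 Px ci.
have h2 := hd hxP Sj (chi_cone ci).
have h3 := ler_wpM2l Md0 (flat n pp).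
have h4 : normc (P x) ^+ (n + 6) <= normc (P x) ^+ n.
  by apply: ler_wiXn2l; rewrite ?cnorm_ge0 ?leq_addr.
have MK : 0 <= Md * Kg * Ag ^+ n * G n.
  apply: mulr_ge0 (ltW (G_gt0 n)); apply: mulr_ge0; last by rewrite exprn_ge0 // ltW.
  exact: mulr_ge0 Md0 (ltW Kg0).
have h5 := ler_wpM2l MK h4.
have h6 : Md * (Kg * Ag ^+ n * G n * normc (P x) ^+ (n + 6)) =
  Md * Kg * Ag ^+ n * G n * normc (P x) ^+ (n + 6) by ring.
have -> : f j x - approx n x = (f j x - f i x) +
   (f i x - principal x - \sum_(k < n) P x ^+ k * acoef k.+2 x).
  by rewrite /approx regular_eq //; ring.
apply: le_trans (cnormD _ _) _; rewrite /error_const mulrDl addrC; apply: lerD => //.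
by apply: le_trans h2 (le_trans h3 _); rewrite h6.
Qed.

Lemma approx_hol n : exists M, ball_hol (approx n) 0 r0' M.
Proof.
have reg := regular_hol.
have X0 k := coef_const_ge0 k.
exists (regular_const + \sum_(k < n) coef_const k.+2) => x hx; have [d1 b1] := reg x hx.
have hx' : nrm x < r0' by rewrite -[x]subr0.
have hx1 := r0'_r1 hx'; have xr : nrm (x - 0) < r0 by rewrite subr0; exact: near_r0.
have xP : nrm (x - 0) < rP by rewrite subr0; have := r1P; have := r10; lra.
have [dP _] := hP xP.
have p1 : normc (P x) <= 1 by have := P_small hx1; have := T1; lra.
have dPk k : differentiable (fun y => P y ^+ k) x.
  elim: k => [|k IH]; first exact: differentiable_cst.
  have -> : (fun y => P y ^+ k.+1) = (fun y => P y * P y ^+ k).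
    by apply/funext => y; rewrite exprS.
  exact: (differentiableM dP IH).
split.
  apply: (differentiableD d1); apply: (@diff_sum R V _ _ (fun (k : 'I_n) y => P y ^+ k * acoef k.+2 y)) => k.
  by have [dk _] := acoef_hol k.+2 xr; exact: (differentiableM (dPk k) dk).
apply: le_trans (cnormD _ _) _; apply: lerD => //.
apply: le_trans (cnorm_sum _ _ _) _; apply: ler_sum => k _.
have [_ h] := acoef_hol k.+2 xr; rewrite cnormM cnormX -[leRHS]mul1r.
apply: ler_pM; rewrite ?exprn_ge0 ?cnorm_ge0 //.
by rewrite exprn_ile1 ?cnorm_ge0.
Qed.

(** At zeros of [P] only two terms are left; elsewhere [f j] is
    bounded. *)
Lemma approx_le n x : nrm x < r0' -> normc (approx n x) <= Bf + error_const n + regular_const + coef_const 0.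
Proof.
move=> hx; have X0 := coef_const_ge0 0; have B0 := Bf0; have Y0 := error_const_ge0 n.
have hx0 : nrm (x - 0) < r0' by rewrite subr0.
have hx1 := r0'_r1 hx; have [_ rc] := regular_hol hx0.
have rc0 : 0 <= regular_const by apply: le_trans rc; exact: cnorm_ge0.
have [Px|Px] := eqVneq (P x) 0.
  have a2 : normc (acoef 2 x) <= coef_const 0 by apply: acoef_le => //; exact: near_r0.
  apply: le_trans (cnormD _ _) _.
  have h n' : normc (\sum_(k < n') P x ^+ k * acoef k.+2 x) <= coef_const 0.
    case: n' => [|n']; first by rewrite big_ord0 cnorm0.
    rewrite big_ord_recl /= expr0 mul1r big1 ?addr0 // => k _.
    by rewrite Px expr0n /= mul0r.
  by apply: le_trans (lerD rc (h n)) _; rewrite lerD2r; lra.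
have [j cj] := chi_supp Px; have h := approx_error n hx (chi_cone cj).
have hxP : nrm x < rP by have := r1P; have := r10; lra.
have [_ fb] := hf hxP (chi_cone cj).
have p1 : normc (P x) <= 1 by have := P_small hx1; have := T1; lra.
have h2 : error_const n * normc (P x) ^+ n <= error_const n.
  by rewrite ler_piMr // exprn_ile1 ?cnorm_ge0.
have := cnorm_sub (approx n x) (f j x); rewrite cdistC; lra.
Qed.

Lemma approx_vanish n : vanish (fun x => approx n.+1 x - approx n x) n.
Proof.
have [M1 h1] := approx_hol n; have [M2 h2] := approx_hol n.+1.
exists r0', (M2 + M1), (lip_const MP rP ^+ n * coef_const n); split; first exact: r00'.
  move=> x hx; have [d1 b1] := h1 x hx; have [d2 b2] := h2 x hx.
  split; first exact: (differentiableB d2 d1).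
  by apply: le_trans (cnormB _ _) _; exact: lerD.
move=> x hx; have hx1 := r0'_r1 hx.
have -> : approx n.+1 x - approx n x = P x ^+ n * acoef n.+2 x.
  by rewrite /approx big_ord_recr /=; ring.
have -> : lip_const MP rP ^+ n * coef_const n * nrm x ^+ n = (lip_const MP rP * nrm x) ^+ n * coef_const n.
  by move: (coef_const n) (lip_const MP rP) => X L; rewrite exprMn; ring.
rewrite cnormM cnormX.
apply: (ler_pM (exprn_ge0 _ (cnorm_ge0 _)) (cnorm_ge0 _)).
  have hxP : nrm x < rP / 2 by have := r1P; lra.
  have h3 := P_lip hxP; have h4 := le_trans (cnorm_ge0 _) h3.
  by rewrite lerXn2r ?nnegrE ?cnorm_ge0.
exact: acoef_le (near_r0 hx1) (lt_index2 n).
Qed.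

Lemma final_bounds : exists K A, [/\ 0 < K, 0 < A &
  forall n, error_const n <= K * A ^+ n * G n /\ Bf + error_const n + regular_const + coef_const 0 <= K * A ^+ n * G n].
Proof.
have bc := bound_const_ge0; have ec := expansion_const_ge0; have t16 := T16.
pose g0 := expR (- 2) : R; have g00 : 0 < g0 := expR_gt0 _.
have gG n : g0 <= G n := Gamma_lower_cst n s0.
pose A := 16 / T * (2 * Ag + 1).
have Ag1 : 1 <= 2 * Ag + 1 by have := Ag0; lra.
have A1 : 1 <= A by rewrite /A; apply: (le_trans t16); rewrite ler_peMr //; lra.
have A0 : 0 < A by lra.
have E0 : 0 <= expansion_const I dr Cc * (16 / T) ^+ 6.
  by apply: mulr_ge0 ec _; apply: exprn_ge0; lra.
pose W := bound_const * Md * Kg * 2 ^+ 6.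
have W0 : 0 <= W.
  by apply: mulr_ge0 (exprn_ge0 _ (ler0n _ _)); apply: mulr_ge0 (ltW Kg0); exact: mulr_ge0.
have one n : g0 <= A ^+ n * G n.
  have h : 1 <= A ^+ n by rewrite exprn_ege1.
  by apply: le_trans (gG n) _; rewrite ler_peMl // ltW // G_gt0.
pose KX := expansion_const I dr Cc * (16 / T) ^+ 6 * (lifted_bound / g0 + W).
have KX0 : 0 <= KX.
  by apply: mulr_ge0 => //; apply: addr_ge0 => //; exact: divr_ge0 lifted_bound_ge0 (ltW g00).
have Xb n : coef_const n <= KX * (A ^+ n * G n).
  have pA : (2 * Ag) ^+ n <= (2 * Ag + 1) ^+ n.
    by rewrite lerXn2r ?nnegrE //; have := Ag0; lra.
  have p1 : 1 <= (2 * Ag + 1) ^+ n by rewrite exprn_ege1.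
  have Gn := G_gt0 n.
  have h1 : lifted_bound <= lifted_bound / g0 * ((2 * Ag + 1) ^+ n * G n).
    rewrite mulrAC ler_pdivlMr // ler_wpM2l ?lifted_bound_ge0 //.
    by apply: le_trans (gG n) _; rewrite ler_peMl // ltW.
  have h2 : gap n <= W * ((2 * Ag + 1) ^+ n * G n).
    by rewrite /gap -/W -mulrA ler_wpM2l // ler_wpM2r // ltW.
  have E1 : 0 <= expansion_const I dr Cc * (16 / T) ^+ n.+4.+2.
    by apply: mulr_ge0 ec _; apply: exprn_ge0; lra.
  rewrite /coef_const; apply: le_trans (ler_wpM2l E1 (lerD h1 h2)) _.
  rewrite -mulrDl /KX /A (_ : n.+4.+2 = n + 6)%N; last by rewrite addnC.
  rewrite le_eqVlt; apply/orP; left; apply/eqP.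
  move: (expansion_const I dr Cc) (16 / T) (lifted_bound / g0 + W) (2 * Ag + 1) (G n) => c q w u g.
  by rewrite exprD exprMn; ring.
pose KY := 3 * KX + Md * Kg.
have KY0 : 0 <= KY by apply: addr_ge0; [exact: mulr_ge0|exact: mulr_ge0 Md0 (ltW Kg0)].
have Yb n : error_const n <= KY * (A ^+ n * G n).
  have h : Md * Kg * Ag ^+ n * G n <= Md * Kg * (A ^+ n * G n).
    rewrite -!mulrA; apply: ler_wpM2l => //; apply: ler_wpM2l; first exact: ltW.
    apply: ler_wpM2r; first exact: ltW (G_gt0 n).
    rewrite lerXn2r ?nnegrE ?(ltW Ag0) ?(ltW A0) //.
    apply: (@le_trans _ _ (1 * (2 * Ag + 1))); first by have := Ag0; lra.
    by apply: ler_wpM2r => //; have := Ag0; lra.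
  apply: le_trans (lerD (ler_wpM2l (ler0n _ 3) (Xb n)) h) _.
  by rewrite /KY le_eqVlt; apply/orP; left; apply/eqP; move: (KX) (A ^+ n) (G n) => *; ring.
have rc0 : 0 <= regular_const.
  have z0 : nrm (0 - 0 : V) < r0' by rewrite subrr nrm0.
  by have [_ h] := regular_hol z0; apply: le_trans h; exact: cnorm_ge0.
have X0 := coef_const_ge0 0; have B0 := Bf0.
pose c := Bf + regular_const + coef_const 0.
have c0' : 0 <= c by rewrite /c; lra.
have cb n : c <= c / g0 * (A ^+ n * G n).
  by rewrite mulrAC ler_pdivlMr // ler_wpM2l.
have cg : 0 <= c / g0 by exact: divr_ge0 c0' (ltW g00).
exists (KY + c / g0 + 1), A; split => //; first by lra.
move=> n; have o := one n; have y := Yb n.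
have cn : Bf + regular_const + coef_const 0 <= c / g0 * (A ^+ n * G n) := cb n.
have Z0 : 0 <= A ^+ n * G n by lra.
have z1 : 0 <= c / g0 * (A ^+ n * G n) by exact: mulr_ge0.
have z2 : 0 <= KY * (A ^+ n * G n) by exact: mulr_ge0.
clearbody c KY; rewrite -mulrA !mulrDl mul1r.
set KZ := KY * _ in y z2 *; set cZ := c / g0 * _ in cn z1 *; set Z := A ^+ n * _ in Z0 *.
have Y0 := error_const_ge0 n.
clearbody KZ cZ Z; move: (error_const n) (coef_const 0) y cn X0 Y0 => Y X y cn X0' Y0.
split; lra.
Qed.

End SecondLine.
End FirstLine.

(** Two directions are used: one for the lift, and one at a smaller scale, whose
    lines stay in the domain of the coefficients, for the continuation of the
    principal part. *)
Theorem common_expansion : exists (rho : R) (fn : nat -> V -> C) (K A : R),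
  [/\ 0 < rho, 0 < K & 0 < A] /\
  [/\ forall n, ball_hol (fn n) 0 rho (K * A ^+ n * G n),
      forall n, vanish (fun x => fn n.+1 x - fn n x) n &
      forall n j x, nrm x < rho -> S j (P x) ->
        normc (f j x - fn n x) <= K * A ^+ n * G n * normc (P x) ^+ n].
Proof.
have [Kg [Ag [Kg0 Ag0 flat]]] := gevrey_flat s0 gam0.
have [v [r0 [T [r00 T0 T1 inb low]]]] := good_line rP0 hP Pn0 rP0 (lexx rP).
have LP0 := lip_const_ge0; have LP1 : 0 < lip_const MP rP + 1 by lra.
pose r1 := Num.min rP (Num.min r0 (T / 8 / (lip_const MP rP + 1))).
have r10 : 0 < r1 by rewrite !lt_min rP0 r00 divr_gt0 // divr_gt0.
have r1P : r1 <= rP by rewrite ge_min lexx.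
have r1r : r1 / 2 <= r0.
  have : r1 <= r0 by rewrite !ge_min lexx !orbT.
  by have := r00; lra.
have Psmall y : nrm y < r1 / 2 -> normc (P y) <= T / 8.
  move=> hy; have y2 : nrm y < rP / 2 by lra.
  apply: le_trans (P_lip y2) _.
  have : nrm y * (lip_const MP rP + 1) <= T / 8.
    rewrite -ler_pdivlMr //; apply: (@le_trans _ _ r1); last by rewrite !ge_min lexx !orbT.
    lra.
  have := nrm_ge0 y; lra.
have [v' [r0' [T' [r00' T0' _ inb' low']]]] := good_line rP0 hP Pn0 r10 r1P.
have [K [A [K0' A0 KA]]] := final_bounds r00 T0 T1 inb low Kg0 Ag0 flat r10 r1P r1r r00' T0' inb' low' Psmall.
exists r0', (approx v T v'), K, A; split; first by split.
split.
- move=> n x hx.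
  have [M h] := approx_hol r00 T0 T1 inb low Kg0 Ag0 flat r10 r1P r1r r00' T0' inb' low' Psmall n.
  have [d _] := h x hx; split => //; rewrite subr0 in hx.
  have [_ hK] := KA n; apply: le_trans hK.
  exact: (approx_le r00 T0 T1 inb low Kg0 Ag0 flat r10 r1P r1r r00' T0' inb' low' Psmall n hx).
- by move=> n; exact: (approx_vanish r00 T0 T1 inb low Kg0 Ag0 flat r10 r1P r1r r00' T0' inb' low' Psmall).
move=> n j x hx Sj; have [hK _] := KA n.
apply: le_trans (approx_error r00 T0 T1 inb low Kg0 Ag0 flat r10 r1P r1r T0' inb' low' Psmall n hx Sj) _.
by apply: ler_wpM2r; rewrite ?exprn_ge0 ?cnorm_ge0.
Qed.

End Assembly.

(** * The theorem *)

Lemma common_bound (R : realType) (I : finType) (Q : I -> R -> Prop) :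
  (forall i (M M' : R), M <= M' -> Q i M -> Q i M') -> (forall i, exists M, Q i M) ->
  exists M, 0 <= M /\ forall i, Q i M.
Proof.
move=> mono ex; pose M i := projT1 (cid (ex i)).
have hM i : Q i (M i) by rewrite /M; case: cid.
exists (\sum_i `|M i|); split; first exact: sumr_ge0.
move=> i; apply: mono (hM i); apply: le_trans (ler_norm _) _.
by rewrite (bigD1 i) //= lerDl sumr_ge0.
Qed.

Lemma differentiable_ball_hol (R : realType) (V : normedModType (CC R)) (f : V -> CC R) (r : R) :
  0 < r -> (forall x, nrm x < r -> differentiable f x) ->
  exists rho M, [/\ 0 < rho, rho <= r & ball_hol f 0 rho M].
Proof.
move=> r0 df; have x0 : nrm (0 : V) < r by rewrite nrm0.
have /cvgr_dist_lt/(_ 1 ltr01)/nearP [d [d0 hd]] := differentiable_continuous (df 0 x0).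
exists (Num.min r d), (normc (f 0) + 1); split; first by rewrite lt_min r0 d0.
  by rewrite ge_min lexx.
move=> x; rewrite subr0 lt_min => /andP[xr xd]; split; first exact: df.
have := hd x; rewrite subr0 => /(_ xd); rewrite nrmE nrmC ltcR => h.
by have := cnorm_sub (f x) (f 0); rewrite cdistC; lra.
Qed.

Theorem theorem7p18 (R : realType) (d : nat) (hd : (2 <= d)%N)
    (P : 'rV[CC R]_d -> CC R) (s r : R) (hs : 0 < s) (hr : 0 < r)
    (P_holo : holomorphic_on (polydisc r) P)
    (P_neq0 : ~ (\forall x \near (0 : 'rV[CC R]_d), P x = 0))
    (P0 : P 0 = 0)
    (m : nat) (a b : 'I_m -> R)
    (hab : forall j, a j < b j /\ b j - a j <= 2 * pi)
    (hcover : polydisc r `\` [set x | P x = 0] `<=`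
              \bigcup_(j in [set: 'I_m]) P_sector P (a j) (b j) r)
    (f : 'I_m -> 'rV[CC R]_d -> CC R)
    (f_holo : forall j, holomorphic_on (P_sector P (a j) (b j) r) (f j))
    (f_bounded : forall j, bounded_on (P_sector P (a j) (b j) r) (f j))
    (f_diff : exists gamma : R, 0 < gamma /\
       forall j1 j2,
         P_sector P (a j1) (b j1) r `&` P_sector P (a j2) (b j2) r !=set0 ->
         exists M : R, forall x,
           P_sector P (a j1) (b j1) r x -> P_sector P (a j2) (b j2) r x ->
           normc (f j1 x - f j2 x) <=
             M * expR (- (gamma / normc (P x) `^ s^-1))) :
  exists fhat : fps R d, forall j : 'I_m,
    gevrey_expansion P s (P_sector P (a j) (b j) r) (f j) fhat.
Proof.
have hP x : nrm x < r -> differentiable P x.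
  by move=> hx; apply: P_holo; apply/(polydiscE _ hr).
have [rP [MP [rP0 rPr PH]]] := differentiable_ball_hol hr hP.
pose S j := cone (a j) (b j).
have sector j y : nrm y < rP -> S j (P y) -> P_sector P (a j) (b j) r y.
  move=> hy [Py th]; split; last by split.
  by apply/(polydiscE _ hr); exact: lt_le_trans rPr.
have [gam [gam0 hgam]] := f_diff.
have [Bf [Bf0 hBf]] := common_bound (fun j M M' (MM : M <= M') (h : forall x,
  P_sector P (a j) (b j) r x -> normc (f j x) <= M) x hx => le_trans (h x hx) MM) f_bounded.
have [|ij|Md [Md0 hMd]] := @common_bound R ('I_m * 'I_m)%type (fun ij M => forall x,
    P_sector P (a ij.1) (b ij.1) r x -> P_sector P (a ij.2) (b ij.2) r x ->
    normc (f ij.1 x - f ij.2 x) <= M * expR (- (gam / normc (P x) `^ s^-1))).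
- move=> ij M M' MM h x h1 h2; apply: le_trans (h x h1 h2) _.
  by apply: ler_wpM2r => //; exact: expR_ge0.
- have [ne|ne] := pselect (P_sector P (a ij.1) (b ij.1) r `&` P_sector P (a ij.2) (b ij.2) r !=set0).
    exact: hgam.
  by exists 0 => x h1 h2; exfalso; apply: ne; exists x.
have S0 j : ~ S j 0 by exact: cone0.
have cover (w : CC R) : w != 0 -> exists j, S j w.
  move=> w0; have wp : 0 < normc w by rewrite cnorm_gt0.
  have [v [r0 [T [r00 T0 T1 inb low]]]] := good_line rP0 PH P_neq0 rP0 (lexx rP).
  have K1 : 0 < K0 R + 1 by have := K0_gt0 R; lra.
  pose c := T / (K0 R + 1) / normc w; have c0' : 0 < c by rewrite !divr_gt0.
  have cw : normc (c%:C * w) = T / (K0 R + 1).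
    by rewrite cnormM cnorm_real gtr0_norm // /c divfK // gt_eqF.
  have cw0 : 0 < normc (c%:C * w) by rewrite cw divr_gt0.
  have cwT : normc (c%:C * w) <= T / (K0 R + 1) by rewrite cw.
  have [y [hy Py]] := small_values PH rP0 (lexx rP) T0 r00 inb low P0 cw0 cwT.
  have [|j _ [_ [Py0 th]]] := hcover y.
    split; first by apply/(polydiscE _ hr); lra.
    by rewrite /= Py => e; move: cw0; rewrite e cnorm0 ltxx.
  exists j; have Sy : S j (P y) by split.
  have ci : 0 < c^-1 by rewrite invr_gt0.
  have := cone_scale ci Sy; rewrite Py mulrA -rcM mulVf ?gt_eqF // mul1r.
  exact.
have [de [de0 de1 leb]] := lebesgue_cone (fun j c w => @cone_scale R (a j) (b j) c w)
  (fun j w => @cone_open R (a j) (b j) w) cover.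
have hf j y : nrm y < rP -> S j (P y) -> differentiable (f j) y /\ normc (f j y) <= Bf.
  by move=> hy Sy; have h := sector j y hy Sy; split; [exact: f_holo|exact: hBf].
have hdf i j y : nrm y < rP -> S i (P y) -> S j (P y) ->
    normc (f i y - f j y) <= Md * expR (- (gam / normc (P y) `^ s^-1)).
  by move=> hy Si Sj; apply: (hMd (i, j)); exact: sector.
have [rho [fn [K [A [[rho0 K0' A0] [fh fv fe]]]]]] :=
  common_expansion rP0 PH P0 P_neq0 Bf0 Md0 gam0 hs de0 de1 S0 leb hf hdf.
have fhol0 n : hol0 (fn n) by exists rho; eexists; split; [exact: rho0|exact: fh].
have [fhat hfhat] := madic_limit fhol0 fv.
exists fhat => j; exists rho, fn, K, A; split; first by split.
have near x : polydisc rho x -> nrm (x - 0) < rho by move=> /(polydiscE _ rho0); rewrite subr0.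
split => //.
- move=> n; split; first by move=> x /near hx; have [] := fh n x hx.
  by eexists => x /near hx; have [_] := fh n x hx; exact.
- by move=> n x /near hx; have [_] := fh n x hx.
move=> n x [_ [Px th]] /near hx; apply: fe; first by rewrite -[x]subr0.
by split.
Qed.
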